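(* Let $\nu\ge 1$ be an integer and let $\boldsymbol\omega\in\mathbb{R}^{\nu}$ satisfy $\boldsymbol n\cdot\boldsymbol\omega\neq 0$ for every $\boldsymbol n\in\mathbb{Z}^\nu$, $\boldsymbol n\neq 0$. Consider the ``good'' Boussinesq equation $$u_{tt}+u_{xxxx}-u_{xx}-(u^{2})_{xx}=0,\qquad x\in\mathbb{R},\ t>0, \tag{E}$$ with the quasi-periodic initial conditions $$u(0,x)=\sum_{\boldsymbol n\in\mathbb{Z}^{\nu}}c(\boldsymbol n)\exp(\mathrm{i}x\,\boldsymbol n\cdot\boldsymbol\omega),\qquad \partial_t u(0,x)=\sum_{\boldsymbol n\in\mathbb{Z}^{\nu}}c'(\boldsymbol n)\exp(\mathrm{i}x\,\boldsymbol n\cdot\boldsymbol\omega). \tag{I}$$ Suppose that for two positive constants $B,\kappa$ and all $\boldsymbol n\in\mathbb{Z}^\nu$, $$|c(\boldsymbol n)|\le B\exp\left(-\frac{\kappa|\boldsymbol n|}{2}\right),\qquad |c'(\boldsymbol n)|\le B|\boldsymbol\omega|\exp\left(-\frac{\kappa|\boldsymbol n|}{2}\right).$$ Then there exists $t_0>0$ such that for $0\le t<t_0$, $x\in\mathbb{R}$, one can construct a function $$u(t,x)=\sum_{\boldsymbol n\in\mathbb{Z}^{\nu}}c(t,\boldsymbol n)\exp(\mathrm{i}x\,\boldsymbol n\cdot\boldsymbol\omega)$$ which satisfies equation (E) with the initial conditions (I). Moreover, with $\lambda=\left((\boldsymbol n\cdot\boldsymbol\omega)^2+(\boldsymbol n\cdot\boldsymbol\omega)^4\right)^{1/2}$,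 $$\begin{aligned}c(t,\boldsymbol n)=\;&\frac12 c(\boldsymbol n)\left(e^{\mathrm{i}t\lambda}+e^{-\mathrm{i}t\lambda}\right)-\frac{\mathrm{i}}{2\lambda}c'(\boldsymbol n)\left(e^{\mathrm{i}t\lambda}-e^{-\mathrm{i}t\lambda}\right)\\&-\frac{\mathrm{i}}{\lambda}\int_0^t\left(e^{\mathrm{i}(\tau-t)\lambda}-e^{\mathrm{i}(t-\tau)\lambda}\right)\sum_{\boldsymbol m\in\mathbb{Z}^\nu}(\boldsymbol m\cdot\boldsymbol\omega)(\boldsymbol n\cdot\boldsymbol\omega)\,c(\tau,\boldsymbol m)\,c(\tau,\boldsymbol n-\boldsymbol m)\,\mathrm{d}\tau\end{aligned}$$ and $$|c(t,\boldsymbol n)|\le 2B\exp\left(-\frac{\kappa|\boldsymbol n|}{4}\right)$$ for all $\boldsymbol n\in\mathbb{Z}^\nu$ and $0\le t<t_0$. Furthermore, if a function $$v(t,x)=\sum_{\boldsymbol n\in\mathbb{Z}^\nu}h(t,\boldsymbol n)\exp(\mathrm{i}x\,\boldsymbol n\cdot\boldsymbol\omega),\qquad 0\le t<t_0,\ x\in\mathbb{R},$$ is also a solution of equation (E) with initial conditions (I) and satisfies, for some positive constants $C_1,\rho$, $$|h(t,\boldsymbol n)|\le C_1\exp(-\rho|\boldsymbol n|)\qquad(\boldsymbol n\in\mathbb{Z}^\nu,\ 0\le t<t_0),$$ then there exists $t_1>0$ such that $v(t,x)=u(t,x)$ for $0\le t\le t_1$, $x\in\mathbb{R}$.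
   Context: For $\boldsymbol y\in\mathbb{R}^\nu$, $|\boldsymbol y|=\sum_{j=1}^\nu|y_j|$ is the $\ell^1$-norm; $\boldsymbol n\cdot\boldsymbol\omega=\sum_{j=1}^{\nu}n_j\omega_j$. For $\boldsymbol n=0$ one has $\lambda=0$, and the expressions with $\lambda$ in the denominator are read as their limits as $\lambda\to0$: $-\frac{\mathrm{i}}{2\lambda}(e^{\mathrm{i}t\lambda}-e^{-\mathrm{i}t\lambda})=\frac{\sin(\lambda t)}{\lambda}$ is read as $t$, and the integral term is zero (it carries the factor $\boldsymbol n\cdot\boldsymbol\omega=0$). *)

(* Defs.v *)
From mathcomp Require Import all_boot all_algebra.
From mathcomp Require Export Rstruct.
From Stdlib Require Export Reals.
From Coquelicot Require Export Coquelicot.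

Set Implicit Arguments.
Unset Strict Implicit.
Unset Printing Implicit Defensive.

(* [%R] denotes Stdlib's [R_scope] here, so the MathComp ring operations get
   a delimiter of their own. *)
Delimit Scope ring_scope with ring.
Delimit Scope R_scope with R.

Section Lattice.
Import GRing.Theory.
Local Open Scope ring_scope.

(* The arithmetic on [R] below is the usual one, through the MathComp
   instances of [Rstruct]. *)
Definition dot (nu : nat) (n : 'rV[int]_nu) (omega : 'rV[R]_nu) : R :=
  \sum_(j < nu) (n ord0 j)%:~R * omega ord0 j.

Definition l1norm (nu : nat) (y : 'rV[R]_nu) : R :=
  \sum_(j < nu) Rabs (y ord0 j).

Definition l1normZ (nu : nat) (n : 'rV[int]_nu) : R :=
  l1norm (map_mx (fun k : int => k%:~R : R) n).

End Lattice.

Local Open Scope R_scope.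

(* e^{i theta} *)
Definition expi (theta : R) : C := (cos theta, sin theta).

(* Unconditional convergence: the finite partial sums converge to [S] along
   the finite sets of indices ordered by inclusion. *)
Definition is_usum (I : eqType) (f : I -> C) (S : C) : Prop :=
  forall eps : posreal, exists F0 : seq I, forall F : seq I,
    uniq F -> {subset F0 <= F} ->
    Cmod (\big[Cplus/RtoC 0]_(m <- F) f m - S)%C < eps.

Definition is_qp_sum (nu : nat) (omega : 'rV[R]_nu) (a : 'rV[int]_nu -> C)
    (x : R) (S : C) : Prop :=
  is_usum (fun n => (a n * expi (x * dot n omega))%C) S.

(* [l] is the k-th derivative at [x] of the complex-valued function [f] of a
   real variable; Coquelicot's [is_derive_n] covers real-valued [f] only. *)
Fixpoint is_Cderive_n (f : R -> C) (k : nat) (x : R) (l : C) : Prop :=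
  match k with
  | O => f x = l
  | S k' => exists g : R -> C,
      locally x (fun y => is_Cderive_n f k' y (g y)) /\
      is_derive (K := R_AbsRing) (V := C_R_NormedModule) g x l
  end.

Definition is_right_Cderive (f : R -> C) (x : R) (l : C) : Prop :=
  filterlim (fun s : R => ((f s - f x) / RtoC (s - x))%C)
    (at_right x) (locally (T := C_UniformSpace) l).

(* Classical solution of u_tt + u_xxxx - u_xx - (u^2)_xx = 0 for 0 < t < T. *)
Definition good_boussinesq (T : R) (u : R -> R -> C) : Prop :=
  forall t x : R, 0 < t < T ->
  exists utt uxxxx uxx u2xx : C,
    is_Cderive_n (fun s => u s x) 2 t utt /\
    is_Cderive_n (fun y => u t y) 4 x uxxxx /\
    is_Cderive_n (fun y => u t y) 2 x uxx /\
    is_Cderive_n (fun y => (u t y * u t y)%C) 2 x u2xx /\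
    (utt + uxxxx - uxx - u2xx)%C = RtoC 0.

(* Functions on [0, T) are total functions whose values outside are junk, so
   the time derivative at 0 is one-sided. *)
Definition initial_data (nu : nat) (omega : 'rV[R]_nu)
    (c c' : 'rV[int]_nu -> C) (u : R -> R -> C) : Prop :=
  forall x : R,
    is_qp_sum omega c x (u 0 x) /\
    exists ut : C,
      is_qp_sum omega c' x ut /\ is_right_Cderive (fun t => u t x) 0 ut.

Definition disp (nu : nat) (omega : 'rV[R]_nu) (n : 'rV[int]_nu) : R :=
  sqrt (dot n omega ^ 2 + dot n omega ^ 4).

(* -(i / (2 lambda)) (e^{i t lambda} - e^{-i t lambda}), continued by its
   limit t at lambda = 0. *)
Definition sine_kernel (lambda t : R) : C :=
  if Req_EM_T lambda 0 then RtoC t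
  else (- (Ci / RtoC (2 * lambda))
        * (expi (t * lambda) - expi (- (t * lambda))))%C.

(* -(i / lambda) J, read as 0 at lambda = 0: there n.omega = 0, and n.omega is
   a factor of the integrand of J. *)
Definition integral_term (lambda : R) (J : C) : C :=
  if Req_EM_T lambda 0 then RtoC 0 else (- (Ci / RtoC lambda) * J)%C.

(* Convergence of the series and Riemann integrability of the integrand are
   part of the formula. *)
Definition duhamel_formula (nu : nat) (omega : 'rV[R]_nu)
    (c c' : 'rV[int]_nu -> C) (ct : R -> 'rV[int]_nu -> C)
    (t : R) (n : 'rV[int]_nu) : Prop :=
  let lambda := disp omega n in
  exists (Q : R -> C) (J : C),
    (forall tau : R, 0 <= tau <= t ->
       is_usum (fun m : 'rV[int]_nu =>
           (RtoC (dot m omega * dot n omega)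
            * ct tau m * ct tau (n - m)%ring)%C)
         (Q tau)) /\
    is_RInt (V := C_R_NormedModule)
      (fun tau : R =>
         ((expi ((tau - t) * lambda) - expi ((t - tau) * lambda)) * Q tau)%C)
      0 t J /\
    ct t n =
      (RtoC (1 / 2) * c n * (expi (t * lambda) + expi (- (t * lambda)))
       + c' n * sine_kernel lambda t
       + integral_term lambda J)%C.

(* Main.v *)
(* On Fourier coefficients the equation reads
   c_tt(n) + lambda_n^2 c(n) = - (n.omega)^2 (c * c)(n).  The Duhamel kernel
   sin(lambda_n t) / lambda_n times (n.omega)^2 is bounded by 1, so no derivative is
   lost.  The weight exp(- s |n|) (1 + |n|)^(- 2 nu) is submultiplicative for
   convolution up to a constant, and Picard iteration therefore contracts, for a short
   time, in the space of coefficients bounded by a multiple of this weight with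
   s = kappa / 4; the exponential decay makes termwise differentiation legitimate.

   For uniqueness, the coefficients of a quasi-periodic series are bounded by its
   supremum.  For a solution v with exponentially decaying coefficients h, the
   equation gives v_tt = sum_n g(t, n) exp(i x n.omega), with g bounded and decaying;
   hence v is Lipschitz in t uniformly in x, so each h(., n), and with it g(., n), is
   continuous.  Integrating g twice in time yields a series with the same second time
   derivative and the same data as v.  So h(., n) is twice differentiable, solves the
   oscillator equation above, and the contraction estimate applies to h - c. *)

Require Import Defs.
From mathcomp Require Import all_boot all_algebra.
From Stdlib Require Import Reals Lra Lia ClassicalEpsilon FunctionalExtensionality.
From Coquelicot Require Import Coquelicot.
From HB Require Import structures.

Set Implicit Arguments.
Unset Strict Implicit.
Unset Printing Implicit Defensive.

Delimit Scope ring_scope with ring.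
Delimit Scope R_scope with R.
Local Open Scope R_scope.

(** The coefficients bounded by a multiple of the plain weight exp(- s |n|) are not closed under
    convolution: for each m lying coordinatewise between 0 and n the product exp(- s |m|) exp(- s |n
    - m|) equals exp(- s |n|), and there are prod_j (1 + |n_j|) such m. The polynomial factor
    repairs this at the price of rate: data of rate kappa / 2 fit into the weighted space of rate
    kappa / 4. The constant 2 B is reached because the contribution of the data is also kept in its
    plain exponential form, and only the nonlinear term is measured in the weight.

    Interior time derivatives are two-sided, whereas solutions live on [0, t0). Coefficients are
    therefore extended continuously to the whole line by clamping time; the Duhamel expression built
    on such a source is twice differentiable everywhere, in particular at 0.

    For uniqueness the obstacle is that h(., n) comes with no regularity in time at all, so that its
    oscillator equation cannot even be written down at first; regularity has to be carried over from
    v to its coefficients. *)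

HB.instance Definition _ := Monoid.isComLaw.Build C (RtoC 0) Cplus Cplus_assoc Cplus_comm Cplus_0_l.

Notation "\Csum_ ( i <- r ) F" := (\big[Cplus/RtoC 0]_(i <- r) F)
  (at level 36, F at level 36, i, r at level 50).
Notation "\Rsum_ ( i <- r ) F" := (\big[Rplus/0%R]_(i <- r) F)
  (at level 36, F at level 36, i, r at level 50).

(** * Limits of complex-valued functions along a filter *)

(** The balls of Coquelicot's [C] are squares; limits are stated with [Cmod] instead, so that
    triangle inequalities apply directly. [Clim_filterlim] translates back. The filter stays
    abstract because finite index sets, punctured neighbourhoods and right neighbourhoods all
    occur. *)
Definition Clim (T : Type) (G : (T -> Prop) -> Prop) (f : T -> C) (l : C) : Prop :=
  forall e : R, 0 < e -> G (fun s => Cmod (f s - l)%C < e).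

Lemma filter_weaken (T : Type) (G : (T -> Prop) -> Prop) {FG : Filter G} (P Q : T -> Prop) :
  G P -> (forall s, P s -> Q s) -> G Q.
Proof. by move=> HP PQ; apply: filter_imp HP. Qed.

Lemma Cmod_minus_sym (x y : C) : Cmod (x - y)%C = Cmod (y - x)%C.
Proof. by rewrite -Cmod_opp; congr Cmod; ring. Qed.

Lemma Cmod_minus_eq0 (x y : C) : (forall e, 0 < e -> Cmod (x - y)%C < e) -> x = y.
Proof.
move=> H; have E : Cmod (x - y)%C = 0.
  apply: Rle_antisym; last exact: Cmod_ge_0.
  by apply: le_epsilon => e He; rewrite Rplus_0_l; apply: Rlt_le; apply: H.
by have := Cmod_eq_0 _ E => {}E; rewrite -(Cplus_0_l y) -E; ring.
Qed.

Lemma Cmod_plus_le (x y : C) (a b : R) :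
  Cmod x <= a -> Cmod y <= b -> Cmod (x + y)%C <= a + b.
Proof. by move=> Hx Hy; apply: Rle_trans (Cmod_triangle _ _) _; lra. Qed.

Lemma Cmod_mult_le (x y : C) (a b : R) :
  Cmod x <= a -> Cmod y <= b -> Cmod (x * y)%C <= a * b.
Proof.
by move=> Hx Hy; rewrite Cmod_mult; apply: Rmult_le_compat => //; apply: Cmod_ge_0.
Qed.

Section Clim.
Context {T : Type} {G : (T -> Prop) -> Prop} {FG : Filter G}.

Lemma Clim_ext (f g : T -> C) (l : C) :
  G (fun s => f s = g s) -> Clim G f l -> Clim G g l.
Proof.
move=> E Hf e He; apply: (filter_weaken (filter_and _ _ E (Hf e He))) => s [<- //].
Qed.

Lemma Clim_const (l : C) : Clim G (fun _ => l) l.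
Proof.
move=> e He; apply: filter_forall => s.
by rewrite (_ : (l - l)%C = RtoC 0) ?Cmod_0 //; ring.
Qed.

Lemma Clim_plus (f g : T -> C) (l m : C) :
  Clim G f l -> Clim G g m -> Clim G (fun s => (f s + g s)%C) (l + m)%C.
Proof.
move=> Hf Hg e He.
have e2 : 0 < e / 2 by lra.
apply: (filter_weaken (filter_and _ _ (Hf _ e2) (Hg _ e2))).
move=> s [H1 H2]; rewrite (_ : _ - _ = (f s - l) + (g s - m))%C; last by ring.
by apply: Rle_lt_trans (Cmod_triangle _ _) _; lra.
Qed.

Lemma Clim_mult (f g : T -> C) (l m : C) :
  Clim G f l -> Clim G g m -> Clim G (fun s => (f s * g s)%C) (l * m)%C.
Proof.
move=> Hf Hg e He.
set D := Cmod l + Cmod m + 1.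
have D1 : 1 <= D by rewrite /D; have := Cmod_ge_0 l; have := Cmod_ge_0 m; lra.
set d := Rmin 1 (e / (2 * D)).
have d0 : 0 < d by apply: Rmin_pos; [lra | apply: Rdiv_lt_0_compat; lra].
apply: (filter_weaken (filter_and _ _ (Hf d d0) (Hg d d0))) => s [H1 H2].
rewrite (_ : _ - _ = (f s - l) * g s + l * (g s - m))%C; last by ring.
apply: Rle_lt_trans (Cmod_triangle _ _) _; rewrite !Cmod_mult.
have d1 : d <= 1 by apply: Rmin_l.
have d2 : d * D <= e / 2.
  apply: Rle_trans (Rmult_le_compat_r D _ _ ltac:(lra) (Rmin_r _ _)) _.
  by apply: Req_le; field; lra.
have Hgs : Cmod (g s) <= Cmod m + 1.
  rewrite (_ : g s = m + (g s - m))%C; last by ring.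
  by apply: Rle_trans (Cmod_triangle _ _) _; lra.
have P1 : Cmod (f s - l)%C * Cmod (g s) <= d * (Cmod m + 1).
  by apply: Rmult_le_compat; [exact: Cmod_ge_0 | exact: Cmod_ge_0 | lra | lra].
have P2 : Cmod l * Cmod (g s - m)%C <= Cmod l * d.
  by apply: Rmult_le_compat_l; [exact: Cmod_ge_0 | lra].
have : d * D = d * (Cmod m + 1) + Cmod l * d by rewrite /D; ring.
lra.
Qed.

Lemma Clim_scal (k : C) (f : T -> C) (l : C) :
  Clim G f l -> Clim G (fun s => (k * f s)%C) (k * l)%C.
Proof. by move=> H; apply: Clim_mult => //; apply: Clim_const. Qed.

Lemma Clim_minus (f g : T -> C) (l m : C) :
  Clim G f l -> Clim G g m -> Clim G (fun s => (f s - g s)%C) (l - m)%C.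
Proof.
move=> Hf /(Clim_scal (- RtoC 1)%C) Hg.
rewrite (_ : l - m = l + - RtoC 1 * m)%C; last by ring.
by apply: Clim_ext (Clim_plus Hf Hg); apply: filter_forall => s; ring.
Qed.

Lemma Clim_sum (I : Type) (F : seq I) (f : T -> I -> C) (l : I -> C) :
  (forall i, Clim G (f^~ i) (l i)) ->
  Clim G (fun s => \Csum_(i <- F) f s i) (\Csum_(i <- F) l i).
Proof.
move=> H; elim: F => [|i F IH].
  rewrite big_nil; apply: Clim_ext (Clim_const _).
  by apply: filter_forall => s; rewrite big_nil.
rewrite big_cons; apply: Clim_ext (Clim_plus (H i) IH).
by apply: filter_forall => s; rewrite big_cons.
Qed.

Lemma Clim_unique {PG : ProperFilter G} (f : T -> C) (l m : C) :
  Clim G f l -> Clim G f m -> l = m.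
Proof.
move=> Hl Hm; apply: Cmod_minus_eq0 => e He.
have e2 : 0 < e / 2 by lra.
have [s [H1 H2]] := filter_ex _ (filter_and _ _ (Hl _ e2) (Hm _ e2)).
rewrite (_ : l - m = (f s - m) - (f s - l))%C; last by ring.
apply: Rle_lt_trans (Cmod_triangle _ _) _; rewrite Cmod_opp; lra.
Qed.

Lemma Clim_le {PG : ProperFilter G} (f : T -> C) (l : C) (K : R) :
  Clim G f l -> G (fun s => Cmod (f s) <= K) -> Cmod l <= K.
Proof.
move=> Hl HK; apply: le_epsilon => e He.
have [s [H1 H2]] := filter_ex _ (filter_and _ _ HK (Hl e He)).
rewrite (_ : l = f s - (f s - l))%C; last by ring.
apply: Rle_trans (Cmod_triangle _ _) _; rewrite Cmod_opp; lra.
Qed.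
End Clim.

(** * Unconditional sums *)

(** Through this filter unconditional convergence becomes an ordinary limit, so that the calculus of
    [Clim] and the Cauchy criterion of a complete space apply to it. *)
Definition fin_filter (I : eqType) (P : seq I -> Prop) : Prop :=
  exists F0 : seq I, forall F, uniq F -> {subset F0 <= F} -> P F.

Global Instance fin_filter_proper (I : eqType) : ProperFilter (@fin_filter I).
Proof.
split=> [P [F0 H]|].
  exists (undup F0); apply: H; first exact: undup_uniq.
  by move=> i; rewrite mem_undup.
split.
- by exists [::].
- move=> P Q [F1 H1] [F2 H2]; exists (F1 ++ F2) => F uF sF; split.
  + by apply: H1 => // i Hi; apply: sF; rewrite mem_cat Hi.
  + by apply: H2 => // i Hi; apply: sF; rewrite mem_cat Hi orbT.
- by move=> P Q PQ [F0 H]; exists F0 => F uF sF; apply: PQ; apply: H.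
Qed.

Lemma is_usumE (I : eqType) (f : I -> C) (S : C) :
  is_usum f S <-> Clim (@fin_filter I) (fun F => \Csum_(i <- F) f i) S.
Proof.
split=> [H e He | H [e He]].
  by have [F0 H0] := H (mkposreal e He); exists F0.
by have [F0 H0] := H e He; exists F0.
Qed.

Definition sum_le (I : eqType) (M : I -> R) (K : R) : Prop :=
  forall F : seq I, uniq F -> \Rsum_(i <- F) M i <= K.

Definition summable (I : eqType) (M : I -> R) : Prop :=
  (forall i, 0 <= M i) /\ exists K, sum_le M K.

Lemma Rsum_ge0 (I : eqType) (M : I -> R) (F : seq I) :
  (forall i, 0 <= M i) -> 0 <= \Rsum_(i <- F) M i.
Proof. by move=> H; apply: (big_ind (fun x => 0 <= x)) => //; [lra | move=> x y; lra]. Qed.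

Lemma Rsum_le (I : Type) (M N : I -> R) (F : seq I) :
  (forall i, M i <= N i) -> \Rsum_(i <- F) M i <= \Rsum_(i <- F) N i.
Proof. by move=> H; apply: (big_ind2 (fun x y => x <= y)) => //; [lra | move=> *; lra]. Qed.

Lemma Rsum_scal (I : Type) (k : R) (M : I -> R) (F : seq I) :
  \Rsum_(i <- F) (k * M i) = k * \Rsum_(i <- F) M i.
Proof. by elim: F => [|i F IH]; rewrite ?big_nil ?big_cons ?IH; ring. Qed.

Lemma Csum_scal (I : Type) (k : C) (f : I -> C) (F : seq I) :
  \Csum_(i <- F) (k * f i)%C = (k * \Csum_(i <- F) f i)%C.
Proof. by elim: F => [|i F IH]; rewrite ?big_nil ?big_cons ?IH; ring. Qed.

Lemma Cmod_sum_le (I : Type) (f : I -> C) (M : I -> R) (F : seq I) :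
  (forall i, Cmod (f i) <= M i) -> Cmod (\Csum_(i <- F) f i) <= \Rsum_(i <- F) M i.
Proof.
move=> H; apply: (big_ind2 (fun x y => Cmod x <= y)) => //.
  by rewrite Cmod_0; lra.
by move=> x1 x2 y1 y2; apply: Cmod_plus_le.
Qed.

Lemma Csum_split (I : eqType) (f : I -> C) (F0 F : seq I) :
  uniq F0 -> uniq F -> {subset F0 <= F} ->
  \Csum_(i <- F) f i = (\Csum_(i <- F0) f i + \Csum_(i <- [seq i <- F | i \notin F0]) f i)%C.
Proof.
move=> u0 uF sF.
rewrite -big_cat; apply: perm_big; apply: uniq_perm => //.
  rewrite cat_uniq u0 filter_uniq // andbT; apply/hasPn => i.
  by rewrite mem_filter => /andP[].
move=> i; rewrite mem_cat mem_filter; case: (boolP (i \in F0)) => //= Hi.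
by rewrite sF.
Qed.

(** Choose [F0] whose sum comes within [e] of the supremum [S] of all finite sums: a list disjoint
    from [F0], appended to it, still cannot exceed [S]. *)
Lemma summable_tail (I : eqType) (M : I -> R) (e : R) :
  summable M -> 0 < e ->
  exists2 F0, uniq F0 & forall F, uniq F -> {in F, forall i, i \notin F0} ->
    \Rsum_(i <- F) M i <= e.
Proof.
move=> [M0 [K HK]] He.
pose E x := exists2 F, uniq F & x = \Rsum_(i <- F) M i.
have [||S [HS1 HS2]] := completeness E.
- by exists K => x [F uF ->]; apply: HK.
- by exists 0, [::] => //; rewrite big_nil.
have [F0 [u0 H0]] : exists F0, uniq F0 /\ S - e < \Rsum_(i <- F0) M i.
  apply: NNPP => H.
  suff : S <= S - e by lra.
  apply: HS2 => x [F uF ->]; apply: Rnot_lt_le => H1; apply: H; by exists F.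
exists F0 => // F uF dF.
have : \Rsum_(i <- F0 ++ F) M i <= S.
  apply: HS1; exists (F0 ++ F) => //; rewrite cat_uniq u0 uF andbT /=.
  by apply/hasPn => i /dF.
rewrite big_cat /=; lra.
Qed.

Lemma summable_le (I : eqType) (M N : I -> R) (k : R) :
  (forall i, 0 <= N i <= k * M i) -> 0 <= k -> summable M -> summable N.
Proof.
move=> H k0 [M0 [K HK]]; split=> [i|]; first by case: (H i).
exists (k * K) => F uF; apply: Rle_trans (_ : \Rsum_(i <- F) (k * M i) <= _).
  by apply: Rsum_le => i; case: (H i).
by rewrite Rsum_scal; apply: Rmult_le_compat_l => //; apply: HK.
Qed.

Lemma usum_ex (I : eqType) (f : I -> C) (M : I -> R) :
  (forall i, Cmod (f i) <= M i) -> summable M -> exists S, is_usum f S.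
Proof.
move=> fM sM.
have [|S HS] := (proj1 (filterlim_locally_cauchy (U := C_CompleteNormedModule)
   (F := @fin_filter I) (fun F => \Csum_(i <- F) f i))).
  move=> [e He] /=.
  have [F0 u0 H0] := summable_tail sM (e := e / 4) ltac:(lra).
  exists (fun F => uniq F /\ {subset F0 <= F}); split; first by exists F0.
  move=> F F' [uF sF] [uF' sF']; apply: C_NormedModule_mixin_compat1.
  rewrite (Csum_split f u0 uF sF) (Csum_split f u0 uF' sF').
  have B : forall F, uniq F -> Cmod (\Csum_(i <- [seq i <- F | i \notin F0]) f i) <= e / 4.
    move=> F1 uF1; apply: Rle_trans (Cmod_sum_le _ fM) _; apply: H0.
      exact: filter_uniq.
    by move=> i; rewrite mem_filter => /andP[].
  set a := \Csum_(i <- F0) f i.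
  set b := \Csum_(i <- _) f i; set c := \Csum_(i <- _) f i.
  have Hb : Cmod b <= e / 4 by apply: B.
  have Hc : Cmod c <= e / 4 by apply: B.
  change (Cmod ((a + b) - (a + c))%C < e).
  rewrite (_ : _ - _ = b + - c)%C; last by ring.
  by apply: Rle_lt_trans (Cmod_triangle _ _) _; rewrite Cmod_opp; lra.
exists S; apply/is_usumE => e He.
(* A ball of radius [r] in [C] only guarantees a modulus below [sqrt 2 * r]; halving [e] absorbs
   this factor. *)
have e2 : 0 < e / 2 by lra.
have := HS (fun y => Cmod (y - S)%C < e); apply.
exists (mkposreal (e / 2) e2) => y Hy.
have /= H2 := C_NormedModule_mixin_compat2 _ _ _ Hy.
apply: Rlt_le_trans H2 _.
have : sqrt 2 <= 2.
  by rewrite -{2}(sqrt_Rsqr 2) ?/Rsqr; [apply: sqrt_le_1_alt | ]; lra.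
nra.
Qed.

(** A total summation operator. Its value means nothing for a divergent series, so it is always
    accessed through [usumP] or [usum_eq]. *)
Definition usum (I : eqType) (f : I -> C) : C := ClassicalEpsilon.epsilon (inhabits (RtoC 0)) (is_usum f).

Lemma is_usum_unique (I : eqType) (f : I -> C) (S S' : C) :
  is_usum f S -> is_usum f S' -> S = S'.
Proof. by move=> /is_usumE H /is_usumE H'; apply: Clim_unique H H'. Qed.

Lemma usum_eq (I : eqType) (f : I -> C) (S : C) : is_usum f S -> usum f = S.
Proof.
move=> H; apply: is_usum_unique (H).
by apply: (ClassicalEpsilon.epsilon_spec (inhabits (RtoC 0)) (is_usum f)); exists S.
Qed.

Lemma usumP (I : eqType) (f : I -> C) (M : I -> R) :
  (forall i, Cmod (f i) <= M i) -> summable M -> is_usum f (usum f).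
Proof.
by move=> fM sM; have [S HS] := usum_ex fM sM; rewrite (usum_eq HS).
Qed.

Lemma is_usum_ext (I : eqType) (f g : I -> C) (S : C) :
  (forall i, f i = g i) -> is_usum f S -> is_usum g S.
Proof. by move=> /functional_extensionality ->. Qed.

Lemma is_usum_scal (I : eqType) (k : C) (f : I -> C) (S : C) :
  is_usum f S -> is_usum (fun i => (k * f i)%C) (k * S)%C.
Proof.
move=> /is_usumE H; apply/is_usumE; apply: Clim_ext (Clim_scal k H).
by apply: filter_forall => F; rewrite Csum_scal.
Qed.

Lemma is_usum_plus (I : eqType) (f g : I -> C) (S S' : C) :
  is_usum f S -> is_usum g S' -> is_usum (fun i => (f i + g i)%C) (S + S')%C.
Proof.
move=> /is_usumE H /is_usumE H'; apply/is_usumE; apply: Clim_ext (Clim_plus H H').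
by apply: filter_forall => F; rewrite big_split.
Qed.

Lemma is_usum_le (I : eqType) (f : I -> C) (M : I -> R) (S : C) (K : R) :
  is_usum f S -> (forall i, Cmod (f i) <= M i) -> sum_le M K -> Cmod S <= K.
Proof.
move=> /is_usumE H fM HK; apply: (Clim_le H).
by exists [::] => F uF _; apply: Rle_trans (Cmod_sum_le _ fM) _; apply: HK.
Qed.

Lemma usum_head (I : eqType) (f : I -> C) (M : I -> R) (F0 : seq I) (e : R) :
  (forall i, Cmod (f i) <= M i) -> summable M -> uniq F0 ->
  (forall F, uniq F -> {in F, forall i, i \notin F0} -> \Rsum_(i <- F) M i <= e) ->
  Cmod (usum f - \Csum_(i <- F0) f i)%C <= e.
Proof.
move=> fM sM u0 H0.
have /is_usumE H := usumP fM sM.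
apply: (Clim_le (Clim_minus H (Clim_const (\Csum_(i <- F0) f i)))).
exists F0 => F uF sF; rewrite (Csum_split f u0 uF sF).
set a := \Csum_(i <- F0) f i; set b := \Csum_(i <- _) f i.
rewrite (_ : a + b - a = b)%C; last by ring.
apply: Rle_trans (Cmod_sum_le _ fM) _; apply: H0; first exact: filter_uniq.
by move=> i; rewrite mem_filter => /andP[].
Qed.

(** Tannery's theorem, that is, dominated convergence for series, along any proper filter: a finite
    head converges term by term, and the majorant makes both tails at most [e / 4]. *)
Lemma usum_Tannery (T : Type) (G : (T -> Prop) -> Prop) {PG : ProperFilter G}
    (I : eqType) (f : T -> I -> C) (l : I -> C) (M : I -> R) :
  (forall i, Clim G (f^~ i) (l i)) ->
  G (fun s => forall i, Cmod (f s i) <= M i) -> summable M ->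
  Clim G (fun s => usum (f s)) (usum l).
Proof.
move=> Hl HM sM e He.
have lM i : Cmod (l i) <= M i by apply: (Clim_le (Hl i)); apply: (filter_weaken HM).
have [F0 u0 H0] := summable_tail sM (e := e / 4) ltac:(lra).
have := Clim_sum F0 Hl (e := e / 4) ltac:(lra).
move=> /(filter_and _ _ HM) HG; apply: (filter_weaken HG) => s [fM Hs].
have H1 := usum_head fM sM u0 H0.
have := usum_head lM sM u0 H0; rewrite Cmod_minus_sym => H2.
set A := (usum (f s) - _)%C in H1; set B := (_ - usum l)%C in H2.
set D := (_ - _)%C in Hs.
rewrite (_ : _ - _ = A + (D + B))%C; last by rewrite /A /B /D; ring.
have := Cmod_triangle A (D + B)%C; have := Cmod_triangle D B; lra.
Qed.

Lemma is_usum_reindex (I : eqType) (p r : I -> I) (f : I -> C) (S : C) :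
  cancel p r -> cancel r p -> is_usum f S -> is_usum (fun i => f (p i)) S.
Proof.
move=> pK rK H e; have [F0 H0] := H e; exists (map r F0) => F uF sF.
have := H0 (map p F); rewrite big_map; apply.
  by rewrite map_inj_uniq //; apply: can_inj pK.
move=> i Hi; rewrite -(rK i); apply: map_f; apply: sF; exact: map_f.
Qed.

(** * Weights on the lattice *)

Lemma sum_le_inj (I J : eqType) (p : I -> J) (M : J -> R) (K : R) :
  injective p -> sum_le M K -> sum_le (fun i => M (p i)) K.
Proof.
move=> pI HK F uF; rewrite -(big_map p xpredT M); apply: HK.
by rewrite map_inj_uniq.
Qed.

Lemma sum_le_weaken (I : eqType) (M N : I -> R) (K : R) :
  (forall i, M i <= N i) -> sum_le N K -> sum_le M K.
Proof. by move=> MN HK F uF; apply: Rle_trans (Rsum_le F MN) (HK F uF). Qed.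

Lemma Rsum_cat (I : Type) (M : I -> R) (F F' : seq I) :
  \Rsum_(i <- F ++ F') M i = \Rsum_(i <- F) M i + \Rsum_(i <- F') M i.
Proof. by rewrite big_cat. Qed.

Lemma Rsum_subset (I : eqType) (M : I -> R) (F F' : seq I) :
  (forall i, 0 <= M i) -> uniq F -> uniq F' -> {subset F <= F'} ->
  \Rsum_(i <- F) M i <= \Rsum_(i <- F') M i.
Proof.
move=> M0 uF uF' sF.
have -> : \Rsum_(i <- F') M i =
    \Rsum_(i <- F) M i + \Rsum_(i <- [seq i <- F' | i \notin F]) M i.
  rewrite -big_cat; apply: perm_big; apply: uniq_perm => //.
    rewrite cat_uniq uF filter_uniq // andbT; apply/hasPn => i.
    by rewrite mem_filter => /andP[].
  move=> i; rewrite mem_cat mem_filter; case: (boolP (i \in F)) => //= Hi.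
  by rewrite sF.
have := Rsum_ge0 [seq i <- F' | i \notin F] M0; lra.
Qed.

(** A finite set of pairs is contained in the product of its two projections, over which the sum
    factors. *)
Lemma sum_le_prod (I J : eqType) (f : I -> R) (g : J -> R) (K L : R) :
  (forall i, 0 <= f i) -> (forall j, 0 <= g j) -> sum_le f K -> sum_le g L ->
  sum_le (fun p : I * J => f p.1 * g p.2) (K * L).
Proof.
move=> f0 g0 HK HL F uF.
pose A := undup (map fst F); pose B := undup (map snd F).
apply: Rle_trans (_ : \Rsum_(p <- [seq (a, b) | a <- A, b <- B]) (f p.1 * g p.2) <= _).
  apply: Rsum_subset => //.
  - by move=> p; apply: Rmult_le_pos.
  - by apply: allpairs_uniq; rewrite ?undup_uniq // => -[a b] [a' b'].
  - move=> [a b] H; apply/allpairsP; exists (a, b); split=> //=.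
      by rewrite mem_undup; apply: (map_f fst H).
    by rewrite mem_undup; apply: (map_f snd H).
rewrite big_allpairs /=.
have -> : \Rsum_(i <- A) \Rsum_(j <- B) (f i * g j) =
    (\Rsum_(j <- B) g j) * \Rsum_(i <- A) f i.
  by rewrite -Rsum_scal; apply: eq_bigr => i _; rewrite Rsum_scal Rmult_comm.
rewrite Rmult_comm; apply: Rmult_le_compat; try exact: Rsum_ge0.
- by apply: HK; apply: undup_uniq.
- by apply: HL; apply: undup_uniq.
Qed.

(** Telescoping: 1 / (1 + x)^2 is at most 2 / ((1 + x) (2 + x)) = 2 / (1 + x) - 2 / (2 + x). *)
Lemma sum_le_inv_square : sum_le (fun k : nat => / (1 + INR k) ^ 2) 2.
Proof.
have H n : \Rsum_(k <- seq.iota O n) / (1 + INR k) ^ 2 <= 2 - 2 / (1 + INR n).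
  elim: n => [|n IH]; first by rewrite big_nil /=; lra.
  rewrite S_INR -(addn1 n) iotaD Rsum_cat big_seq1 add0n.
  have n0 := pos_INR n; set x := INR n in IH n0 *.
  have -> : 2 - 2 / (1 + (x + 1)) = (2 - 2 / (1 + x)) + 2 / ((1 + x) * (1 + (x + 1))).
    by field; lra.
  have : / (1 + x) ^ 2 <= 2 / ((1 + x) * (1 + (x + 1))).
    apply: (Rmult_le_reg_r ((1 + x) ^ 2 * (1 + (x + 1)))); first nra.
    have -> : / (1 + x) ^ 2 * ((1 + x) ^ 2 * (1 + (x + 1))) = 1 + (x + 1) by field; lra.
    have -> : 2 / ((1 + x) * (1 + (x + 1))) * ((1 + x) ^ 2 * (1 + (x + 1))) = 2 * (1 + x).
      by field; lra.
    lra.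
  lra.
move=> F uF; pose N := (\max_(k <- F) k).+1.
apply: Rle_trans (_ : \Rsum_(k <- seq.iota O N) / (1 + INR k) ^ 2 <= _).
  apply: Rsum_subset => //; last 1 first.
  - by move=> k Hk; rewrite mem_iota /= add0n ltnS; apply: leq_bigmax_seq.
  - by move=> k; apply/Rlt_le/Rinv_0_lt_compat/pow_lt; have := pos_INR k; lra.
  - exact: iota_uniq.
apply: Rle_trans (H _) _.
have : 0 < / (1 + INR N) by apply: Rinv_0_lt_compat; have := pos_INR N; lra.
rewrite /Rdiv; lra.
Qed.

Lemma sum_le_bool : sum_le (fun _ : bool => 1) 2.
Proof.
move=> F uF; apply: Rle_trans (_ : \Rsum_(b <- [:: true; false]) 1 <= _).
  by apply: Rsum_subset => //; [move=> _; lra | case; rewrite !inE].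
by rewrite !big_cons big_nil; lra.
Qed.

Definition absZ (k : int) : R := Rabs (k%:~R : R)%ring.

Lemma absZE (k : int) : absZ k = INR `|k|%N.
Proof.
have H (n : nat) : (n%:R)%ring = INR n by rewrite INRE.
rewrite /absZ; case: k => n.
  by rewrite /= -H Rabs_pos_eq //; rewrite -pmulrn H; apply: pos_INR.
rewrite NegzE GRing.rmorphN /= Rabs_Ropp.
rewrite (_ : (n.+1)%:Z%:~R%ring = INR n.+1); last by rewrite -H -pmulrn.
by rewrite Rabs_pos_eq //; apply: pos_INR.
Qed.

Lemma sum_le_inv_squareZ : sum_le (fun k : int => / (1 + absZ k) ^ 2) 4.
Proof.
(* Encoding an integer by its sign and absolute value costs a factor 2 for the sign, whence 4 = 2 *
   2. *)
pose p (k : int) := ((0 <= k)%ring, `|k|%N).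
have pI : injective p.
  move=> a b [].
  case: a => a; case: b => b //= _.
  - by move=> ->.
  - by case=> ->.
have H0 : forall k : nat, 0 <= / (1 + INR k) ^ 2.
  by move=> k; apply/Rlt_le/Rinv_0_lt_compat/pow_lt; have := pos_INR k; lra.
have -> : 4 = 2 * 2 by lra.
have := sum_le_inj pI (sum_le_prod (fun _ => Rle_0_1) H0 sum_le_bool sum_le_inv_square).
by apply: sum_le_weaken => k; rewrite /= absZE; lra.
Qed.

Lemma sum_le_rV (n : nat) (f : int -> R) (K : R) :
  (forall k, 0 <= f k) -> sum_le f K ->
  sum_le (fun m : 'rV[int]_n => \big[Rmult/1]_(j < n) f (m ord0 j)) (K ^ n).
Proof.
move=> f0 HK; elim: n => [|n IH].
  (* There is only one row of length 0, so a duplicate-free list of such rows has at most one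
     entry. *)
  case=> [|a [|b F]]; rewrite ?big_nil ?big_seq1 ?big_ord0 /=; try lra.
  by rewrite (_ : a = b) ?inE ?eqxx //; apply/rowP; case.
pose p (m : 'rV[int]_n.+1) : int * 'rV[int]_n :=
  (m ord0 ord0, \row_j m ord0 (lift ord0 j))%ring.
have pI : injective p.
  move=> a b [E0 E]; apply/rowP => j.
  case: (unliftP ord0 j) => [i ->|-> //].
  by have /rowP /(_ i) := E; rewrite !mxE.
have P0 (m : 'rV[int]_n) : 0 <= \big[Rmult/1]_(j < n) f (m ord0 j).
  by apply: (big_ind (fun x => 0 <= x)) => //; [lra | exact: Rmult_le_pos].
have := sum_le_inj pI (sum_le_prod f0 P0 HK IH).
apply: sum_le_weaken => m /=; rewrite big_ord_recl; apply: Req_le; congr (_ * _).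
by apply: eq_bigr => j _; rewrite mxE.
Qed.

Section LatticeNorm.
Context {nu : nat}.
Implicit Types (m n : 'rV[int]_nu) (omega : 'rV[R]_nu).

Lemma l1normZE n : l1normZ n = \big[Rplus/0]_(j < nu) absZ (n ord0 j).
Proof. by rewrite /l1normZ /l1norm; apply: eq_bigr => j _; rewrite mxE. Qed.

Lemma absZ_ge0 k : 0 <= absZ k.
Proof. exact: Rabs_pos. Qed.

Lemma l1normZ_ge0 n : 0 <= l1normZ n.
Proof.
rewrite l1normZE; apply: (big_ind (fun x => 0 <= x)); [lra | move=> *; lra|].
by move=> *; apply: absZ_ge0.
Qed.

Lemma l1normZ_coord n j : absZ (n ord0 j) <= l1normZ n.
Proof.
rewrite l1normZE (bigD1 j) //.
change (absZ (n ord0 j) <= absZ (n ord0 j) + \big[Rplus/0]_(i < nu | i != j) absZ (n ord0 i)).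
have : 0 <= \big[Rplus/0]_(i < nu | i != j) absZ (n ord0 i).
  apply: (big_ind (fun x => 0 <= x)); [lra | move=> *; lra|].
  by move=> *; apply: absZ_ge0.
lra.
Qed.

Lemma l1normZ_triangle m n : l1normZ n <= l1normZ m + l1normZ (n - m)%ring.
Proof.
rewrite !l1normZE -big_split.
apply: (big_ind2 (fun x y => x <= y)); [lra | move=> ? ? ? ?; exact: Rplus_le_compat|] => j _.
rewrite /absZ !mxE GRing.rmorphB /=; set a := (_%:~R)%ring; set b := (_%:~R)%ring.
by apply: Rle_trans (Rabs_triang _ _); apply: Req_le; congr Rabs; rewrite RplusE GRing.addrC GRing.subrK.
Qed.

Lemma dotD m n omega : dot (m + n)%ring omega = dot m omega + dot n omega.
Proof.
rewrite /dot -big_split; apply: eq_bigr => j _.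
by rewrite mxE GRing.rmorphD /= GRing.mulrDl.
Qed.

Lemma dotN n omega : dot (- n)%ring omega = - dot n omega.
Proof.
rewrite /dot RoppE -GRing.sumrN; apply: eq_bigr => j _.
by rewrite mxE GRing.rmorphN /= GRing.mulNr.
Qed.

Lemma dotB m n omega : dot (m - n)%ring omega = dot m omega - dot n omega.
Proof. by rewrite dotD dotN. Qed.

Lemma l1norm_ge0 omega : 0 <= l1norm omega.
Proof.
apply: (big_ind (fun x => 0 <= x)); [exact: Rle_refl | exact: Rplus_le_le_0_compat|].
by move=> *; apply: Rabs_pos.
Qed.

Lemma dot_le n omega : Rabs (dot n omega) <= l1norm omega * l1normZ n.
Proof.
rewrite l1normZE.
have -> : l1norm omega * \big[Rplus/0]_(j < nu) absZ (n ord0 j) =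
  \big[Rplus/0]_(j < nu) (l1norm omega * absZ (n ord0 j)).
  by rewrite Rsum_scal.
rewrite /dot; apply: (big_ind2 (fun x y => Rabs x <= y)).
- by rewrite Rabs_R0; apply: Rle_refl.
- by move=> x1 x2 y1 y2 H1 H2; apply: Rle_trans (Rabs_triang _ _) _; apply: Rplus_le_compat.
move=> j _; rewrite -RmultE Rabs_mult Rmult_comm; apply: Rmult_le_compat_r; first exact: Rabs_pos.
rewrite /l1norm (bigD1 j) //= -RplusE.
rewrite -[X in X <= _]Rplus_0_r; apply: Rplus_le_compat_l.
apply: (big_ind (fun x => 0 <= x)); [exact: Rle_refl | exact: Rplus_le_le_0_compat|].
by move=> *; apply: Rabs_pos.
Qed.

(** The exponent [2 * nu] provides one factor (1 + |n_j|)^(-2) per coordinate, which is summable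
    over the integers; see [polyw_le_prod]. *)
Definition polyw n : R := / (1 + l1normZ n) ^ (2 * nu).

Lemma polyw_gt0 n : 0 < polyw n.
Proof. by apply/Rinv_0_lt_compat/pow_lt; have := l1normZ_ge0 n; lra. Qed.

Lemma inv_square_ge0 k : 0 <= / (1 + absZ k) ^ 2.
Proof. by apply/Rlt_le/Rinv_0_lt_compat/pow_lt; have := absZ_ge0 k; lra. Qed.

Lemma polyw_le_prod n : polyw n <= \big[Rmult/1]_(j < nu) / (1 + absZ (n ord0 j)) ^ 2.
Proof.
rewrite /polyw pow_mult -pow_inv.
have E x k : x ^ k = \big[Rmult/1]_(j < k) x.
  by rewrite big_const card_ord; elim: k => //= k ->.
rewrite E.
apply: (proj2 (_ : 0 <= _ <= _)).
apply: (big_ind2 (fun x y => 0 <= x <= y)); first lra.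
  by move=> x1 x2 y1 y2 [? ?] [? ?]; split; [exact: Rmult_le_pos | exact: Rmult_le_compat].
move=> j _; have := l1normZ_coord n j; have := absZ_ge0 (n ord0 j) => A1 A2; split.
  by apply/Rlt_le/Rinv_0_lt_compat/pow_lt; lra.
apply: Rinv_le_contravar; first by apply: pow_lt; lra.
by apply: pow_incr; lra.
Qed.

Lemma polyw_sum : sum_le polyw (4 ^ nu).
Proof.
exact: sum_le_weaken polyw_le_prod (sum_le_rV inv_square_ge0 sum_le_inv_squareZ).
Qed.

(** By the triangle inequality 1 + |n| is at most twice the larger of 1 + |m| and 1 + |n - m|;
    raised to the power [2 * nu], the 2 becomes [4 ^ nu], and a maximum is at most a sum. *)
Lemma polyw_mul m n :
  polyw m * polyw (n - m)%ring <= 4 ^ nu * polyw n * (polyw m + polyw (n - m)%ring).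
Proof.
have T := l1normZ_triangle m n.
have := l1normZ_ge0 m; have := l1normZ_ge0 n; have := l1normZ_ge0 (n - m)%ring.
rewrite /polyw; set a := l1normZ m in T *; set b := l1normZ (n - m)%ring in T *; set c := l1normZ n in T *.
move=> b0 c0 a0.
have H : (1 + c) ^ (2 * nu) <= 4 ^ nu * ((1 + a) ^ (2 * nu) + (1 + b) ^ (2 * nu)).
  have -> : 4 ^ nu = 2 ^ (2 * nu) by rewrite pow_mult; congr (_ ^ _); lra.
  have A := pow_le (1 + a) (2 * nu) ltac:(lra); have B := pow_le (1 + b) (2 * nu) ltac:(lra).
  have C2 := pow_le 2 (2 * nu) ltac:(lra).
  case: (Rle_dec a b) => ab.
    apply: Rle_trans (_ : (2 * (1 + b)) ^ (2 * nu) <= _); first by apply: pow_incr; lra.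
    by rewrite Rpow_mult_distr; apply: Rmult_le_compat_l; lra.
  apply: Rle_trans (_ : (2 * (1 + a)) ^ (2 * nu) <= _); first by apply: pow_incr; lra.
  by rewrite Rpow_mult_distr; apply: Rmult_le_compat_l; lra.
have A := pow_lt (1 + a) (2 * nu) ltac:(lra); have B := pow_lt (1 + b) (2 * nu) ltac:(lra).
have D := pow_lt (1 + c) (2 * nu) ltac:(lra).
move: A B D H; set x := _ ^ _; set y := (1 + b) ^ _; set z := (1 + c) ^ _; set k := 4 ^ nu.
move=> A B D H.
apply: (Rmult_le_reg_r (x * y * z)); first by apply: Rmult_lt_0_compat => //; apply: Rmult_lt_0_compat.
have -> : / x * / y * (x * y * z) = z by field; lra.
have -> : k * / z * (/ x + / y) * (x * y * z) = k * (x + y) by field; lra.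
exact: H.
Qed.

Definition expw (s : R) n : R := exp (- (s * l1normZ n)) * polyw n.

Lemma expw_gt0 s n : 0 < expw s n.
Proof. by apply: Rmult_lt_0_compat; [exact: exp_pos | exact: polyw_gt0]. Qed.

Lemma expw_mul s m n : 0 <= s ->
  expw s m * expw s (n - m)%ring <= expw s n * (4 ^ nu * (polyw m + polyw (n - m)%ring)).
Proof.
move=> s0; rewrite /expw.
have -> : exp (- (s * l1normZ m)) * polyw m * (exp (- (s * l1normZ (n - m)%ring)) * polyw (n - m)%ring)
  = exp (- (s * l1normZ m) + - (s * l1normZ (n - m)%ring)) * (polyw m * polyw (n - m)%ring).
  by rewrite exp_plus; ring.
rewrite Rmult_assoc; apply: Rmult_le_compat.
- exact/Rlt_le/exp_pos.
- by apply/Rlt_le/Rmult_lt_0_compat; apply: polyw_gt0.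
- have : - (s * l1normZ m) + - (s * l1normZ (n - m)%ring) <= - (s * l1normZ n).
    by have := Rmult_le_compat_l s _ _ s0 (l1normZ_triangle m n); lra.
  by case=> [/exp_increasing|->]; lra.
- by apply: Rle_trans (polyw_mul m n) _; lra.
Qed.

Lemma expw_le s s' n : s' <= s -> expw s n <= expw s' n.
Proof.
move=> H; apply: Rmult_le_compat_r; first exact/Rlt_le/polyw_gt0.
have : - (s * l1normZ n) <= - (s' * l1normZ n) by have := l1normZ_ge0 n; nra.
by case=> [/exp_increasing|->]; lra.
Qed.

Lemma expw_le_polyw s n : 0 <= s -> expw s n <= polyw n.
Proof.
move=> H; apply: Rle_trans (expw_le n H) _.
by rewrite /expw Rmult_0_l Ropp_0 exp_0; lra.
Qed.

Lemma expw_le_exp s n : expw s n <= exp (- (s * l1normZ n)).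
Proof.
rewrite -[X in _ <= X]Rmult_1_r; apply: Rmult_le_compat_l; first exact/Rlt_le/exp_pos.
rewrite -[X in _ <= X]Rinv_1; apply: Rinv_le_contravar; first lra.
by apply: pow_R1_Rle; have := l1normZ_ge0 n; lra.
Qed.

Definition conv (a b : 'rV[int]_nu -> C) n : C := usum (fun m => (a m * b (n - m)%ring)%C).

Definition conv_majorant (K s : R) n m : R :=
  K * expw s n * (4 ^ nu * (polyw m + polyw (n - m)%ring)).

(** The first factor is the loss in [polyw_mul]; each of the two summands bounds the sum of [polyw]
    over the lattice, once in [m] and once in [n - m]. *)
Definition conv_cst : R := 4 ^ nu * (4 ^ nu + 4 ^ nu).

Lemma conv_cst_gt0 : 0 < conv_cst.
Proof. by have := pow_lt 4 nu ltac:(lra); rewrite /conv_cst; nra. Qed.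

Lemma conv_term_le (a b : 'rV[int]_nu -> C) K L s n m : 0 <= s ->
  (forall n, Cmod (a n) <= K * expw s n) -> (forall n, Cmod (b n) <= L * expw s n) ->
  Cmod (a m * b (n - m)%ring)%C <= conv_majorant (K * L) s n m.
Proof.
move=> s0 Ha Hb; apply: Rle_trans (Cmod_mult_le (Ha m) (Hb _)) _.
have K0 : 0 <= K.
  by have := Rle_trans _ _ _ (Cmod_ge_0 _) (Ha m); have := expw_gt0 s m; nra.
have L0 : 0 <= L.
  by have := Rle_trans _ _ _ (Cmod_ge_0 _) (Hb m); have := expw_gt0 s m; nra.
have := Rmult_le_compat_l _ _ _ (Rmult_le_pos _ _ K0 L0) (expw_mul m n s0).
by rewrite /conv_majorant; lra.
Qed.

Lemma conv_majorant_ge0 K s n m : 0 <= K -> 0 <= conv_majorant K s n m.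
Proof.
move=> K0; rewrite /conv_majorant.
have := expw_gt0 s n; have := polyw_gt0 m; have := polyw_gt0 (n - m)%ring.
have := pow_lt 4 nu ltac:(lra).
by move=> *; apply: Rmult_le_pos; apply: Rmult_le_pos; lra.
Qed.

Lemma conv_majorant_sum K s n : 0 <= K ->
  sum_le (conv_majorant K s n) (K * expw s n * conv_cst).
Proof.
move=> K0 F uF; rewrite /conv_majorant Rsum_scal.
apply: Rmult_le_compat_l; first by apply: Rmult_le_pos => //; exact/Rlt_le/expw_gt0.
rewrite Rsum_scal; apply: Rmult_le_compat_l; first by apply: pow_le; lra.
rewrite big_split; apply: Rplus_le_compat; first exact: polyw_sum.
have I : injective (fun m : 'rV[int]_nu => n - m)%ring.
  by move=> x y /GRing.addrI /GRing.oppr_inj.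
exact: (sum_le_inj I polyw_sum).
Qed.

Lemma conv_majorant_summable K s n : 0 <= K -> summable (conv_majorant K s n).
Proof.
move=> K0; split; first by move=> m; apply: conv_majorant_ge0.
by eexists; apply: conv_majorant_sum.
Qed.

Lemma bound_ge0 (a : 'rV[int]_nu -> C) K s :
  (forall n, Cmod (a n) <= K * expw s n) -> 0 <= K.
Proof.
move=> /(_ 0%ring) H; have := expw_gt0 s (0%ring : 'rV[int]_nu).
by have := Cmod_ge_0 (a 0%ring); nra.
Qed.

Lemma conv_usum (a b : 'rV[int]_nu -> C) K L s n : 0 <= s ->
  (forall n, Cmod (a n) <= K * expw s n) -> (forall n, Cmod (b n) <= L * expw s n) ->
  is_usum (fun m => (a m * b (n - m)%ring)%C) (conv a b n).
Proof.
move=> s0 Ha Hb.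
have KL := Rmult_le_pos _ _ (bound_ge0 Ha) (bound_ge0 Hb).
exact: usumP (fun m => conv_term_le n m s0 Ha Hb) (conv_majorant_summable _ _ KL).
Qed.

Lemma conv_le (a b : 'rV[int]_nu -> C) K L s n : 0 <= s ->
  (forall n, Cmod (a n) <= K * expw s n) -> (forall n, Cmod (b n) <= L * expw s n) ->
  Cmod (conv a b n) <= K * L * conv_cst * expw s n.
Proof.
move=> s0 Ha Hb.
have KL := Rmult_le_pos _ _ (bound_ge0 Ha) (bound_ge0 Hb).
have := is_usum_le (conv_usum n s0 Ha Hb) (fun m => conv_term_le n m s0 Ha Hb)
  (conv_majorant_sum s n KL).
lra.
Qed.

(** Bilinearity writes the difference as (a - b) * a + b * (a - b), two convolutions with the same
    bound, whence the factor 2. *)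
Lemma conv_sub_le (a b : 'rV[int]_nu -> C) K N s n : 0 <= s ->
  (forall n, Cmod (a n) <= K * expw s n) -> (forall n, Cmod (b n) <= K * expw s n) ->
  (forall n, Cmod (a n - b n)%C <= N * expw s n) ->
  Cmod (conv a a n - conv b b n)%C <= 2 * K * N * conv_cst * expw s n.
Proof.
move=> s0 Ha Hb Hab.
have H1 := conv_usum n s0 Hab Ha; have H2 := conv_usum n s0 Hb Hab.
have -> : (conv a a n - conv b b n =
    conv (fun n => a n - b n) a n + conv b (fun n => a n - b n) n)%C.
  apply: (@is_usum_unique _ (fun m => (a m * a (n - m)%ring - b m * b (n - m)%ring)%C)).
    have H3 := is_usum_scal (- RtoC 1)%C (conv_usum n s0 Hb Hb).
    have := is_usum_plus (conv_usum n s0 Ha Ha) H3.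
    rewrite (_ : _ + _ = conv a a n - conv b b n)%C; last by ring.
    by apply: is_usum_ext => m; ring.
  by have := is_usum_plus H1 H2; apply: is_usum_ext => m; ring.
have := Cmod_plus_le (conv_le n s0 Hab Ha) (conv_le n s0 Hb Hab); lra.
Qed.

(* Exchanging [m] and [n - m] replaces the factor [m.omega] by its mean [n.omega / 2]. *)
Lemma conv_dot (omega : 'rV[R]_nu) (a : 'rV[int]_nu -> C) K L s n : 0 <= s ->
  (forall n, Cmod (a n) <= K * expw s n) ->
  (forall n, Cmod (RtoC (dot n omega) * a n)%C <= L * expw s n) ->
  is_usum (fun m => (RtoC (dot m omega * dot n omega) * a m * a (n - m)%ring)%C)
    (RtoC (dot n omega ^ 2 / 2) * conv a a n)%C.
Proof.
move=> s0 Ha Hb.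
set S := conv (fun n => RtoC (dot n omega) * a n)%C a n.
have H1 := conv_usum n s0 Hb Ha.
have sK : involutive (fun m : 'rV[int]_nu => n - m)%ring by move=> m; apply: GRing.subKr.
have H2 := is_usum_reindex sK sK H1.
have E : (S + S = RtoC (dot n omega) * conv a a n)%C.
  apply: is_usum_unique (is_usum_plus H1 H2) _.
  apply: is_usum_ext (is_usum_scal (RtoC (dot n omega)) (conv_usum n s0 Ha Ha)) => m.
  rewrite GRing.subKr dotB RtoC_minus; ring.
have -> : (RtoC (dot n omega ^ 2 / 2) * conv a a n = RtoC (dot n omega) * S)%C.
  rewrite (_ : dot n omega ^ 2 / 2 = / 2 * dot n omega * dot n omega); last by field.
  have <- : (RtoC (/ 2) * (S + S) = S)%C.
    by apply: injective_projections; rewrite /=; field.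
  by rewrite E !RtoC_mult; ring.
apply: is_usum_ext (is_usum_scal (RtoC (dot n omega)) H1) => m.
by rewrite RtoC_mult; ring.
Qed.
End LatticeNorm.

Lemma poly_le_exp (k : nat) (e : R) : 0 < e ->
  exists2 D, 0 < D & forall y, 0 <= y -> (1 + y) ^ k <= D * exp (e * y).
Proof.
(* Since 1 + y <= (1 + 1/d) exp(d y), the k-th power costs the rate k d <= e. Dividing by k + 1
   keeps [d] meaningful for k = 0. *)
move=> e0; pose d := e / INR k.+1.
have k0 : 0 < INR k.+1 by apply: lt_0_INR; lia.
have d0 : 0 < d by apply: Rdiv_lt_0_compat.
exists ((1 + / d) ^ k).
  by apply: pow_lt; have := Rinv_0_lt_compat _ d0; lra.
move=> y y0; apply: Rle_trans (_ : ((1 + / d) * exp (d * y)) ^ k <= _).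
  apply: pow_incr; split; first lra.
  have dy : 0 <= d * y by nra.
  have E1 : 1 + d * y <= exp (d * y) by apply: exp_ineq1_le.
  have -> : 1 + y = 1 + / d * (d * y) by field; lra.
  have := Rmult_le_compat_l (/ d) _ _ (Rlt_le _ _ (Rinv_0_lt_compat _ d0)) E1.
  have := Rinv_0_lt_compat _ d0; nra.
rewrite Rpow_mult_distr; apply: Rmult_le_compat_l.
  by apply: pow_le; have := Rinv_0_lt_compat _ d0; lra.
have -> : exp (d * y) ^ k = exp (INR k * (d * y)).
  elim: k {d k0 d0} (d) => [|k IH] d; first by rewrite /= Rmult_0_l exp_0.
  by rewrite -tech_pow_Rmult IH -exp_plus S_INR; congr exp; ring.
have : INR k * (d * y) <= e * y.
  rewrite -Rmult_assoc; apply: Rmult_le_compat_r => //.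
  rewrite /d (_ : INR k * _ = e - d); last by rewrite /d S_INR; field; rewrite S_INR in k0; lra.
  by rewrite -/d; lra.
by case=> [/exp_increasing|->]; lra.
Qed.

(** * Quasi-periodic series *)

Section QuasiPeriodic.
Context {nu : nat}.
Implicit Types (m n : 'rV[int]_nu) (omega : 'rV[R]_nu) (a b : 'rV[int]_nu -> C).

(** A loss of rate pays for the polynomial factor of the weight. With kappa / 2 and kappa / 4 this
    brings the initial data into the weighted space. *)
Lemma exp_le_expw s s' : s' < s ->
  exists2 D, 0 < D & forall n : 'rV[int]_nu, exp (- (s * l1normZ n)) <= D * expw s' n.
Proof.
move=> ss; have [D D0 H] := poly_le_exp (2 * nu) (e := s - s') ltac:(lra).
exists D => // n; have y0 := l1normZ_ge0 n; have {}H := H _ y0.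
have P := pow_lt (1 + l1normZ n) (2 * nu) ltac:(lra).
rewrite /expw /polyw; set x := l1normZ n in y0 H P *; set p := (1 + x) ^ _ in H P *.
apply: (Rmult_le_reg_r p) => //.
have -> : D * (exp (- (s' * x)) * / p) * p = D * exp (- (s' * x)) by field; lra.
have -> : exp (- (s' * x)) = exp (- (s * x)) * exp ((s - s') * x).
  by rewrite -exp_plus; congr exp; ring.
by have := exp_pos (- (s * x)); nra.
Qed.

Lemma dot_pow_expw omega (k : nat) s s' : s' < s ->
  exists2 D, 0 < D & forall n, Rabs (dot n omega) ^ k * expw s n <= D * expw s' n.
Proof.
move=> ss; have [D D0 H] := poly_le_exp k (e := s - s') ltac:(lra).
have W0 := l1norm_ge0 omega.
exists ((1 + l1norm omega) ^ k * D).
  by apply: Rmult_lt_0_compat => //; apply: pow_lt; lra.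
move=> n; have y0 := l1normZ_ge0 n; have {}H := H _ y0.
have : Rabs (dot n omega) ^ k <= (1 + l1norm omega) ^ k * (1 + l1normZ n) ^ k.
  rewrite -Rpow_mult_distr; apply: pow_incr; split; first exact: Rabs_pos.
  by apply: Rle_trans (dot_le n omega) _; nra.
have Wk := pow_lt (1 + l1norm omega) k ltac:(lra).
rewrite /expw; set x := l1normZ n in y0 H *; set p := _ ^ k; set o := _ ^ k in Wk *.
set z := _ ^ k in H *.
move=> Hp; rewrite -!Rmult_assoc; apply: Rmult_le_compat_r; first exact/Rlt_le/polyw_gt0.
have -> : exp (- (s' * x)) = exp ((s - s') * x) * exp (- (s * x)).
  by rewrite -exp_plus; congr exp; ring.
rewrite -Rmult_assoc; apply: Rmult_le_compat_r; first exact/Rlt_le/exp_pos.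
apply: Rle_trans Hp _; rewrite Rmult_assoc; apply: Rmult_le_compat_l; lra.
Qed.

Lemma dot_pow_bound omega (k : nat) s s' a K : s' < s ->
  (forall n, Cmod (a n) <= K * expw s n) ->
  exists2 D, 0 <= D & forall n, Cmod (a n) * Rabs (dot n omega) ^ k <= D * expw s' n.
Proof.
move=> ss Ha; have [D D0 H] := dot_pow_expw omega k ss.
have K0 := bound_ge0 Ha.
exists (K * D); first nra.
move=> n; have P : 0 <= Rabs (dot n omega) ^ k by apply/pow_le/Rabs_pos.
have := Rmult_le_compat_r _ _ _ P (Ha n); have := Rmult_le_compat_l _ _ _ K0 (H n); lra.
Qed.

Lemma Cmod_expi t : Cmod (expi t) = 1.
Proof.
rewrite /Cmod /expi /= !Rmult_1_r Rplus_comm.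
by have := sin2_cos2 t; rewrite /Rsqr => ->; apply: sqrt_1.
Qed.

Lemma expi_plus s t : expi (s + t) = (expi s * expi t)%C.
Proof. by apply: injective_projections; rewrite /= ?cos_plus ?sin_plus; ring. Qed.

Lemma expi_0 : expi 0 = RtoC 1.
Proof. by rewrite /expi cos_0 sin_0. Qed.

Definition qp omega a (x : R) : C := usum (fun n => (a n * expi (x * dot n omega))%C).

Lemma qp_term_le omega a K s x n : 0 <= s ->
  (forall n, Cmod (a n) <= K * expw s n) ->
  Cmod (a n * expi (x * dot n omega))%C <= K * polyw n.
Proof.
move=> s0 Ha; rewrite Cmod_mult Cmod_expi Rmult_1_r; apply: Rle_trans (Ha n) _.
by apply: Rmult_le_compat_l (bound_ge0 Ha) (expw_le_polyw n s0).
Qed.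

Lemma polyw_summable K : 0 <= K -> summable (fun n => K * polyw n).
Proof.
move=> K0; split=> [n|]; first by apply: Rmult_le_pos => //; exact/Rlt_le/polyw_gt0.
exists (K * 4 ^ nu) => F uF; rewrite Rsum_scal; apply: Rmult_le_compat_l => //.
exact: polyw_sum.
Qed.

Lemma qpP omega a K s x : 0 <= s -> (forall n, Cmod (a n) <= K * expw s n) ->
  is_qp_sum omega a x (qp omega a x).
Proof.
move=> s0 Ha.
exact: usumP (fun n => qp_term_le omega x n s0 Ha) (polyw_summable (bound_ge0 Ha)).
Qed.

Lemma qp_le omega a K s x : 0 <= s -> (forall n, Cmod (a n) <= K * expw s n) ->
  Cmod (qp omega a x) <= K * 4 ^ nu.
Proof.
move=> s0 Ha; apply: is_usum_le (qpP omega x s0 Ha) (fun n => qp_term_le omega x n s0 Ha) _.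
move=> F uF; rewrite Rsum_scal; apply: Rmult_le_compat_l (bound_ge0 Ha) _.
exact: polyw_sum.
Qed.

Lemma qp_eq omega a x S : is_qp_sum omega a x S -> qp omega a x = S.
Proof. exact: usum_eq. Qed.

Lemma is_usum_finsum (I : eqType) (J : Type) (F : seq J) (f : J -> I -> C) (S : J -> C) :
  (forall j, is_usum (f j) (S j)) ->
  is_usum (fun i => \Csum_(j <- F) f j i) (\Csum_(j <- F) S j).
Proof.
move=> H; elim: F => [|j F IH].
  rewrite big_nil => e; exists [::] => F _ _.
  rewrite big1 => [|i _]; last by rewrite big_nil.
  rewrite (_ : (0 - 0)%C = RtoC 0) ?Cmod_0; last by ring.
  exact: cond_pos.
rewrite big_cons; apply: is_usum_ext (is_usum_plus (H j) IH) => i.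
by rewrite big_cons.
Qed.

(* The partial sums of the first series times the second series are reindexed along
   [m + k = n]; dominated convergence then interchanges the two limits. *)
Lemma qp_conv omega a b K L s x : 0 <= s ->
  (forall n, Cmod (a n) <= K * expw s n) -> (forall n, Cmod (b n) <= L * expw s n) ->
  qp omega (conv a b) x = (qp omega a x * qp omega b x)%C.
Proof.
move=> s0 Ha Hb; set E := fun n : 'rV[int]_nu => expi (x * dot n omega).
have KL := Rmult_le_pos _ _ (bound_ge0 Ha) (bound_ge0 Hb).
have EE n m : (E m * E (n - m)%ring = E n)%C.
  by rewrite -expi_plus; congr expi; rewrite dotB; ring.
have /is_usumE HA := qpP omega x s0 Ha; have HB := qpP omega x s0 Hb.
pose f (F : seq 'rV[int]_nu) n := (\Csum_(m <- F) (a m * b (n - m)%ring * E n))%C.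
have H1 : Clim (@fin_filter 'rV[int]_nu) (fun F => usum (f F)) (qp omega (conv a b) x).
  apply: (usum_Tannery (M := fun n => K * L * conv_cst (nu := nu) * polyw n)).
  - move=> n; have /is_usumE H := conv_usum n s0 Ha Hb.
    apply: (Clim_ext _ (Clim_mult H (Clim_const (E n)))); apply: filter_forall => F.
    rewrite /f Cmult_comm -Csum_scal; apply: eq_bigr => m _; ring.
  - exists [::] => F uF _ n; rewrite /f.
    have -> : (\Csum_(m <- F) (a m * b (n - m)%ring * E n) =
       E n * \Csum_(m <- F) (a m * b (n - m)%ring))%C.
      by rewrite -Csum_scal; apply: eq_bigr => m _; ring.
    rewrite Cmod_mult Cmod_expi Rmult_1_l.
    apply: Rle_trans (Cmod_sum_le F (fun m => conv_term_le n m s0 Ha Hb)) _.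
    apply: Rle_trans (conv_majorant_sum s n KL uF) _.
    have := expw_le_polyw n s0; have := conv_cst_gt0 (nu := nu); set e := expw s n.
    move=> c0 H; rewrite Rmult_assoc (Rmult_comm e) -Rmult_assoc.
    by apply: Rmult_le_compat_l => //; apply: Rmult_le_pos; lra.
  apply: polyw_summable; apply: Rmult_le_pos => //; exact/Rlt_le/conv_cst_gt0.
apply: Clim_unique H1 _.
apply: (Clim_ext _ (Clim_mult HA (Clim_const (qp omega b x)))).
apply: filter_forall => F; rewrite Cmult_comm -Csum_scal; symmetry; apply: usum_eq.
apply: (@is_usum_finsum _ _ F (fun m n => (a m * b (n - m)%ring * E n)%C)
  (fun m => (qp omega b x * (a m * E m))%C)) => m.
have sK : cancel (fun n : 'rV[int]_nu => n - m)%ring (fun n => n + m)%ring by move=> n; apply: GRing.subrK.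
have aK : cancel (fun n : 'rV[int]_nu => n + m)%ring (fun n => n - m)%ring by move=> n; apply: GRing.addrK.
rewrite (Cmult_comm (qp omega b x)).
apply: is_usum_ext (is_usum_scal (a m * E m)%C (is_usum_reindex sK aK HB)) => n.
by rewrite -/(E _) -(EE n m); ring.
Qed.
End QuasiPeriodic.

(** * Derivatives of complex-valued functions of a real variable *)

Global Instance locally'_proper (x : R) : ProperFilter (locally' x).
Proof. exact: (Rbar_locally'_filter x). Qed.

Definition Cder (f : R -> C) (x : R) (l : C) : Prop :=
  is_derive (K := R_AbsRing) (V := C_R_NormedModule) f x l.

Lemma norm_Cmod (z : C) : @norm R_AbsRing C_R_NormedModule z = Cmod z.
Proof.
change (sqrt (Rabs z.1 ^ 2 + Rabs z.2 ^ 2) = sqrt (z.1 ^ 2 + z.2 ^ 2)).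
by rewrite !pow2_abs.
Qed.

Lemma CderE (f : R -> C) (x : R) (l : C) :
  Cder f x l <-> forall e, 0 < e ->
    locally x (fun s => Cmod (f s - f x - RtoC (s - x) * l)%C <= e * Rabs (s - x)).
Proof.
have E s : @minus C_R_NormedModule (@minus C_R_NormedModule (f s) (f x))
    (@scal R_AbsRing C_R_NormedModule (@minus R_NormedModule s x) l) =
    (f s - f x - RtoC (s - x) * l)%C.
  apply: injective_projections.
    change ((f s).1 + - (f x).1 + - ((s + - x) * l.1) =
      (f s).1 + - (f x).1 + - ((s - x) * l.1 - 0 * l.2)); ring.
  change ((f s).2 + - (f x).2 + - ((s + - x) * l.2) =
    (f s).2 + - (f x).2 + - ((s - x) * l.2 + 0 * l.1)); ring.
split=> [[_ H] e He | H].
  have := H x (fun P q => q) (mkposreal e He).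
  by apply: filter_imp => s; rewrite E norm_Cmod.
split; first exact: is_linear_scal_l.
move=> y Hy; have <- : x = y by apply: is_filter_lim_locally_unique.
move=> e; have := H e (cond_pos e).
by apply: filter_imp => s; rewrite -norm_Cmod E.
Qed.

Lemma Cmod_pair_le (x y : R) : Cmod (x, y) <= Rabs x + Rabs y.
Proof.
rewrite (_ : (x, y) = RtoC x + Ci * RtoC y)%C.
  apply: Rle_trans (Cmod_triangle _ _) _; rewrite Cmod_mult !Cmod_R.
  have -> : Cmod Ci = 1 by rewrite /Cmod /= -[X in _ = X]sqrt_1; congr sqrt; ring.
  lra.
by apply: injective_projections; rewrite /=; ring.
Qed.

Lemma Rabs_fst_le (z : C) : Rabs z.1 <= Cmod z.
Proof. exact: Rle_trans (Rmax_l _ _) (Rmax_Cmod z). Qed.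

Lemma Rabs_snd_le (z : C) : Rabs z.2 <= Cmod z.
Proof. exact: Rle_trans (Rmax_r _ _) (Rmax_Cmod z). Qed.

Lemma is_deriveE (f : R -> R) (x l : R) :
  is_derive f x l <-> forall e, 0 < e ->
    locally x (fun s => Rabs (f s - f x - (s - x) * l) <= e * Rabs (s - x)).
Proof.
split=> [[_ H] e He | H].
  exact: (H x (fun P q => q) (mkposreal e He)).
split; first exact: is_linear_scal_l.
move=> y Hy; have <- : x = y by apply: is_filter_lim_locally_unique.
move=> e; exact: (H e (cond_pos e)).
Qed.

Lemma Cder_pair (f : R -> C) (x : R) (l : C) :
  Cder f x l <-> is_derive (fun y => (f y).1) x l.1 /\ is_derive (fun y => (f y).2) x l.2.
Proof.
have E1 s : (f s).1 - (f x).1 - (s - x) * l.1 = (f s - f x - RtoC (s - x) * l)%C.1 by rewrite /=; ring.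
have E2 s : (f s).2 - (f x).2 - (s - x) * l.2 = (f s - f x - RtoC (s - x) * l)%C.2 by rewrite /=; ring.
split=> [/CderE H | [/is_deriveE H1 /is_deriveE H2]].
  split; apply/is_deriveE => e He; apply: (filter_weaken (H e He)) => s Hs.
    by rewrite E1; apply: Rle_trans (Rabs_fst_le _) Hs.
  by rewrite E2; apply: Rle_trans (Rabs_snd_le _) Hs.
apply/CderE => e He; have e2 : 0 < e / 2 by lra.
apply: (filter_weaken (filter_and _ _ (H1 _ e2) (H2 _ e2))) => s [].
rewrite E1 E2; set z := (f s - _ - _)%C => A B.
by rewrite [z]surjective_pairing; apply: Rle_trans (Cmod_pair_le _ _) _; lra.
Qed.

(** In the form of a limit of difference quotients, termwise differentiation becomes an instance of
    [usum_Tannery]. *)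
Lemma Cder_Clim (f : R -> C) (x : R) (l : C) :
  Cder f x l <-> Clim (locally' x) (fun s => ((f s - f x) / RtoC (s - x))%C) l.
Proof.
have E s : s <> x -> ((f s - f x) / RtoC (s - x) - l =
    (f s - f x - RtoC (s - x) * l) / RtoC (s - x))%C.
  by move=> H; field => H0; have : s - x = 0 by [case: H0]; lra.
have M (s : R) (z : C) : s <> x -> Cmod (z / RtoC (s - x))%C = Cmod z / Rabs (s - x).
  by move=> H; rewrite Cmod_div ?Cmod_R // => H0; have : s - x = 0 by [case: H0]; lra.
split=> [/CderE H e He | H].
  have e2 : 0 < e / 2 by lra.
  rewrite /locally' /within; apply: (filter_weaken (H _ e2)) => s Hs sx; rewrite E // M //.
  have P : 0 < Rabs (s - x) by apply: Rabs_pos_lt; lra.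
  apply: Rle_lt_trans (_ : e / 2 * Rabs (s - x) / Rabs (s - x) < e).
    by apply: Rmult_le_compat_r => //; apply/Rlt_le/Rinv_0_lt_compat.
  by rewrite /Rdiv Rmult_assoc Rinv_r; lra.
apply/CderE => e He.
have {}H : locally x (fun s => s <> x -> Cmod ((f s - f x) / RtoC (s - x) - l)%C < e) by exact: H.
apply: (filter_weaken H) => s Hs.
case: (Req_dec s x) => [->|sx].
  rewrite Rminus_diag Rabs_R0 (_ : (_ - _ - _)%C = RtoC 0) ?Cmod_0; first lra.
  by ring.
have := Hs sx; rewrite E // M //.
have P : 0 < Rabs (s - x) by apply: Rabs_pos_lt; lra.
move=> H1; have := Rmult_lt_compat_r _ _ _ P H1.
by rewrite /Rdiv Rmult_assoc Rinv_l; lra.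
Qed.

Lemma Clim_filterlim (T : Type) (G : (T -> Prop) -> Prop) {FG : Filter G} (f : T -> C) (l : C) :
  Clim G f l <-> filterlim f G (locally (T := C_UniformSpace) l).
Proof.
split=> [H P [e He] | H e He].
  change (G (fun s => P (f s))); apply: (filter_weaken (H e (cond_pos e))) => s Hs; apply: He.
  exact: (C_NormedModule_mixin_compat1 l (f s) e Hs).
apply: (H (fun y => Cmod (y - l)%C < e)); have e2 : 0 < e / 2 by lra.
exists (mkposreal _ e2) => y Hy.
have /= H2 := C_NormedModule_mixin_compat2 _ _ _ Hy.
apply: Rlt_le_trans H2 _.
have : sqrt 2 <= 2.
  by rewrite -{2}(sqrt_Rsqr 2) ?/Rsqr; [apply: sqrt_le_1_alt | ]; lra.
nra.
Qed.

Lemma Clim_pair (T : Type) (G : (T -> Prop) -> Prop) {FG : Filter G} (f : T -> C) (l : C) :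
  Clim G f l -> filterlim (fun s => (f s).1) G (locally l.1) /\
    filterlim (fun s => (f s).2) G (locally l.2).
Proof.
move=> H; split=> P [e He];
  [change (G (fun s => P (f s).1)) | change (G (fun s => P (f s).2))]; apply: (filter_weaken (H e (cond_pos e))) => s Hs; apply: He.
  exact: Rle_lt_trans (Rabs_fst_le _) Hs.
exact: Rle_lt_trans (Rabs_snd_le _) Hs.
Qed.

Lemma Cder_unique (f : R -> C) (x : R) (l m : C) : Cder f x l -> Cder f x m -> l = m.
Proof. by move=> /Cder_Clim H /Cder_Clim H'; exact: (Clim_unique H H'). Qed.

Lemma Cder_ext_loc (f g : R -> C) (x : R) (l : C) :
  locally x (fun y => f y = g y) -> Cder f x l -> Cder g x l.
Proof. exact: is_derive_ext_loc. Qed.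

Lemma Cder_ext (f g : R -> C) (x : R) (l m : C) :
  (forall y, f y = g y) -> l = m -> Cder f x l -> Cder g x m.
Proof. by move=> E <-; apply: is_derive_ext. Qed.

Lemma Cder_cont (f : R -> C) (x : R) (l : C) : Cder f x l -> Clim (locally x) f (f x).
Proof.
move=> /CderE H e He.
have D : 0 < 1 + Cmod l by have := Cmod_ge_0 l; lra.
have d0 : 0 < e / (1 + Cmod l) by apply: Rdiv_lt_0_compat.
have B : locally x (fun s => Rabs (s - x) < e / (1 + Cmod l)).
  by exists (mkposreal _ d0) => s.
apply: (filter_weaken (filter_and _ _ (H 1 Rlt_0_1) B)) => s [H1 H2].
rewrite (_ : _ - _ = (f s - f x - RtoC (s - x) * l) + RtoC (s - x) * l)%C; last by ring.
apply: Rle_lt_trans (Cmod_triangle _ _) _; rewrite Cmod_mult Cmod_R.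
have := Rmult_lt_compat_r _ _ _ D H2.
by rewrite /Rdiv Rmult_assoc Rinv_l; [lra | lra].
Qed.

Lemma Cder_plus (f g : R -> C) (x : R) (l m : C) :
  Cder f x l -> Cder g x m -> Cder (fun y => f y + g y)%C x (l + m)%C.
Proof. exact: is_derive_plus. Qed.

Lemma Cder_const (z : C) (x : R) : Cder (fun _ => z) x (RtoC 0).
Proof. exact: is_derive_const. Qed.

Lemma Cder_Rmult (r : R -> R) (f : R -> C) (x r' : R) (l : C) :
  is_derive r x r' -> Cder f x l ->
  Cder (fun y => RtoC (r y) * f y)%C x (RtoC r' * f x + RtoC (r x) * l)%C.
Proof.
move=> Hr /Cder_pair [H1 H2]; apply/Cder_pair; split.
  apply: is_derive_ext (fun y => r y * (f y).1) _ _ _ _ _; first by move=> y /=; ring.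
  have := is_derive_mult _ _ _ _ _ Hr H1 Rmult_comm.
  by congr (is_derive _ _ _); rewrite /plus /mult /=; ring.
apply: is_derive_ext (fun y => r y * (f y).2) _ _ _ _ _; first by move=> y /=; ring.
have := is_derive_mult _ _ _ _ _ Hr H2 Rmult_comm.
by congr (is_derive _ _ _); rewrite /plus /mult /=; ring.
Qed.

Lemma Cder_scal (k : C) (f : R -> C) (x : R) (l : C) :
  Cder f x l -> Cder (fun y => k * f y)%C x (k * l)%C.
Proof.
move=> /Cder_Clim H; apply/Cder_Clim.
apply: (Clim_ext _ (Clim_scal k H)); apply: filter_forall => s.
by rewrite /Cdiv; ring.
Qed.

Lemma Cder_minus (f g : R -> C) (x : R) (l m : C) :
  Cder f x l -> Cder g x m -> Cder (fun y => f y - g y)%C x (l - m)%C.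
Proof. exact: is_derive_minus. Qed.

(** There is no mean value equality for complex values. Applying the real one to both components, at
    different intermediate points, costs the factor 2 that recurs in later constants. *)
Lemma MVT_C (f f' : R -> C) (a b L : R) :
  (forall y, Rmin a b <= y <= Rmax a b -> Cder f y (f' y)) ->
  (forall y, Rmin a b <= y <= Rmax a b -> Cmod (f' y) <= L) ->
  Cmod (f b - f a)%C <= 2 * L * Rabs (b - a).
Proof.
move=> Hf HL.
have [c1 [I1 E1]] : exists c, Rmin a b <= c <= Rmax a b /\ (f b).1 - (f a).1 = (f' c).1 * (b - a).
  apply: (MVT_gen (fun y => (f y).1) a b (fun y => (f' y).1)) => y Hy.
    by have /Cder_pair[] := Hf y ltac:(lra).
  apply/continuity_pt_filterlim/ex_derive_continuous; exists (f' y).1.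
  by have /Cder_pair[] := Hf y Hy.
have [c2 [I2 E2]] : exists c, Rmin a b <= c <= Rmax a b /\ (f b).2 - (f a).2 = (f' c).2 * (b - a).
  apply: (MVT_gen (fun y => (f y).2) a b (fun y => (f' y).2)) => y Hy.
    by have /Cder_pair[] := Hf y ltac:(lra).
  apply/continuity_pt_filterlim/ex_derive_continuous; exists (f' y).2.
  by have /Cder_pair[] := Hf y Hy.
rewrite (_ : (f b - f a)%C = ((f b).1 - (f a).1, (f b).2 - (f a).2)); last by [].
apply: Rle_trans (Cmod_pair_le _ _) _; rewrite E1 E2 !Rabs_mult.
have A1 := Rle_trans _ _ _ (Rabs_fst_le _) (HL _ I1).
have A2 := Rle_trans _ _ _ (Rabs_snd_le _) (HL _ I2).
have P := Rabs_pos (b - a).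
have := Rmult_le_compat_r _ _ _ P A1; have := Rmult_le_compat_r _ _ _ P A2; lra.
Qed.

(** * Termwise differentiation *)

(** [G] stands for either a punctured neighbourhood or a right neighbourhood of [x]. Control on the
    whole segment from [x] to [s] is what [MVT_C] needs to dominate the quotients of the terms by
    [2 * M]. *)
Lemma usum_quotient (G : (R -> Prop) -> Prop) {FG : ProperFilter G} (I : eqType)
    (f f' : R -> I -> C) (x : R) (M0 M : I -> R) :
  summable M0 -> summable M ->
  (forall P : R -> Prop, locally' x P -> G P) ->
  G (fun s => forall y, Rmin x s <= y <= Rmax x s -> forall n,
    [/\ Cder (f^~ n) y (f' y n), Cmod (f y n) <= M0 n & Cmod (f' y n) <= M n]) ->
  Clim G (fun s => ((usum (f s) - usum (f x)) / RtoC (s - x))%C) (usum (f' x)).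
Proof.
move=> s0 sM GG H.
have Hne : G (fun s => s <> x) by apply: GG; exists (mkposreal 1 Rlt_0_1) => s _.
have Hx n : Cder (f^~ n) x (f' x n).
  have [s Hs] := filter_ex _ H.
  by have [] := Hs x (conj (Rmin_l _ _) (Rmax_l _ _)) n.
apply: (Clim_ext (f := fun s => usum (fun n => (/ RtoC (s - x) * (f s n - f x n))%C))).
  apply: (filter_weaken (filter_and _ _ Hne H)) => s [sx Hs]; apply: usum_eq.
  have U1 : is_usum (f s) (usum (f s)).
    by apply: usumP s0 => n; have [] := Hs s (conj (Rmin_r _ _) (Rmax_r _ _)) n.
  have U2 : is_usum (f x) (usum (f x)).
    by apply: usumP s0 => n; have [] := Hs x (conj (Rmin_l _ _) (Rmax_l _ _)) n.
  have := is_usum_scal (/ RtoC (s - x))%C (is_usum_plus U1 (is_usum_scal (- RtoC 1)%C U2)).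
  rewrite (_ : (_ * _)%C = ((usum (f s) - usum (f x)) / RtoC (s - x))%C); last by rewrite /Cdiv; ring.
  by apply: is_usum_ext => n; ring.
apply: (usum_Tannery (M := fun n => 2 * M n)).
- move=> n; have /Cder_Clim Hn := Hx n.
  apply: (Clim_ext (f := fun s => ((f s n - f x n) / RtoC (s - x))%C)).
    by apply: filter_forall => s; rewrite /Cdiv; ring.
  by move=> e He; apply: GG; apply: Hn.
- apply: (filter_weaken (filter_and _ _ Hne H)) => s [sx Hs] n.
  have P : 0 < Rabs (s - x) by apply: Rabs_pos_lt; lra.
  rewrite Cmod_mult Cmod_inv ?Cmod_R; last by move=> E; case: E; lra.
  have B : Cmod (f s n - f x n)%C <= 2 * M n * Rabs (s - x).
    by apply: (MVT_C (f := f^~ n) (f' := f'^~ n)) => y Hy; have [] := Hs y Hy n.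
  have := Rmult_le_compat_l _ _ _ (Rlt_le _ _ (Rinv_0_lt_compat _ P)) B.
  by rewrite (_ : / Rabs (s - x) * (2 * M n * Rabs (s - x)) = 2 * M n); last by field; lra.
apply: (summable_le (k := 2) _ _ sM); last lra.
by move=> n; case: sM => M1 _; have := M1 n; lra.
Qed.

Lemma locally'_segment (x : R) (P : R -> Prop) :
  locally x P -> locally' x (fun s => forall y, Rmin x s <= y <= Rmax x s -> P y).
Proof.
move=> [e He]; exists e => s Hs _ y Hy; apply: He.
move: Hs Hy; rewrite /ball /= /AbsRing_ball /abs /minus /plus /opp /= => Hs Hy.
move: Hs Hy; rewrite /Rmin /Rmax; case: Rle_dec => H Hs Hy; move: Hs.
  rewrite !Rabs_pos_eq; lra.
rewrite -!(Rabs_Ropp (_ + - x)) !Rabs_pos_eq; lra.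
Qed.

Lemma usum_Cder (I : eqType) (f f' : R -> I -> C) (x : R) (M0 M : I -> R) :
  summable M0 -> summable M ->
  locally x (fun y => forall n,
    [/\ Cder (f^~ n) y (f' y n), Cmod (f y n) <= M0 n & Cmod (f' y n) <= M n]) ->
  Cder (fun y => usum (f y)) x (usum (f' x)).
Proof.
move=> s0 sM H; apply/Cder_Clim; apply: usum_quotient s0 sM (fun P q => q) _.
exact: locally'_segment.
Qed.

(** Each term has a two-sided derivative even at [x], but the majorants hold on [x, x + d] only, so
    that the sum is differentiated from the right. *)
Lemma usum_right_Cder (I : eqType) (f f' : R -> I -> C) (x d : R) (M0 M : I -> R) :
  summable M0 -> summable M -> 0 < d ->
  (forall y, x <= y <= x + d -> forall n,
    [/\ Cder (f^~ n) y (f' y n), Cmod (f y n) <= M0 n & Cmod (f' y n) <= M n]) ->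
  is_right_Cderive (fun y => usum (f y)) x (usum (f' x)).
Proof.
move=> s0 sM d0 H; apply/Clim_filterlim; apply: usum_quotient s0 sM _ _.
  move=> P [e He]; exists e => s Hs xs; apply: He => //; lra.
exists (mkposreal _ d0) => s Hs xs y Hy n; apply: H.
move: Hs Hy; rewrite /ball /= /AbsRing_ball /abs /minus /plus /opp /= => Hs.
rewrite Rabs_pos_eq in Hs; last lra.
rewrite Rmin_left ?Rmax_right; lra.
Qed.

Lemma is_Cderive_n_unique (f : R -> C) (k : nat) (x : R) (l m : C) :
  is_Cderive_n f k x l -> is_Cderive_n f k x m -> l = m.
Proof.
elim: k x l m => [|k IH] x l m /=; first by move=> -> ->.
move=> [g1 [L1 D1]] [g2 [L2 D2]].
apply: (Cder_unique (f := g2) (x := x)) => //.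
apply: (Cder_ext_loc _ D1); apply: (filter_weaken (filter_and _ _ L1 L2)) => y [].
exact: IH.
Qed.

Lemma is_Cderive_n_ext (f g : R -> C) (k : nat) (x : R) (l : C) :
  (forall y, f y = g y) -> is_Cderive_n f k x l -> is_Cderive_n g k x l.
Proof. by move=> /functional_extensionality ->. Qed.

Lemma is_Cderive_n2 (f f1 : R -> C) (x : R) (l : C) :
  locally x (fun y => Cder f y (f1 y)) -> Cder f1 x l -> is_Cderive_n f 2 x l.
Proof.
move=> H1 H2; exists f1; split=> //.
by apply: (filter_weaken H1) => y Hy; exists f; split=> //; apply: filter_forall.
Qed.

Lemma is_Cderive_n2_inv (f : R -> C) (x : R) (l : C) :
  is_Cderive_n f 2 x l ->
  exists f1, locally x (fun y => Cder f y (f1 y)) /\ Cder f1 x l.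
Proof.
move=> [f1 [H1 H2]]; exists f1; split=> //.
apply: (filter_weaken H1) => y [g [Hg Dg]].
by apply: (Cder_ext_loc _ Dg); apply: (filter_weaken Hg) => z /= ->.
Qed.

Lemma Cder_term (d : R) (z : C) (x : R) :
  Cder (fun y => z * expi (y * d))%C x (Ci * RtoC d * z * expi (x * d))%C.
Proof.
apply: (Cder_ext (f := fun y => (z * expi (y * d))%C) (l := (z * (Ci * RtoC d * expi (x * d)))%C)).
- by [].
- by ring.
apply: Cder_scal; apply/Cder_pair; split; rewrite /=.
  by auto_derive => //; ring.
by auto_derive => //; ring.
Qed.

Section QPDerivatives.
Context {nu : nat} (omega : 'rV[R]_nu).
Implicit Types (n : 'rV[int]_nu) (a : 'rV[int]_nu -> C).

Lemma Cmod_Ci_dot n z : Cmod (Ci * RtoC (dot n omega) * z)%C = Cmod z * Rabs (dot n omega) ^ 1.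
Proof.
rewrite !Cmod_mult Cmod_R (_ : Cmod Ci = 1); first by ring.
by rewrite /Cmod /= -[X in _ = X]sqrt_1; congr sqrt; ring.
Qed.

Lemma qp_Cder a K s x : 0 < s -> (forall n, Cmod (a n) <= K * expw s n) ->
  Cder (qp omega a) x (qp omega (fun n => Ci * RtoC (dot n omega) * a n)%C x).
Proof.
move=> s0 Ha.
(* The whole rate may be spent on the derivative: at rate 0 the weight is still [polyw], which is
   summable. *)
have [D D0 HD] := dot_pow_bound omega 1 (s' := 0) s0 Ha.
apply: (@usum_Cder _ (fun y n => (a n * expi (y * dot n omega))%C)
  (fun y n => (Ci * RtoC (dot n omega) * a n * expi (y * dot n omega))%C)
  x (fun n => K * polyw n) (fun n => D * polyw n)).
- exact: polyw_summable (bound_ge0 Ha).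
- exact: polyw_summable.
apply: filter_forall => y n; split.
- exact: Cder_term.
- exact: qp_term_le (Rlt_le _ _ s0) Ha.
- apply: (qp_term_le _ _ _ (Rle_refl 0)
    (a := fun n => (Ci * RtoC (dot n omega) * a n)%C)) => m.
  by rewrite Cmod_Ci_dot.
Qed.

Lemma qp_Cderive_n (k : nat) a K s x : 0 < s -> (forall n, Cmod (a n) <= K * expw s n) ->
  is_Cderive_n (qp omega a) k x (qp omega (fun n => (Ci * RtoC (dot n omega)) ^ k * a n)%C x).
Proof.
move=> s0 Ha; elim: k x => [|k IH] x /=.
  by congr (qp _ _ _); apply: functional_extensionality => n; ring.
exists (qp omega (fun n => (Ci * RtoC (dot n omega)) ^ k * a n)%C); split.
  exact: filter_forall.
(* Half of the rate absorbs the [k] factors already produced; the other half stays for the next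
   derivative, which requires a positive rate. *)
have s2 : s / 2 < s by lra.
have [D D0 HD] := dot_pow_bound omega k s2 Ha.
apply: Cder_ext (qp_Cder x (s := s / 2) (K := D) _ _); try lra.
- by [].
- by congr (qp _ _ _); apply: functional_extensionality => n; ring.
move=> n; rewrite Cmod_mult Rmult_comm.
suff -> : Cmod ((Ci * RtoC (dot n omega)) ^ k)%C = Rabs (dot n omega) ^ k by [].
elim: k {IH HD} => [|k IH]; first by rewrite /= Cmod_1.
by rewrite Cpow_S Cmod_Ci_dot IH /=; ring.
Qed.
End QPDerivatives.

(** * The Duhamel formula *)

(** Continuity is asked on the whole line so that primitives have two-sided derivatives at every
    time, including 0. *)
Definition Ccont (f : R -> C) : Prop := forall t, Clim (locally t) f (f t).

Lemma Ccont_Rmult (r : R -> R) (f : R -> C) :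
  (forall t, ex_derive r t) -> Ccont f -> Ccont (fun t => RtoC (r t) * f t)%C.
Proof.
move=> Hr Hf t; apply: Clim_mult => // e He.
have /filterlim_locally H := ex_derive_continuous _ _ (Hr t).
apply: (filter_weaken (H (mkposreal e He))) => s Hs.
by rewrite -RtoC_minus Cmod_R.
Qed.

Lemma Ccont_pair (f : R -> C) : Ccont f ->
  (forall t, continuous (fun s => (f s).1) t) /\ (forall t, continuous (fun s => (f s).2) t).
Proof. by move=> H; split=> t; have [] := Clim_pair (H t). Qed.

Definition prim (f : R -> C) (t : R) : C :=
  (RInt (fun s => (f s).1) 0 t, RInt (fun s => (f s).2) 0 t).

Lemma prim_0 (f : R -> C) : prim f 0 = RtoC 0.
Proof. by rewrite /prim !RInt_point. Qed.

Lemma Cder_prim (f : R -> C) (t : R) : Ccont f -> Cder (prim f) t (f t).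
Proof.
move=> /Ccont_pair [H1 H2]; apply/Cder_pair; split; rewrite /=.
  apply: (is_derive_RInt (fun s => (f s).1)) => //.
  apply: filter_forall => y; apply: RInt_correct.
  by apply: ex_RInt_continuous => z _; apply: H1.
apply: (is_derive_RInt (fun s => (f s).2)) => //.
apply: filter_forall => y; apply: RInt_correct.
by apply: ex_RInt_continuous => z _; apply: H2.
Qed.

Lemma Cder_RInt (F f : R -> C) (a b : R) :
  (forall t, Cder F t (f t)) -> Ccont f ->
  is_RInt (V := C_R_NormedModule) f a b (F b - F a)%C.
Proof.
move=> HF /Ccont_pair [H1 H2].
have -> : (F b - F a)%C = ((F b).1 - (F a).1, (F b).2 - (F a).2) by [].
apply: (is_RInt_fct_extend_pair (U := R_NormedModule) (V := R_NormedModule)).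
  apply: (is_RInt_derive (fun t => (F t).1)) => t _; last exact: H1.
  by have /Cder_pair[] := HF t.
apply: (is_RInt_derive (fun t => (F t).2)) => t _; last exact: H2.
by have /Cder_pair[] := HF t.
Qed.

(* [sin (l t) / l], continued by its limit [t] at [l = 0]. *)
Definition sinl (l t : R) : R := if Req_EM_T l 0 then t else sin (l * t) / l.

Lemma sinl_0 l : sinl l 0 = 0.
Proof.
rewrite /sinl; case: Req_EM_T => //= H; rewrite Rmult_0_r sin_0; field; lra.
Qed.

Lemma is_derive_sinl l t : is_derive (sinl l) t (cos (l * t)).
Proof.
rewrite /sinl; case: Req_EM_T => H /=.
  by rewrite H Rmult_0_l cos_0; auto_derive.
by auto_derive => //; field.
Qed.

Lemma is_derive_cosl l t : is_derive (fun s => cos (l * s)) t (- (l ^ 2 * sinl l t)).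
Proof.
rewrite /sinl; case: Req_EM_T => H /=; auto_derive => //; first by rewrite H; ring.
by field.
Qed.

Lemma sinl_minus l t s : sinl l (t - s) = sinl l t * cos (l * s) - cos (l * t) * sinl l s.
Proof.
rewrite /sinl; case: Req_EM_T => H /=; first by rewrite H !Rmult_0_l cos_0; ring.
by rewrite Rmult_minus_distr_l sin_minus; field.
Qed.

Lemma cos2_sinl2 l t : cos (l * t) ^ 2 + l ^ 2 * sinl l t ^ 2 = 1.
Proof.
rewrite /sinl; have := sin2_cos2 (l * t); rewrite !Rsqr_pow2; case: Req_EM_T => H /=.
  by move=> _; rewrite H Rmult_0_l cos_0; ring.
by move=> E; rewrite -[RHS]E; field.
Qed.

Lemma sinl_le l t : Rabs (sinl l t) <= Rabs t.
Proof.
have [c [_]] := MVT_gen (sinl l) 0 t (fun s => cos (l * s))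
  (fun s _ => is_derive_sinl l s)
  (fun s _ => proj2 (continuity_pt_filterlim _ _) (ex_derive_continuous _ _ (ex_intro _ _ (is_derive_sinl l s)))).
rewrite sinl_0 !Rminus_0_r => ->; rewrite Rabs_mult.
have : Rabs (cos (l * c)) <= 1 by apply/Rabs_le/COS_bound.
by have := Rabs_pos t; nra.
Qed.

(** The frequency dominates d^2, because its square d^2 + d^4 is at least (d^2)^2. This is where the
    fourth-order term of the equation compensates for the two derivatives on the nonlinearity. *)
Lemma sinl_disp d t : d ^ 2 * Rabs (sinl (sqrt (d ^ 2 + d ^ 4)) t) <= 1.
Proof.
set l := sqrt _.
have l0 : 0 <= l by apply: sqrt_pos.
have d2 : 0 <= d ^ 2 by apply: pow2_ge_0.
have d4 : d ^ 4 = d ^ 2 * d ^ 2 by ring.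
have ld : d ^ 2 <= l.
  by rewrite -(sqrt_pow2 (d ^ 2)) //; apply: sqrt_le_1_alt; rewrite d4; lra.
rewrite /sinl; case: Req_EM_T => H; rewrite [is_left _]/=; first by rewrite (_ : d ^ 2 = 0); lra.
have lp : 0 < l by lra.
rewrite Rabs_mult Rabs_inv (Rabs_pos_eq l) //.
have S : Rabs (sin (l * t)) <= 1 by apply/Rabs_le/SIN_bound.
apply: (Rmult_le_reg_r l) => //.
rewrite (_ : d ^ 2 * (Rabs (sin (l * t)) * / l) * l = d ^ 2 * Rabs (sin (l * t))); last by field; lra.
nra.
Qed.

Section Duhamel.
Context (l : R) (a b : C) (f : R -> C).

Definition prim_cos : R -> C := prim (fun s => RtoC (cos (l * s)) * f s)%C.
Definition prim_sin : R -> C := prim (fun s => RtoC (sinl l s) * f s)%C.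

(** Variation of constants for y'' + l^2 y = f with y(0) = a and y'(0) = b. The kernel sinl(l, t -
    s) is expanded by [sinl_minus], which moves [t] out of the integrals; no integral depending on a
    parameter has to be differentiated. *)
Definition duh (t : R) : C :=
  (RtoC (cos (l * t)) * (a - prim_sin t) + RtoC (sinl l t) * (b + prim_cos t))%C.

Definition duh' (t : R) : C :=
  (RtoC (cos (l * t)) * (b + prim_cos t) - RtoC (l ^ 2 * sinl l t) * (a - prim_sin t))%C.

Context (fc : Ccont f).

Lemma Ccont_cosl : Ccont (fun s => RtoC (cos (l * s)) * f s)%C.
Proof. by apply: Ccont_Rmult => // t; eexists; apply: is_derive_cosl. Qed.

Lemma Ccont_sinl : Ccont (fun s => RtoC (sinl l s) * f s)%C.
Proof. by apply: Ccont_Rmult => // t; eexists; apply: is_derive_sinl. Qed.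

Lemma Cder_prim_cos t : Cder prim_cos t (RtoC (cos (l * t)) * f t)%C.
Proof. by apply: (Cder_prim t Ccont_cosl). Qed.

Lemma Cder_prim_sin t : Cder prim_sin t (RtoC (sinl l t) * f t)%C.
Proof. by apply: (Cder_prim t Ccont_sinl). Qed.

Lemma duh_0 : duh 0 = a.
Proof.
rewrite /duh /prim_sin /prim_cos !prim_0 sinl_0 Rmult_0_r cos_0; ring.
Qed.

Lemma duh'_0 : duh' 0 = b.
Proof.
rewrite /duh' /prim_sin /prim_cos !prim_0 sinl_0 !Rmult_0_r cos_0; ring.
Qed.

(** The two terms in which a primitive is differentiated cancel each other. *)
Lemma Cder_duh t : Cder duh t (duh' t).
Proof.
have C1 := Cder_Rmult (is_derive_cosl l t) (Cder_minus (Cder_const a t) (Cder_prim_sin t)).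
have C2 := Cder_Rmult (is_derive_sinl l t) (Cder_plus (Cder_const b t) (Cder_prim_cos t)).
apply: Cder_ext (Cder_plus C1 C2) => //; rewrite /duh'; ring_simplify.
by rewrite !RtoC_opp; ring.
Qed.

(** Here the terms in which a primitive is differentiated add up to [f t] times cos^2 + l^2 sinl^2,
    which is 1 by [cos2_sinl2]. *)
Lemma Cder_duh' t : Cder duh' t (f t - RtoC (l ^ 2) * duh t)%C.
Proof.
have C1 := Cder_Rmult (is_derive_cosl l t) (Cder_plus (Cder_const b t) (Cder_prim_cos t)).
have D2 := is_derive_scal _ _ (l ^ 2) _ (is_derive_sinl l t).
have C2 := Cder_Rmult D2 (Cder_minus (Cder_const a t) (Cder_prim_sin t)).
apply: Cder_ext (Cder_minus C1 C2) => //; rewrite /duh.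
have E : (RtoC (cos (l * t)) ^ 2 + RtoC (l ^ 2) * RtoC (sinl l t) ^ 2 = 1)%C.
  have := f_equal RtoC (cos2_sinl2 l t); rewrite RtoC_plus RtoC_mult.
  by rewrite !RtoC_pow.
rewrite -[X in _ = (X - _)%C]Cmult_1_l -E !RtoC_opp !RtoC_mult; ring.
Qed.

(** With [t] fixed in the coefficients, the integrand has an explicit primitive in [s]. The factor
    [k] will be [Ci * RtoC l], which turns the sine kernel into exponentials. *)
Lemma duh_RInt (k : C) t :
  is_RInt (V := C_R_NormedModule) (fun s => k * (RtoC (sinl l (t - s)) * f s))%C 0 t
    (k * (duh t - RtoC (cos (l * t)) * a - RtoC (sinl l t) * b))%C.
Proof.
have -> : (k * (duh t - RtoC (cos (l * t)) * a - RtoC (sinl l t) * b) =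
   k * (RtoC (sinl l t) * prim_cos t - RtoC (cos (l * t)) * prim_sin t) -
   k * (RtoC (sinl l t) * prim_cos 0 - RtoC (cos (l * t)) * prim_sin 0))%C.
  by rewrite /duh /prim_cos /prim_sin !prim_0; ring.
apply: (Cder_RInt (F := fun s => k * (RtoC (sinl l t) * prim_cos s - RtoC (cos (l * t)) * prim_sin s))%C).
  move=> s; apply: Cder_scal.
  have := Cder_minus (Cder_scal (RtoC (sinl l t)) (Cder_prim_cos s))
    (Cder_scal (RtoC (cos (l * t))) (Cder_prim_sin s)).
  apply: Cder_ext => //; rewrite sinl_minus RtoC_minus !RtoC_mult; ring.
move=> s; apply: Clim_scal; apply: (Ccont_Rmult (r := fun s => sinl l (t - s))) => // y.
eexists; apply: (is_derive_comp (sinl l) (fun s => t - s)); first exact: is_derive_sinl.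
by auto_derive => //; reflexivity.
Qed.

(** The integral term is the increment over [0, t] of that same primitive in [s], so [MVT_C]
    replaces an integral estimate; hence [2 * L * t]. *)
Lemma duh_le t L : 0 <= t ->
  (forall s, 0 <= s <= t -> Cmod (RtoC (sinl l (t - s)) * f s)%C <= L) ->
  Cmod (duh t) <= Cmod a + t * Cmod b + 2 * L * t.
Proof.
move=> t0 HL.
have := MVT_C (f := fun s => (RtoC (sinl l t) * prim_cos s - RtoC (cos (l * t)) * prim_sin s)%C)
  (f' := fun s => (RtoC (sinl l (t - s)) * f s)%C) (a := 0) (b := t) (L := L).
rewrite Rmin_left // Rmax_right // Rminus_0_r Rabs_pos_eq // => H.
have {}H : Cmod (RtoC (sinl l t) * prim_cos t - RtoC (cos (l * t)) * prim_sin t)%C <= 2 * L * t.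
  rewrite (_ : (_ - _)%C = (RtoC (sinl l t) * prim_cos t - RtoC (cos (l * t)) * prim_sin t -
   (RtoC (sinl l t) * prim_cos 0 - RtoC (cos (l * t)) * prim_sin 0))%C); last first.
    by rewrite /prim_cos /prim_sin !prim_0; ring.
  apply: H => // s _.
  have := Cder_minus (Cder_scal (RtoC (sinl l t)) (Cder_prim_cos s))
    (Cder_scal (RtoC (cos (l * t))) (Cder_prim_sin s)).
  apply: Cder_ext => //; rewrite sinl_minus RtoC_minus !RtoC_mult; ring.
rewrite (_ : duh t = (RtoC (cos (l * t)) * a + RtoC (sinl l t) * b) +
  (RtoC (sinl l t) * prim_cos t - RtoC (cos (l * t)) * prim_sin t))%C; last by rewrite /duh; ring.
apply: Cmod_plus_le => //; apply: Cmod_plus_le; rewrite Cmod_mult Cmod_R.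
  have : Rabs (cos (l * t)) <= 1 by apply/Rabs_le/COS_bound.
  by have := Cmod_ge_0 a; nra.
apply: Rmult_le_compat_r; first exact: Cmod_ge_0.
by apply: Rle_trans (sinl_le _ _) _; rewrite Rabs_pos_eq; lra.
Qed.

End Duhamel.

Lemma duh_sub_le (l : R) (a b : C) (f g : R -> C) t L : Ccont f -> Ccont g -> 0 <= t ->
  (forall s, 0 <= s <= t -> Cmod (RtoC (sinl l (t - s)) * (f s - g s))%C <= L) ->
  Cmod (duh l a b f t - duh l a b g t)%C <= 2 * L * t.
Proof.
move=> Hf Hg t0 HL.
have H := MVT_C (a := 0) (b := t) (L := L)
  (f := fun s => ((RtoC (sinl l t) * prim_cos l f s - RtoC (cos (l * t)) * prim_sin l f s) -
    (RtoC (sinl l t) * prim_cos l g s - RtoC (cos (l * t)) * prim_sin l g s))%C)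
  (f' := fun s => (RtoC (sinl l (t - s)) * (f s - g s))%C).
rewrite Rmin_left // Rmax_right // Rminus_0_r (Rabs_pos_eq t) // in H.
rewrite (_ : (_ - _)%C = (((RtoC (sinl l t) * prim_cos l f t - RtoC (cos (l * t)) * prim_sin l f t) -
    (RtoC (sinl l t) * prim_cos l g t - RtoC (cos (l * t)) * prim_sin l g t)) -
   ((RtoC (sinl l t) * prim_cos l f 0 - RtoC (cos (l * t)) * prim_sin l f 0) -
    (RtoC (sinl l t) * prim_cos l g 0 - RtoC (cos (l * t)) * prim_sin l g 0)))%C); last first.
  by rewrite /duh /prim_cos /prim_sin !prim_0; ring.
apply: H => // s _.
have D h (Hh : Ccont h) := Cder_minus (Cder_scal (RtoC (sinl l t)) (Cder_prim_cos l Hh s))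
    (Cder_scal (RtoC (cos (l * t))) (Cder_prim_sin l Hh s)).
have := Cder_minus (D f Hf) (D g Hg).
by apply: Cder_ext => //; rewrite sinl_minus RtoC_minus !RtoC_mult; ring.
Qed.

(** For fixed [t], the quantity sinl(l, t - s) y1(s) + cos(l (t - s)) y(s) is the value at time [t]
    of the free oscillation that starts at time [s] from y(s), y1(s). It vanishes at s = 0, equals
    y(t) at s = t, and its derivative in [s] retains only the forcing. *)
Lemma oscillator_le (l t L : R) (y y1 F : R -> C) : 0 <= t ->
  (forall s, 0 <= s <= t -> Cder y s (y1 s)) ->
  (forall s, 0 <= s <= t -> Cder y1 s (F s - RtoC (l ^ 2) * y s)%C) ->
  y 0 = RtoC 0 -> y1 0 = RtoC 0 ->
  (forall s, 0 <= s <= t -> Cmod (RtoC (sinl l (t - s)) * F s)%C <= L) ->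
  Cmod (y t) <= 2 * L * t.
Proof.
move=> t0 Hy Hy1 y0 y10 HL.
have H := MVT_C (a := 0) (b := t) (L := L)
  (f := fun s => (RtoC (sinl l (t - s)) * y1 s + RtoC (cos (l * (t - s))) * y s)%C)
  (f' := fun s => (RtoC (sinl l (t - s)) * F s)%C).
rewrite Rmin_left // Rmax_right // Rminus_0_r Rminus_diag (Rabs_pos_eq t) // in H.
rewrite sinl_0 Rmult_0_r cos_0 y0 y10 in H.
rewrite (_ : y t = (0 * y1 t + 1 * y t - (RtoC (sinl l t) * 0 + RtoC (cos (l * t)) * 0)))%C; last by ring.
apply: H => // s Hs.
have D1 : is_derive (fun s => sinl l (t - s)) s (- cos (l * (t - s))).
  have D0 : is_derive (fun s => t - s) s (- 1) by auto_derive => //; ring.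
  have := is_derive_comp (sinl l) (fun s => t - s) _ _ _ (is_derive_sinl l (t - s)) D0.
  by congr (is_derive _ _ _); rewrite /scal /= /mult /=; ring.
have D2 : is_derive (fun s => cos (l * (t - s))) s (l ^ 2 * sinl l (t - s)).
  have D0 : is_derive (fun s => t - s) s (- 1) by auto_derive => //; ring.
  have := is_derive_comp (fun s => cos (l * s)) (fun s => t - s) _ _ _ (is_derive_cosl l (t - s)) D0.
  by congr (is_derive _ _ _); rewrite /scal /= /mult /=; ring.
have := Cder_plus (Cder_Rmult D1 (Hy1 s Hs)) (Cder_Rmult D2 (Hy s Hs)).
by apply: Cder_ext => //; rewrite RtoC_opp RtoC_mult; ring.
Qed.

(** * Picard iteration *)

Lemma half_pow_small (M e : R) : 0 < e -> exists k, M * (1 / 2) ^ k < e.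
Proof.
move=> He; have M1 : 0 < Rabs M + 1 by have := Rabs_pos M; lra.
have [k Hk] := pow_lt_1_zero (1 / 2) ltac:(rewrite Rabs_pos_eq; lra) (e / (Rabs M + 1))
  (Rdiv_lt_0_compat _ _ He M1).
exists k; have := Hk k (PeanoNat.Nat.le_refl k).
have P : 0 < (1 / 2) ^ k by apply: pow_lt; lra.
rewrite Rabs_pos_eq; last lra.
move=> H; have := Rmult_lt_compat_l _ _ _ M1 H.
rewrite (_ : (Rabs M + 1) * (e / (Rabs M + 1)) = e); last by field; lra.
by have := Rle_abs M; nra.
Qed.

Lemma le0_of_half_pow (x M : R) : (forall k, x <= M * (1 / 2) ^ k) -> x <= 0.
Proof.
move=> H; apply: le_epsilon => e He; have [k Hk] := half_pow_small M He.
by have := H k; lra.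
Qed.

Lemma geometric_limit (u : nat -> C) (M : R) :
  (forall k, Cmod (u k.+1 - u k)%C <= M * (1 / 2) ^ k) ->
  exists l, forall k, Cmod (u k - l)%C <= 2 * M * (1 / 2) ^ k.
Proof.
move=> H.
have P k : 0 < (1 / 2) ^ k by apply: pow_lt; lra.
have M0 : 0 <= M by have := Rle_trans _ _ _ (Cmod_ge_0 _) (H O); rewrite /=; lra.
have T k j : Cmod (u (k + j)%nat - u k)%C <= 2 * M * ((1 / 2) ^ k - (1 / 2) ^ (k + j)).
  elim: j => [|j IH].
    by rewrite addn0 (_ : (_ - _)%C = RtoC 0) ?Cmod_0; [lra | ring].
  rewrite addnS (_ : (_ - _)%C = (u (k + j).+1 - u (k + j)%nat) + (u (k + j)%nat - u k))%C; last by ring.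
  apply: Rle_trans (Cmod_plus_le (H _) IH) _; rewrite -tech_pow_Rmult; lra.
have B k j : (k <= j)%nat -> Cmod (u j - u k)%C <= 2 * M * (1 / 2) ^ k.
  by move=> kj; rewrite -(subnKC kj); apply: Rle_trans (T _ _) _; have := P (k + (j - k))%nat; nra.
have E k : eventually (fun j => Cmod (u j - u k)%C <= 2 * M * (1 / 2) ^ k).
  by exists k => j /leP; apply: B.
have [|l Hl] := (proj1 (filterlim_locally_cauchy (U := C_CompleteNormedModule)
   (F := eventually) u)).
  move=> [e He] /=; have [k Hk] := half_pow_small (4 * M) He.
  exists (fun j => Cmod (u j - u k)%C <= 2 * M * (1 / 2) ^ k); split; first exact: E.
  move=> i j Hi Hj; apply: C_NormedModule_mixin_compat1.
  change (Cmod (u j - u i)%C < e).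
  rewrite (_ : u j - u i = (u j - u k) + - (u i - u k))%C; last by ring.
  apply: Rle_lt_trans (Cmod_triangle _ _) _; rewrite Cmod_opp; lra.
exists l => k; rewrite Cmod_minus_sym.
have /Clim_filterlim L : filterlim u eventually (locally (T := C_UniformSpace) l) by exact: Hl.
exact: (Clim_le (Clim_minus L (Clim_const (u k))) (E k)).
Qed.

(** The retraction onto [0, T]. Composing with it makes the Picard iterates bounded at all times, as
    [admissible] demands, whereas the Duhamel expression itself may grow with [t]. *)
Definition clamp (T t : R) : R := Rmax 0 (Rmin t T).

Lemma clamp_range (T t : R) : 0 <= T -> 0 <= clamp T t <= T.
Proof. by move=> T0; rewrite /clamp /Rmax /Rmin; do 2 case: Rle_dec; lra. Qed.

Lemma clamp_id (T t : R) : 0 <= t <= T -> clamp T t = t.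
Proof. by move=> H; rewrite /clamp /Rmax /Rmin; do 2 case: Rle_dec; lra. Qed.

Lemma clamp_lip (T t s : R) : Rabs (clamp T t - clamp T s) <= Rabs (t - s).
Proof.
have := Rle_abs (t - s); have := Rle_abs (- (t - s)); rewrite Rabs_Ropp => H1 H2.
by apply: Rabs_le; rewrite /clamp /Rmax /Rmin; do ! case: Rle_dec; lra.
Qed.

Lemma Ccont_clamp (T : R) (f : R -> C) :
  (forall t, 0 <= t <= T -> forall e, 0 < e -> exists2 d, 0 < d &
     forall s, 0 <= s <= T -> Rabs (s - t) < d -> Cmod (f s - f t)%C < e) ->
  0 <= T -> Ccont (fun t => f (clamp T t)).
Proof.
move=> H T0 t e He; have [d d0 Hd] := H _ (clamp_range t T0) e He.
exists (mkposreal d d0) => s Hs; apply: Hd; first by apply: clamp_range.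
exact: Rle_lt_trans (clamp_lip _ _ _) Hs.
Qed.

Lemma Ccont_comp_clamp (T : R) (f : R -> C) : 0 <= T -> Ccont f -> Ccont (fun t => f (clamp T t)).
Proof.
move=> T0 Hf; apply: Ccont_clamp => // t _ e He; have [d Hd] := Hf t e He.
by exists d; [exact: cond_pos | move=> s _ Hs; apply: Hd].
Qed.

Section Picard.
Context {nu : nat} (omega : 'rV[R]_nu) (c c' : 'rV[int]_nu -> C) (sigma : R) (hs : 0 <= sigma).
Implicit Types (n m : 'rV[int]_nu) (z w : R -> 'rV[int]_nu -> C).

Definition admissible (K : R) z : Prop :=
  (forall n, Ccont (z^~ n)) /\ forall t n, Cmod (z t n) <= K * expw sigma n.

Lemma conv_cont K z n : admissible K z -> Ccont (fun t => conv (z t) (z t) n).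
Proof.
move=> [zc zK] t.
have K0 : 0 <= K := bound_ge0 (zK t).
apply: (usum_Tannery (M := conv_majorant (K * K) sigma n)).
- by move=> m; apply: Clim_mult; apply: zc.
- by apply: filter_forall => s m; apply: conv_term_le.
- by apply: conv_majorant_summable; apply: Rmult_le_pos.
Qed.

Definition source z n (t : R) : C := (- (RtoC (dot n omega ^ 2) * conv (z t) (z t) n))%C.

Lemma source_cont K z n : admissible K z -> Ccont (source z n).
Proof.
move=> az.
rewrite (_ : source z n = fun t => (- RtoC (dot n omega ^ 2) * conv (z t) (z t) n)%C).
  by move=> t; apply: Clim_scal; apply: (conv_cont n az).
by apply: functional_extensionality => t; rewrite /source; ring.
Qed.

Lemma kernel_le n t (x : C) :
  Cmod (RtoC (sinl (disp omega n) t) * - (RtoC (dot n omega ^ 2) * x))%C <= Cmod x.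
Proof.
rewrite Cmod_mult Cmod_opp Cmod_mult !Cmod_R (Rabs_pos_eq (_ ^ 2)); last exact: pow2_ge_0.
have := sinl_disp (dot n omega) t; rewrite -/(disp omega n) => H.
by have := Cmod_ge_0 x; nra.
Qed.

Definition duhamel z (t : R) n : C := duh (disp omega n) (c n) (c' n) (source z n) t.

Lemma duhamel_le K z t n : admissible K z -> 0 <= t ->
  Cmod (duhamel z t n) <=
    Cmod (c n) + t * Cmod (c' n) + 2 * (K * K * conv_cst (nu := nu) * expw sigma n) * t.
Proof.
move=> az t0; apply: duh_le => //; first exact: source_cont az.
move=> s _; apply: Rle_trans (kernel_le _ _ _) _.
by case: az => _ zK; apply: conv_le.
Qed.

Lemma duhamel_sub_le K N z w t n : admissible K z -> admissible K w -> 0 <= t ->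
  (forall s n, Cmod (z s n - w s n)%C <= N * expw sigma n) ->
  Cmod (duhamel z t n - duhamel w t n)%C <=
    2 * (2 * K * N * conv_cst (nu := nu) * expw sigma n) * t.
Proof.
move=> az aw t0 HN; apply: duh_sub_le => //; [exact: source_cont az | exact: source_cont aw |].
move=> s _; rewrite (_ : source z n s - source w n s =
  - (RtoC (dot n omega ^ 2) * (conv (z s) (z s) n - conv (w s) (w s) n)))%C; last first.
  by rewrite /source; ring.
apply: Rle_trans (kernel_le _ _ _) _.
by case: az aw => _ zK [_ wK]; apply: conv_sub_le.
Qed.

Lemma duhamel_cont K z n : admissible K z -> Ccont (fun t => duhamel z t n).
Proof. by move=> az t; apply: Cder_cont; apply: Cder_duh; apply: source_cont az. Qed.

Context (K T : R) (K0 : 0 <= K) (T0 : 0 <= T).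
(** [HK] bounds the right-hand side of [duhamel_le] at time [T], so that the ball of radius [K] is
    mapped to itself; [HT] makes the factor 4 K conv_cst T of [duhamel_sub_le] at most 1/2. *)
Context (HK : forall n, Cmod (c n) + T * Cmod (c' n) +
  2 * (K * K * conv_cst (nu := nu) * expw sigma n) * T <= K * expw sigma n).
Context (HT : 4 * K * conv_cst (nu := nu) * T <= 1 / 2).

Definition picard_map z (t : R) n : C := duhamel z (clamp T t) n.

Lemma picard_map_admissible z : admissible K z -> admissible K (picard_map z).
Proof.
move=> az; split=> [n|t n].
  exact: (@Ccont_comp_clamp _ (fun t => duhamel z t n) T0 (duhamel_cont n az)).
have [t0 tT] := clamp_range t T0.
apply: Rle_trans (duhamel_le n az t0) _; apply: Rle_trans (HK n).
have X0 : 0 <= K * K * conv_cst (nu := nu) * expw sigma n.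
  have := conv_cst_gt0 (nu := nu); have := expw_gt0 sigma n => A1 A2.
  by apply: Rmult_le_pos; [apply: Rmult_le_pos; [exact: Rmult_le_pos|lra] | lra].
by have := Cmod_ge_0 (c' n); nra.
Qed.

Lemma picard_map_contraction N z w : admissible K z -> admissible K w ->
  (forall s n, Cmod (z s n - w s n)%C <= N * expw sigma n) ->
  forall s n, Cmod (picard_map z s n - picard_map w s n)%C <= N / 2 * expw sigma n.
Proof.
move=> az aw HN s n; have [t0 tT] := clamp_range s T0.
apply: Rle_trans (duhamel_sub_le n az aw t0 HN) _.
have N0 : 0 <= N := bound_ge0 (HN 0).
have X : 4 * K * conv_cst (nu := nu) * clamp T s <= 1 / 2.
  apply: Rle_trans HT; apply: Rmult_le_compat_l => //.
  by have := conv_cst_gt0 (nu := nu); nra.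
have E0 := expw_gt0 sigma n.
have := Rmult_le_compat_r (N * expw sigma n) _ _ ltac:(nra) X; lra.
Qed.

Fixpoint picard (k : nat) : R -> 'rV[int]_nu -> C :=
  if k is k'.+1 then picard_map (picard k') else fun _ _ => RtoC 0.

Lemma picard_admissible k : admissible K (picard k).
Proof.
elim: k => [|k IH]; last exact: picard_map_admissible.
split=> [n t|t n]; first exact: Clim_const.
by rewrite /= Cmod_0; apply: Rmult_le_pos => //; exact/Rlt_le/expw_gt0.
Qed.

Lemma picard_step k t n :
  Cmod (picard k.+1 t n - picard k t n)%C <= K * (1 / 2) ^ k * expw sigma n.
Proof.
elim: k t n => [|k IH] t n.
  rewrite (_ : (_ - picard 0 t n)%C = picard 1 t n); last by rewrite /=; ring.
  rewrite Rmult_1_r; exact: (proj2 (picard_admissible 1)).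
apply: Rle_trans (picard_map_contraction (picard_admissible k.+1) (picard_admissible k) IH t n) _.
by rewrite -tech_pow_Rmult; lra.
Qed.

(** The limit is chosen separately for each [t] and [n], but the geometric rate does not depend on
    [t], so continuity passes to the limit. The equation is claimed on [0, T], where clamping
    changes nothing. *)
Lemma picard_fixpoint : exists2 z, admissible K z &
  forall t n, 0 <= t <= T -> z t n = duhamel z t n.
Proof.
have L t n : exists l, forall k, Cmod (picard k t n - l)%C <= 2 * (K * expw sigma n) * (1 / 2) ^ k.
  by apply: geometric_limit => k; have := picard_step k t n; lra.
pose z t n := ClassicalEpsilon.epsilon (inhabits (RtoC 0))
  (fun l => forall k, Cmod (picard k t n - l)%C <= 2 * (K * expw sigma n) * (1 / 2) ^ k).
have Hz t n k : Cmod (picard k t n - z t n)%C <= 2 * (K * expw sigma n) * (1 / 2) ^ k.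
  exact: (ClassicalEpsilon.epsilon_spec (inhabits (RtoC 0)) _ (L t n)).
have az : admissible K z.
  split=> [n t e He|t n].
    have e3 : 0 < e / 3 by lra.
    have [k Hk] := half_pow_small (2 * (K * expw sigma n)) e3.
    apply: (filter_weaken (proj1 (picard_admissible k) n t _ e3)) => s Hs.
    rewrite (_ : _ - _ = (picard k s n - picard k t n) + (- (picard k s n - z s n) + (picard k t n - z t n)))%C; last by ring.
    apply: Rle_lt_trans (Cmod_triangle _ _) _.
    have := Cmod_triangle (- (picard k s n - z s n))%C (picard k t n - z t n)%C.
    rewrite Cmod_opp; have := Hz s n k; have := Hz t n k; lra.
  suff : Cmod (z t n) - K * expw sigma n <= 0 by lra.
  apply: (@le0_of_half_pow _ (2 * (K * expw sigma n))) => k.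
  have := Cmod_triangle (picard k t n) (- (picard k t n - z t n))%C.
  rewrite Cmod_opp (_ : (_ + - _)%C = z t n); last by ring.
  by have := Hz t n k; have := proj2 (picard_admissible k) t n; lra.
exists z => // t n tT.
have -> : duhamel z t n = picard_map z t n by rewrite /picard_map clamp_id.
apply: Cmod_minus_eq0 => e He.
have [k Hk] := half_pow_small (2 * (K * expw sigma n)) He.
have N s m : Cmod (picard k s m - z s m)%C <= 2 * K * (1 / 2) ^ k * expw sigma m.
  by have := Hz s m k; lra.
have H1 := picard_map_contraction (picard_admissible k) az N t n.
have H2 := Hz t n k.+1.
rewrite (_ : _ - _ = - (picard k.+1 t n - z t n) + (picard_map (picard k) t n - picard_map z t n))%C; last first.
  by rewrite /=; ring.
apply: Rle_lt_trans (Cmod_triangle _ _) _; rewrite Cmod_opp.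
by move: H2; rewrite -tech_pow_Rmult; lra.
Qed.
End Picard.

(** * The equation on Fourier coefficients *)

Section Equation.
Context {nu : nat} (omega : 'rV[R]_nu).
Implicit Types (n m : 'rV[int]_nu) (a : 'rV[int]_nu -> C).

Lemma disp_sqr n : disp omega n ^ 2 = dot n omega ^ 2 + dot n omega ^ 4.
Proof.
rewrite /disp pow2_sqrt //; have := pow2_ge_0 (dot n omega); have := pow2_ge_0 (dot n omega ^ 2).
by rewrite -pow_mult /=; lra.
Qed.

Definition rhs a n : C :=
  (- (RtoC (dot n omega ^ 2) * conv a a n) - RtoC (disp omega n ^ 2) * a n)%C.

(** [D] is chosen before [a]: one constant serves the coefficients at all times simultaneously. *)
Lemma rhs_bound K s : 0 < s -> 0 <= K -> exists2 D, 0 <= D &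
  forall a, (forall n, Cmod (a n) <= K * expw s n) ->
  forall n, Cmod (rhs a n) <= D * expw (s / 2) n.
Proof.
move=> s0 K0; have s2 : s / 2 < s by lra.
have [D2 D20 H2] := dot_pow_expw omega 2 s2.
have [D4 D40 H4] := dot_pow_expw omega 4 s2.
have KA : 0 <= K * K * conv_cst (nu := nu).
  by apply: Rmult_le_pos; [exact: Rmult_le_pos | exact/Rlt_le/conv_cst_gt0].
exists (D2 * (K * K * conv_cst (nu := nu)) + (D2 + D4) * K).
  by apply: Rplus_le_le_0_compat; apply: Rmult_le_pos; lra.
move=> a Ha n.
have E2 : Rabs (dot n omega ^ 2) = Rabs (dot n omega) ^ 2 by rewrite RPow_abs.
have P2 : 0 <= Rabs (dot n omega) ^ 2 by apply/pow_le/Rabs_pos.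
have P4 : 0 <= Rabs (dot n omega) ^ 4 by apply/pow_le/Rabs_pos.
have B1 : Cmod (- (RtoC (dot n omega ^ 2) * conv a a n))%C <= K * K * conv_cst (nu := nu) * (D2 * expw (s / 2) n).
  rewrite Cmod_opp Cmod_mult Cmod_R E2.
  have H := Rmult_le_compat_l _ _ _ P2 (conv_le n (Rlt_le _ _ s0) Ha Ha).
  have := Rmult_le_compat_l _ _ _ KA (H2 n); lra.
have B2 : Cmod (- (RtoC (disp omega n ^ 2) * a n))%C <= K * ((D2 + D4) * expw (s / 2) n).
  rewrite Cmod_opp Cmod_mult Cmod_R disp_sqr.
  have E : Rabs (dot n omega ^ 2 + dot n omega ^ 4) <= Rabs (dot n omega) ^ 2 + Rabs (dot n omega) ^ 4.
    by apply: Rle_trans (Rabs_triang _ _) _; rewrite !RPow_abs; lra.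
  apply: Rle_trans (Rmult_le_compat _ _ _ _ (Rabs_pos _) (Cmod_ge_0 _) E (Ha n)) _.
  have := Rmult_le_compat_l _ _ _ K0 (H2 n); have := Rmult_le_compat_l _ _ _ K0 (H4 n); lra.
by apply: Rle_trans (Cmod_plus_le B1 B2) _; lra.
Qed.

(** The spatial half of the equation at a frozen time, with the series of [rhs] in the place of
    u_tt. For the constructed solution it remains to show that u_tt is this series; for a given
    solution it shows that u_tt must be this series. *)
Lemma qp_equation a K s x : 0 < s -> (forall n, Cmod (a n) <= K * expw s n) ->
  exists axxxx axx a2xx : C,
    [/\ is_Cderive_n (qp omega a) 4 x axxxx, is_Cderive_n (qp omega a) 2 x axx,
      is_Cderive_n (fun y => (qp omega a y * qp omega a y)%C) 2 x a2xx &
      (qp omega (rhs a) x + axxxx - axx - a2xx)%C = RtoC 0].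
Proof.
move=> s0 Ha; have sw := Rlt_le _ _ s0.
have Hc n : Cmod (conv a a n) <= K * K * conv_cst (nu := nu) * expw s n by apply: conv_le.
have D4 := qp_Cderive_n omega 4 x s0 Ha.
have D2 := qp_Cderive_n omega 2 x s0 Ha.
have D2' := qp_Cderive_n omega 2 x s0 Hc.
eexists; eexists; eexists; split; [exact: D4 | exact: D2 | | ].
  apply: is_Cderive_n_ext D2' => y; exact: (qp_conv omega y sw Ha Ha).
have [R R0 HR] := rhs_bound s0 (bound_ge0 Ha).
have S1 := qpP omega x (s := s / 2) ltac:(lra) (HR a Ha).
have Q (k : nat) (b : 'rV[int]_nu -> C) L : (forall n, Cmod (b n) <= L * expw s n) ->
    is_qp_sum omega (fun n => (Ci * RtoC (dot n omega)) ^ k * b n)%C x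
      (qp omega (fun n => (Ci * RtoC (dot n omega)) ^ k * b n)%C x).
  move=> Hb; have [D D0 HD] := dot_pow_bound omega k s0 Hb.
  apply: (qpP _ _ (Rle_refl 0) (K := D)) => n.
  rewrite Cmod_mult Rmult_comm; suff -> : Cmod ((Ci * RtoC (dot n omega)) ^ k)%C = Rabs (dot n omega) ^ k by [].
  elim: k {HD} => [|k IH]; first by rewrite /= Cmod_1.
  by rewrite Cpow_S Cmod_Ci_dot IH /=; ring.
have := is_usum_plus (is_usum_plus (is_usum_plus S1 (Q 4%nat _ _ Ha))
   (is_usum_scal (- RtoC 1)%C (Q 2%nat _ _ Ha))) (is_usum_scal (- RtoC 1)%C (Q 2%nat _ _ Hc)).
(* Scaled by 0, the convergent series has sum 0; uniqueness of sums then reduces the equation to an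
   identity between terms. *)
move=> H; have E0 := is_usum_scal (RtoC 0) H.
rewrite Cmult_0_l in E0.
apply: is_usum_unique E0.
move: H; rewrite (_ : (_ + _ + - RtoC 1 * _ + - RtoC 1 * _)%C =
  (qp omega (rhs a) x + qp omega (fun n => (Ci * RtoC (dot n omega)) ^ 4 * a n)%C x
  - qp omega (fun n => (Ci * RtoC (dot n omega)) ^ 2 * a n)%C x
  - qp omega (fun n => (Ci * RtoC (dot n omega)) ^ 2 * conv a a n)%C x)%C); last by ring.
apply: is_usum_ext => n; rewrite /rhs disp_sqr RtoC_plus !RtoC_pow.
have I2 : (Ci * Ci = - RtoC 1)%C by apply: injective_projections; rewrite /=; ring.
have E2 (z : C) : ((Ci * z) ^ 2 = - (z ^ 2))%C.
  have -> : ((Ci * z) ^ 2 = (Ci * Ci) * z ^ 2)%C by ring.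
  by rewrite I2; ring.
have E4 (z : C) : ((Ci * z) ^ 4 = z ^ 4)%C.
  have -> : ((Ci * z) ^ 4 = (Ci * Ci) * (Ci * Ci) * z ^ 4)%C by ring.
  by rewrite I2; ring.
by rewrite E2 E4; ring.
Qed.

(** * Series with twice differentiable coefficients *)

(** Bounds are assumed on the data at time 0 and on the second derivative; those on [Y] and [Y1]
    follow from the mean value inequality. This serves both the Duhamel solution and the twice
    integrated forcing of a given solution. *)
Context (T s K0 K1 K2 : R) (Y Y1 Y2 : R -> 'rV[int]_nu -> C).
Context (T0 : 0 < T) (s0 : 0 <= s).
Context (DY : forall t n, Cder (Y^~ n) t (Y1 t n)) (DY1 : forall t n, Cder (Y1^~ n) t (Y2 t n)).
Context (B0 : forall n, Cmod (Y 0 n) <= K0 * expw s n) (B1 : forall n, Cmod (Y1 0 n) <= K1 * expw s n).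
Context (B2 : forall t n, 0 <= t <= T -> Cmod (Y2 t n) <= K2 * expw s n).

Lemma coef_grow (F F1 : R -> 'rV[int]_nu -> C) L0 L1 :
  (forall t n, Cder (F^~ n) t (F1 t n)) ->
  (forall n, Cmod (F 0 n) <= L0 * expw s n) ->
  (forall t n, 0 <= t <= T -> Cmod (F1 t n) <= L1 * expw s n) ->
  forall t n, 0 <= t <= T -> Cmod (F t n) <= (L0 + 2 * L1 * T) * expw s n.
Proof.
move=> DF HF0 HF1 t n tT.
have H := MVT_C (f := F^~ n) (f' := F1^~ n) (a := 0) (b := t) (L := L1 * expw s n).
rewrite Rmin_left ?Rmax_right ?Rminus_0_r ?(Rabs_pos_eq t) in H; try lra.
rewrite (_ : F t n = F 0 n + (F t n - F 0 n))%C; last by ring.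
have {}H : Cmod (F t n - F 0 n)%C <= 2 * (L1 * expw s n) * t.
  by apply: H => y Hy; [exact: DF | apply: HF1; lra].
have P : 0 <= L1 * expw s n by apply: Rle_trans (Cmod_ge_0 _) (HF1 t n tT).
have P' : L1 * expw s n * t <= L1 * expw s n * T by apply: Rmult_le_compat_l => //; lra.
by apply: Rle_trans (Cmod_plus_le (HF0 n) H) _; lra.
Qed.

Definition coef_bound1 := K1 + 2 * K2 * T.
Definition coef_bound := K0 + 2 * coef_bound1 * T.

Lemma coef1_le t n : 0 <= t <= T -> Cmod (Y1 t n) <= coef_bound1 * expw s n.
Proof. exact: coef_grow DY1 B1 B2 t n. Qed.

Lemma coef_le t n : 0 <= t <= T -> Cmod (Y t n) <= coef_bound * expw s n.
Proof. exact: coef_grow DY B0 coef1_le t n. Qed.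

Lemma Cder_term_mul (f : R -> C) t (l k : C) :
  Cder f t l -> Cder (fun y => f y * k)%C t (l * k)%C.
Proof. by move=> H; apply: Cder_ext (Cder_scal k H) => [y|]; ring. Qed.

Lemma bound_ge0_at (F : R -> 'rV[int]_nu -> C) L :
  (forall t n, 0 <= t <= T -> Cmod (F t n) <= L * expw s n) -> 0 <= L.
Proof. by move=> H; apply: (bound_ge0 (a := F 0) (s := s)) => n; apply: H; lra. Qed.

Lemma qp_time_Cder (F F1 : R -> 'rV[int]_nu -> C) L0 L1 x t : 0 < t < T ->
  (forall t n, Cder (F^~ n) t (F1 t n)) ->
  (forall t n, 0 <= t <= T -> Cmod (F t n) <= L0 * expw s n) ->
  (forall t n, 0 <= t <= T -> Cmod (F1 t n) <= L1 * expw s n) ->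
  Cder (fun t => qp omega (F t) x) t (qp omega (F1 t) x).
Proof.
move=> tT DF HF HF1.
apply: (@usum_Cder _ (fun t n => (F t n * expi (x * dot n omega))%C)
  (fun t n => (F1 t n * expi (x * dot n omega))%C)
  t (fun n => L0 * polyw n) (fun n => L1 * polyw n)).
- exact: polyw_summable (bound_ge0_at HF).
- exact: polyw_summable (bound_ge0_at HF1).
have d0 : 0 < Rmin t (T - t) by apply: Rmin_pos; lra.
exists (mkposreal _ d0) => y Hy n.
have {}Hy : 0 <= y <= T.
  move: Hy; rewrite /ball /= /AbsRing_ball /abs /minus /plus /opp /= => /Rabs_def2 [].
  by have := Rmin_l t (T - t); have := Rmin_r t (T - t); lra.
split.
- exact: Cder_term_mul.
- by apply: (qp_term_le omega x n s0) => m; apply: HF.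
- by apply: (qp_term_le omega x n s0) => m; apply: HF1.
Qed.

Lemma qp_time_Cder1 x t : 0 < t < T ->
  Cder (fun t => qp omega (Y t) x) t (qp omega (Y1 t) x).
Proof. by move=> tT; apply: qp_time_Cder tT DY coef_le coef1_le. Qed.

Lemma qp_time_Cder2 x t : 0 < t < T ->
  Cder (fun t => qp omega (Y1 t) x) t (qp omega (Y2 t) x).
Proof. by move=> tT; apply: qp_time_Cder tT DY1 coef1_le B2. Qed.

Lemma qp_time_right x : is_right_Cderive (fun t => qp omega (Y t) x) 0 (qp omega (Y1 0) x).
Proof.
apply: (@usum_right_Cder _ (fun t n => (Y t n * expi (x * dot n omega))%C)
  (fun t n => (Y1 t n * expi (x * dot n omega))%C)
  0 T (fun n => coef_bound * polyw n) (fun n => coef_bound1 * polyw n)) => //.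
- exact: polyw_summable (bound_ge0_at coef_le).
- exact: polyw_summable (bound_ge0_at coef1_le).
move=> y; rewrite Rplus_0_l => Hy n; split.
- exact: Cder_term_mul.
- by apply: (qp_term_le omega x n s0) => m; apply: coef_le.
- by apply: (qp_term_le omega x n s0) => m; apply: coef1_le.
Qed.
End Equation.

(** * Coefficients are controlled by the supremum of the series *)

Section CoefficientBound.
Context {nu : nat} (omega : 'rV[R]_nu)
  (homega : forall n : 'rV[int]_nu, n <> 0%ring -> dot n omega <> 0).
Implicit Types (n m k : 'rV[int]_nu) (a b : 'rV[int]_nu -> C).

Lemma expi_PI : expi PI = (- RtoC 1)%C.
Proof. by rewrite /expi cos_PI sin_PI; apply: injective_projections; rewrite /= ?Ropp_0. Qed.

(* Averaging [f x] with [f (x + r) exp (- i r n.omega)], where [r (m - n).omega = PI],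
   removes the mode [m], keeps the mode [n], and does not increase the supremum. *)
Lemma kill_mode a K s n m L : 0 <= s -> (forall k, Cmod (a k) <= K * expw s k) -> m <> n ->
  (forall x, Cmod (qp omega a x) <= L) ->
  exists b, [/\ b n = a n, b m = RtoC 0, (forall k, Cmod (b k) <= Cmod (a k)),
    (forall k, a k = RtoC 0 -> b k = RtoC 0) & forall x, Cmod (qp omega b x) <= L].
Proof.
move=> s0 Ha mn HL.
have dmn : dot m omega - dot n omega <> 0.
  rewrite -dotB; apply: homega => E; apply: mn.
  by rewrite -(GRing.subrK n m) E GRing.add0r.
pose r := PI / (dot m omega - dot n omega).
pose e k := expi (r * (dot k omega - dot n omega)).
exists (fun k => RtoC (/ 2) * (a k * (1 + e k)))%C.
have half : (RtoC (/ 2) * (1 + 1) = 1)%C by apply: injective_projections; rewrite /=; field.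
split.
- rewrite /e Rminus_diag Rmult_0_r expi_0.
  by transitivity (RtoC (/ 2) * (1 + 1) * a n)%C; [ring | rewrite half; ring].
- rewrite /e (_ : r * _ = PI) ?expi_PI; last by rewrite /r; field.
  by ring.
- move=> k; rewrite !Cmod_mult Cmod_R Rabs_pos_eq; last lra.
  have : Cmod (1 + e k)%C <= 2.
    by apply: Rle_trans (Cmod_triangle _ _) _; rewrite Cmod_1 Cmod_expi; lra.
  by have := Cmod_ge_0 (a k); have := Cmod_ge_0 (1 + e k)%C; nra.
- by move=> k ->; ring.
move=> x.
have S1 := qpP omega x s0 Ha; have S2 := qpP omega (x + r) s0 Ha.
have := is_usum_scal (RtoC (/ 2)) (is_usum_plus S1 (is_usum_scal (expi (- (r * dot n omega))) S2)).
move=> H; rewrite (qp_eq (S := (RtoC (/ 2) * (qp omega a x + expi (- (r * dot n omega)) * qp omega a (x + r)%R))%C)).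
  rewrite Cmod_mult Cmod_R Rabs_pos_eq; last lra.
  have := Cmod_triangle (qp omega a x) (expi (- (r * dot n omega)) * qp omega a (x + r)%R)%C.
  by rewrite Cmod_mult Cmod_expi; have := HL x; have := HL (x + r); lra.
apply: is_usum_ext H => k; rewrite /e.
have -> : expi ((x + r) * dot k omega) = (expi (x * dot k omega) * expi (r * dot k omega))%C.
  by rewrite -expi_plus; congr expi; ring.
have -> : expi (r * (dot k omega - dot n omega)) = (expi (- (r * dot n omega)) * expi (r * dot k omega))%C.
  by rewrite -expi_plus; congr expi; ring.
ring.
Qed.

(** Modes can be removed one after another because [kill_mode] leaves vanishing coefficients equal
    to zero. *)
Lemma kill_modes (F : seq 'rV[int]_nu) a K s n L :
  0 <= s -> (forall k, Cmod (a k) <= K * expw s k) ->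
  (forall x, Cmod (qp omega a x) <= L) ->
  exists b, [/\ b n = a n, (forall k, Cmod (b k) <= Cmod (a k)),
    (forall m, m \in F -> m <> n -> b m = RtoC 0) & forall x, Cmod (qp omega b x) <= L].
Proof.
move=> s0 Ha HL; elim: F => [|m F [b [bn ba bF bL]]].
  by exists a; split=> // k; apply: Rle_refl.
case: (eqVneq m n) => [->|/eqP mn].
  by exists b; split=> // k; rewrite inE => /orP[/eqP -> [] //|]; apply: bF.
have Hb k : Cmod (b k) <= K * expw s k by apply: Rle_trans (ba k) (Ha k).
have [d [dn dm db d0 dL]] := kill_mode s0 Hb mn bL.
exists d; split=> //; [by rewrite dn | by move=> k; apply: Rle_trans (db k) (ba k) |].
by move=> k; rewrite inE => /orP[/eqP -> _ //|kF kn]; apply: d0; apply: bF.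
Qed.

(** Once all modes of a large finite set other than [n] are removed, the value of the remaining
    series at x = 0 is [a n] up to a tail of size [e], while it is still bounded by [L]. No mean
    over x is taken. *)
Lemma coef_le_sup a K s n L : 0 <= s -> (forall k, Cmod (a k) <= K * expw s k) ->
  (forall x, Cmod (qp omega a x) <= L) -> Cmod (a n) <= L.
Proof.
move=> s0 Ha HL; apply: le_epsilon => e He.
have sM := polyw_summable (nu := nu) (bound_ge0 Ha).
have [F0 u0 H0] := summable_tail sM He.
have [b [bn ba bF bL]] := kill_modes F0 n s0 Ha HL.
have Hb k : Cmod (b k) <= K * expw s k by apply: Rle_trans (ba k) (Ha k).
pose F1 := n :: [seq k <- F0 | k != n].
have u1 : uniq F1 by rewrite /= mem_filter eqxx filter_uniq.
have H1 F : uniq F -> {in F, forall i, i \notin F1} -> \Rsum_(i <- F) (K * polyw i) <= e.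
  move=> uF dF; apply: H0 => // i /dF; rewrite inE mem_filter negb_or => /andP[/negbTE -> /=].
  by [].
have := usum_head (fun k => qp_term_le omega 0 k s0 Hb) sM u1 H1.
have -> : (\Csum_(i <- F1) (b i * expi (0 * dot i omega)))%C = a n.
  rewrite big_cons big1_seq => [|k /andP[_]].
    by rewrite Cplus_0_r Rmult_0_l expi_0 bn Cmult_1_r.
  rewrite mem_filter => /andP[/eqP kn kF]; rewrite bF //; ring.
rewrite -/(qp omega b 0) => H.
rewrite (_ : a n = qp omega b 0 - (qp omega b 0 - a n))%C; last by ring.
by apply: Rle_trans (Cmod_triangle _ _) _; rewrite Cmod_opp; have := bL 0; lra.
Qed.

Lemma qp_minus a b K L s x : 0 <= s ->
  (forall k, Cmod (a k) <= K * expw s k) -> (forall k, Cmod (b k) <= L * expw s k) ->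
  qp omega (fun k => a k - b k)%C x = (qp omega a x - qp omega b x)%C.
Proof.
move=> s0 Ha Hb; apply: qp_eq.
have := is_usum_plus (qpP omega x s0 Ha) (is_usum_scal (- RtoC 1)%C (qpP omega x s0 Hb)).
rewrite (_ : _ + _ = qp omega a x - qp omega b x)%C; last by ring.
by apply: is_usum_ext => k; ring.
Qed.

Lemma coef_dist_le a b K L s M n : 0 <= s ->
  (forall k, Cmod (a k) <= K * expw s k) -> (forall k, Cmod (b k) <= L * expw s k) ->
  (forall x, Cmod (qp omega a x - qp omega b x)%C <= M) -> Cmod (a n - b n)%C <= M.
Proof.
move=> s0 Ha Hb HM.
apply: (coef_le_sup (a := fun k => (a k - b k)%C) (K := K + L) n s0).
  by move=> k; apply: Rle_trans (Cmod_triangle _ _) _; rewrite Cmod_opp; have := Ha k; have := Hb k; lra.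
by move=> x; rewrite (qp_minus x s0 Ha Hb).
Qed.

Lemma coef_unique a b K L s n : 0 <= s ->
  (forall k, Cmod (a k) <= K * expw s k) -> (forall k, Cmod (b k) <= L * expw s k) ->
  (forall x, qp omega a x = qp omega b x) -> a n = b n.
Proof.
move=> s0 Ha Hb E; apply: Cmod_minus_eq0 => e He.
apply: Rle_lt_trans He; apply: (coef_dist_le n s0 Ha Hb) => x.
by rewrite E (_ : (_ - _)%C = RtoC 0) ?Cmod_0; [lra | ring].
Qed.
End CoefficientBound.

(** * Functions twice differentiable on an open interval *)

(* Taylor expansion with step [T / 4] towards the middle of the interval bounds the
   first derivative by the function and its second derivative. *)
Lemma derivative_bound (T V M : R) (w w1 w2 : R -> C) :
  (forall t, 0 < t < T -> Cder w t (w1 t)) ->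
  (forall t, 0 < t < T -> Cder w1 t (w2 t)) ->
  (forall t, 0 < t < T -> Cmod (w t) <= V) ->
  (forall t, 0 < t < T -> Cmod (w2 t) <= M) ->
  forall t, 0 < t < T -> Cmod (w1 t) <= 8 * V / T + M * T.
Proof.
move=> D1 D2 HV HM t tT.
have T0 : 0 < T by lra.
have [r [rT tr]] : exists r, Rabs r = T / 4 /\ 0 < t + r < T.
  case: (Rle_dec t (T / 2)) => H.
    by exists (T / 4); rewrite Rabs_pos_eq; lra.
  by exists (- (T / 4)); rewrite Rabs_Ropp Rabs_pos_eq; lra.
have seg y : Rmin t (t + r) <= y <= Rmax t (t + r) -> 0 < y < T /\ Rabs (y - t) <= T / 4.
  move=> H; split.
    by move: H; rewrite /Rmin /Rmax; case: Rle_dec; lra.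
  rewrite -rT; move: H; rewrite /Rmin /Rmax; case: Rle_dec => H1 H2.
    by rewrite !Rabs_pos_eq; lra.
  by rewrite -Rabs_Ropp -(Rabs_Ropp r) !Rabs_pos_eq; lra.
have M0 : 0 <= M by apply: Rle_trans (Cmod_ge_0 _) (HM t tT).
have N : Cmod ((w (t + r)%R - RtoC (t + r)%R * w1 t) - (w t - RtoC t * w1 t))%C <= 2 * (2 * M * (T / 4)) * Rabs (t + r - t).
  apply: (MVT_C (f := fun y => (w y - RtoC y * w1 t)%C) (f' := fun y => (w1 y - w1 t)%C)) => y /seg [yT yt].
    have := Cder_minus (D1 y yT) (Cder_Rmult (is_derive_id y) (Cder_const (w1 t) y)).
    by apply: Cder_ext => //; rewrite /one /=; ring.
  have B := MVT_C (f := w1) (f' := w2) (a := t) (b := y) (L := M).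
  apply: Rle_trans (B _ _) _; last by apply: Rmult_le_compat_l; lra.
    move=> q Hq; apply: D2; move: Hq; rewrite /Rmin /Rmax; case: Rle_dec; lra.
  move=> q Hq; apply: HM; move: Hq; rewrite /Rmin /Rmax; case: Rle_dec; lra.
have {}N : Cmod (RtoC r * w1 t)%C <= 2 * V + M * T * (T / 4).
  rewrite (_ : RtoC r * w1 t = - ((w (t + r)%R - RtoC (t + r)%R * w1 t) - (w t - RtoC t * w1 t)) +
    (w (t + r)%R + - w t))%C; last by rewrite RtoC_plus; ring.
  apply: Rle_trans (Cmod_triangle _ _) _; rewrite Cmod_opp.
  have := Cmod_triangle (w (t + r)%R) (- w t)%C; rewrite Cmod_opp.
  move: N; rewrite (_ : t + r - t = r) ?rT; last by ring.
  by have := HV _ tr; have := HV _ tT; lra.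
move: N; rewrite Cmod_mult Cmod_R rT => N.
apply: (Rmult_le_reg_l (T / 4)); first lra.
by apply: Rle_trans N _; apply: Req_le; field; lra.
Qed.

Lemma right_Cder_cont (w : R -> C) (l : C) :
  Clim (at_right 0) (fun s => ((w s - w 0) / RtoC (s - 0)%R)%C) l -> Clim (at_right 0) w (w 0).
Proof.
move=> H.
have id0 : Clim (at_right 0) (fun s => RtoC s) (RtoC 0).
  move=> e He; exists (mkposreal e He) => s Hs _; rewrite -RtoC_minus Cmod_R; exact: Hs.
assert (H1 := Clim_plus (Clim_const (w 0)) (Clim_mult id0 H)).
move: H1; rewrite (_ : (w 0 + 0 * l)%C = w 0); last by ring.
move=> H1; apply: (Clim_ext _ H1); exists (mkposreal 1 Rlt_0_1) => s _ s0.
by rewrite Rminus_0_r; field => E; case: E; lra.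
Qed.

(** The one-sided derivative at 0 provides right continuity there, which extends the interior
    estimate to the endpoint by a limit. *)
Lemma lipschitz_right (T N : R) (w w1 : R -> C) (l : C) :
  (forall t, 0 < t < T -> Cder w t (w1 t)) ->
  (forall t, 0 < t < T -> Cmod (w1 t) <= N) ->
  is_right_Cderive w 0 l ->
  forall s t, 0 <= s < T -> 0 <= t < T -> Cmod (w t - w s)%C <= 2 * N * Rabs (t - s).
Proof.
move=> D1 HN /Clim_filterlim Hr.
have I s t : 0 < s < T -> 0 < t < T -> Cmod (w t - w s)%C <= 2 * N * Rabs (t - s).
  move=> sT tT; apply: (MVT_C (f := w) (f' := w1)) => y Hy; [apply: D1 | apply: HN];
  move: Hy; rewrite /Rmin /Rmax; case: Rle_dec; lra.
have C0 := right_Cder_cont Hr.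
have Z t : 0 < t < T -> Cmod (w t - w 0)%C <= 2 * N * t.
  move=> tT; assert (L := Clim_minus (Clim_const (w t)) C0); apply: (Clim_le L).
  have t0 : 0 < t by lra.
  exists (mkposreal t t0) => s Hs s0.
  move: Hs; rewrite /ball /= /AbsRing_ball /abs /minus /plus /opp /= => /Rabs_def2 [H1 _].
  apply: Rle_trans (I s t _ tT) _; first lra.
  rewrite Rabs_pos_eq; last lra.
  have N0 : 0 <= N by apply: Rle_trans (Cmod_ge_0 _) (HN t tT).
  by nra.
move=> s t [s0 sT] [t0 tT].
case: s0 => [s0|<-]; case: t0 => [t0|<-].
- by apply: I.
- by rewrite Cmod_minus_sym -Rabs_Ropp Rabs_pos_eq; [apply: Rle_trans (Z s _) _; lra | lra].
- by rewrite Rabs_pos_eq; [apply: Rle_trans (Z t _) _; lra | lra].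
- by rewrite (_ : (_ - _)%C = RtoC 0) ?Cmod_0 ?Rminus_diag ?Rabs_R0; [lra | ring].
Qed.

(** [w] is affine on the open interval. Its limit at 0 forces the form w(t) = t w1(t), and its right
    derivative at 0 forces the slope to vanish. *)
Lemma zero_of_second_derivative (T : R) (w w1 : R -> C) :
  (forall t, 0 < t < T -> Cder w t (w1 t)) ->
  (forall t, 0 < t < T -> Cder w1 t (RtoC 0)) ->
  w 0 = RtoC 0 -> is_right_Cderive w 0 (RtoC 0) ->
  forall t, 0 < t < T -> w t = RtoC 0.
Proof.
move=> D1 D2 w0 /Clim_filterlim Hr t tT.
have K s : 0 < s < T -> w1 s = w1 t.
  move=> sT; apply: Cmod_minus_eq0 => e He; apply: Rle_lt_trans He.
  apply: Rle_trans (MVT_C (f := w1) (f' := fun _ => RtoC 0) (a := t) (b := s) (L := 0) _ _) _.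
  - by move=> y Hy; apply: D2; move: Hy; rewrite /Rmin /Rmax; case: Rle_dec; lra.
  - by move=> y _; rewrite Cmod_0; lra.
  - lra.
have A s : 0 < s < T -> (w s = w t + RtoC (s - t)%R * w1 t)%C.
  move=> sT; apply: Cmod_minus_eq0 => e He; apply: Rle_lt_trans He.
  have H := MVT_C (f := fun y => (w y - RtoC y * w1 t)%C) (f' := fun _ => RtoC 0) (a := t) (b := s) (L := 0).
  rewrite (_ : (_ - _)%C = (w s - RtoC s * w1 t - (w t - RtoC t * w1 t))%C); last by rewrite RtoC_minus; ring.
  apply: Rle_trans (H _ _) _; try lra; last by move=> y _; rewrite Cmod_0; lra.
  move=> y Hy; have yT : 0 < y < T by move: Hy; rewrite /Rmin /Rmax; case: Rle_dec; lra.
  have := Cder_minus (D1 y yT) (Cder_Rmult (is_derive_id y) (Cder_const (w1 t) y)).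
  by apply: Cder_ext => //; rewrite K // /one /=; ring.
have near0 (P : R -> Prop) : (forall s, 0 < s < T -> P s) -> at_right 0 P.
  move=> HP; have T0 : 0 < T by lra.
  exists (mkposreal T T0) => s Hs s0; apply: HP; split=> //.
  by move: Hs; rewrite /ball /= /AbsRing_ball /abs /minus /plus /opp /= => /Rabs_def2 []; lra.
have id0 : Clim (at_right 0) (fun s => RtoC s) (RtoC 0).
  move=> e He; exists (mkposreal e He) => s Hs _; rewrite -RtoC_minus Cmod_R; exact: Hs.
have C0 := right_Cder_cont Hr.
have E1 : w t = (RtoC t * w1 t)%C.
  have L : Clim (at_right 0) w (w t + (RtoC 0 - RtoC t) * w1 t)%C.
    apply: (Clim_ext (f := fun s => (w t + (RtoC s - RtoC t) * w1 t)%C)).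
      by apply: near0 => s /A ->; rewrite RtoC_minus.
    apply: Clim_plus; first exact: Clim_const.
    by apply: Clim_mult; [apply: Clim_minus => //; apply: Clim_const | apply: Clim_const].
  have := Clim_unique C0 L; rewrite w0 => E.
  rewrite -[RHS]Cplus_0_l [X in _ = (X + _)%C]E; ring.
suff E2 : w1 t = RtoC 0 by rewrite E1 E2; ring.
apply: (Clim_unique (G := at_right 0) _ Hr).
apply: (Clim_ext _ (Clim_const (w1 t))); apply: near0 => s sT.
rewrite A // E1 w0 Rminus_0_r RtoC_minus; field => H; case: H; lra.
Qed.

(** * Fourier coefficients of a classical solution *)

(** In [is_Cderive_n] the first derivative is an existential witness that changes with the base
    point; uniqueness of derivatives glues these witnesses into one function. *)
Lemma is_Cderive_n2_global (f : R -> C) (l : R -> C) (D : R -> Prop) :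
  (forall t, D t -> is_Cderive_n f 2 t (l t)) ->
  exists f1, (forall t, D t -> Cder f t (f1 t)) /\ (forall t, D t -> Cder f1 t (l t)).
Proof.
move=> H; pose f1 t := ClassicalEpsilon.epsilon (inhabits (RtoC 0)) (Cder f t).
have E t k : Cder f t k -> f1 t = k.
  move=> Hk; exact: (Cder_unique (ClassicalEpsilon.epsilon_spec _ (Cder f t) (ex_intro _ k Hk)) Hk).
exists f1; split=> t /H /is_Cderive_n2_inv [g [Hg Dg]].
  by have G := locally_singleton _ _ Hg; rewrite (E _ _ G).
by apply: (Cder_ext_loc _ Dg); apply: (filter_weaken Hg) => y Hy; rewrite (E _ _ Hy).
Qed.

Lemma is_right_Cderive_minus (f g : R -> C) (x : R) (l m : C) :
  is_right_Cderive f x l -> is_right_Cderive g x m ->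
  is_right_Cderive (fun t => f t - g t)%C x (l - m)%C.
Proof.
move=> /Clim_filterlim Hf /Clim_filterlim Hg; apply/Clim_filterlim.
assert (H := Clim_minus Hf Hg); apply: (Clim_ext _ H).
by apply: filter_forall => s; rewrite /Cdiv; ring.
Qed.

Section Solution.
Context {nu : nat} (omega : 'rV[R]_nu)
  (homega : forall n : 'rV[int]_nu, n <> 0%ring -> dot n omega <> 0)
  (c c' : 'rV[int]_nu -> C) (v : R -> R -> C) (h : R -> 'rV[int]_nu -> C) (t0 K s Kc Kc' : R).
Context (t0p : 0 < t0) (s0 : 0 < s)
  (Hc : forall n, Cmod (c n) <= Kc * expw 0 n) (Hc' : forall n, Cmod (c' n) <= Kc' * expw 0 n)
  (Hv : forall t x, 0 <= t < t0 -> is_qp_sum omega (h t) x (v t x))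
  (Hbq : good_boussinesq t0 v) (Hi : initial_data omega c c' v)
  (Hh : forall n t, 0 <= t < t0 -> Cmod (h t n) <= K * expw s n).
Implicit Types (n m : 'rV[int]_nu).

Lemma solution_qp t x : 0 <= t < t0 -> qp omega (h t) x = v t x.
Proof. by move=> tT; apply: qp_eq; apply: Hv. Qed.

Lemma solution_K0 : 0 <= K.
Proof. by apply: (bound_ge0 (a := h 0) (s := s)) => n; apply: Hh; lra. Qed.

Lemma solution_utt t x : 0 < t < t0 ->
  is_Cderive_n (fun y => v y x) 2 t (qp omega (rhs omega (h t)) x).
Proof.
move=> tT; have tT' : 0 <= t < t0 by lra.
have [utt [uxxxx [uxx [u2xx [D [D4 [D2 [D2' E]]]]]]]] := Hbq x tT.
have Ha n : Cmod (h t n) <= K * expw s n by apply: Hh.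
have [a4 [a2 [a2' [A4 A2 A2' E']]]] := qp_equation omega x s0 Ha.
have V : qp omega (h t) = v t.
  by apply: functional_extensionality => y; apply: solution_qp.
rewrite V in A4 A2 A2'.
rewrite (is_Cderive_n_unique D4 A4) (is_Cderive_n_unique D2 A2)
  (is_Cderive_n_unique D2' A2') in E.
suff -> : qp omega (rhs omega (h t)) x = utt by [].
set q := qp _ _ _ in E' *.
rewrite (_ : q = (q + a4 - a2 - a2') - (utt + a4 - a2 - a2') + utt)%C; last by ring.
by rewrite E E'; ring.
Qed.

(** No bound on v_t is given. [derivative_bound] extracts one, uniform in [x], from the bounds on v
    and v_tt as series; the resulting Lipschitz estimate for v passes to each coefficient by
    [coef_dist_le]. *)
Lemma solution_lipschitz : exists2 N, 0 <= N & forall n t r, 0 <= t < t0 -> 0 <= r < t0 ->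
  Cmod (h t n - h r n)%C <= N * Rabs (t - r).
Proof.
have [D D0 HD] := rhs_bound omega s0 solution_K0.
pose V := K * 4 ^ nu; pose M := D * 4 ^ nu.
pose N := 8 * V / t0 + M * t0.
have F0 : 0 <= 4 ^ nu by apply: pow_le; lra.
have V0 : 0 <= V by apply: Rmult_le_pos solution_K0 F0.
have M0 : 0 <= M by apply: Rmult_le_pos D0 F0.
have N0 : 0 <= N.
  apply: Rplus_le_le_0_compat; last by apply: Rmult_le_pos; lra.
  by apply: Rmult_le_pos; [lra | exact/Rlt_le/Rinv_0_lt_compat].
exists (2 * N); first lra.
move=> n t r tT rT.
have Ht k : Cmod (h t k) <= K * expw s k by apply: Hh.
have Hr k : Cmod (h r k) <= K * expw s k by apply: Hh.
apply: (coef_dist_le homega n (Rlt_le _ _ s0) Ht Hr) => x.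
rewrite !solution_qp //.
have [_ [ut [_ Hut]]] := Hi x.
have [v1 [D1 D2]] := is_Cderive_n2_global (D := fun t => 0 < t < t0) (fun t tT => solution_utt x tT).
apply: (lipschitz_right (T := t0) D1 _ Hut) => //.
apply: (derivative_bound D1 D2) => y yT.
  by rewrite -solution_qp; [apply: (qp_le _ _ (Rlt_le _ _ s0)) => k; apply: Hh; lra | lra].
have s2 : 0 <= s / 2 by lra.
by apply: (qp_le _ _ s2) => k; apply: HD => m; apply: Hh; lra.
Qed.

(** With [T] strictly below [t0], clamped times stay in [0, t0), where the hypotheses on [h]
    hold. *)
Context (T : R) (HT : 0 < T < t0).

(* Clamping time to [[0, T]] makes the coefficients continuous on the whole line. *)
Definition frozen (t : R) n : C := h (clamp T t) n.

Lemma frozen_id t n : 0 <= t <= T -> frozen t n = h t n.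
Proof. by move=> H; rewrite /frozen clamp_id. Qed.

Lemma frozen_admissible : admissible s K frozen.
Proof.
have T0 : 0 <= T by lra.
split=> [n|t n]; last by apply: Hh; have := clamp_range t T0; lra.
have [N N0 HN] := solution_lipschitz.
apply: (Ccont_clamp (f := h^~ n)) => // t tT e He.
exists (e / (N + 1)); first by apply: Rdiv_lt_0_compat; lra.
move=> r rT H; apply: Rle_lt_trans (HN n r t _ _) _; try lra.
have N1 : 0 < N + 1 by lra.
have := Rmult_lt_compat_l _ _ _ N1 H.
rewrite (_ : (N + 1) * (e / (N + 1)) = e); last by field; lra.
by have := Rabs_pos (r - t); lra.
Qed.

Definition forcing (t : R) n : C := rhs omega (frozen t) n.

Lemma forcing_cont n : Ccont (forcing^~ n).
Proof.
have A := frozen_admissible.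
have s1 := Rlt_le _ _ s0.
move=> t; apply: Clim_minus; first exact: (@source_cont _ omega _ s1 _ _ n A t).
by apply: Clim_scal; apply: (proj1 A).
Qed.

(** At frequency 0 the Duhamel expression is c(n) + t c'(n) plus the double time integral of the
    forcing. *)
Definition integrated (t : R) n : C := duh 0 (c n) (c' n) (forcing^~ n) t.
Definition integrated' (t : R) n : C := duh' 0 (c n) (c' n) (forcing^~ n) t.

Lemma Cder_integrated t n : Cder (integrated^~ n) t (integrated' t n).
Proof. exact: (Cder_duh _ _ _ (@forcing_cont n)). Qed.

Lemma Cder_integrated' t n : Cder (integrated'^~ n) t (forcing t n).
Proof.
have := Cder_duh' 0 (c n) (c' n) (@forcing_cont n) t.
by apply: Cder_ext => //; rewrite pow_i; [ring | lia].
Qed.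

Lemma forcing_bound : exists D, forall t n, Cmod (forcing t n) <= D * expw 0 n.
Proof.
have [D D0 HD] := rhs_bound omega s0 solution_K0.
exists D => t n; apply: Rle_trans (HD (frozen t) _ n) _; first exact: (proj2 frozen_admissible).
by apply: Rmult_le_compat_l => //; apply: expw_le; lra.
Qed.

Lemma solution_integrated t n : 0 <= t < T -> h t n = integrated t n.
Proof.
have [D HD] := forcing_bound.
have T0 : 0 < T by lra.
have z0 : 0 <= 0 by lra.
have B0 m : Cmod (integrated 0 m) <= Kc * expw 0 m by rewrite /integrated duh_0.
have B1 m : Cmod (integrated' 0 m) <= Kc' * expw 0 m by rewrite /integrated' duh'_0.
have B2 r m : 0 <= r <= T -> Cmod (forcing r m) <= D * expw 0 m by move=> _; apply: HD.
move=> tT.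
have Hs m : Cmod (h t m) <= K * expw 0 m.
  apply: Rle_trans (Hh m _) _; first lra.
  by apply: Rmult_le_compat_l; [exact: solution_K0 | apply: expw_le; lra].
have HI m : Cmod (integrated t m) <= coef_bound T Kc Kc' D * expw 0 m.
  by apply: (coef_le Cder_integrated Cder_integrated' B0 B1 B2); lra.
apply: (coef_unique homega n z0 Hs HI) => x.
rewrite solution_qp; last lra.
have [v0 [ut [Hut Dut]]] := Hi x.
have E0 : v 0 x = qp omega (integrated 0) x.
  rewrite -(qp_eq v0); congr (qp _ _ _); apply: functional_extensionality => m.
  by rewrite /integrated duh_0.
case: (proj1 tT) => [tp|<-] //.
apply: Cmod_minus_eq0 => e He; apply: Rle_lt_trans He.
have [v1 [D1 D2]] := is_Cderive_n2_global (D := fun t => 0 < t < t0) (fun t tT => solution_utt x tT).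
rewrite (zero_of_second_derivative (T := T)
  (w := fun t => (v t x - qp omega (integrated t) x)%C)
  (w1 := fun t => (v1 t - qp omega (integrated' t) x)%C)); rewrite ?Cmod_0; try lra.
- move=> y yT; apply: Cder_minus; first by apply: D1; lra.
  exact: (qp_time_Cder1 omega T0 z0 Cder_integrated Cder_integrated' B0 B1 B2).
- move=> y yT; have D1' := D2 y ltac:(lra).
  have := Cder_minus D1' (qp_time_Cder2 omega T0 z0 Cder_integrated' B1 B2 x yT).
  apply: Cder_ext => //; rewrite (_ : forcing y = rhs omega (h y)); first ring.
  apply: functional_extensionality => m; rewrite /forcing; congr (rhs _ _ _).
  by apply: functional_extensionality => k; rewrite frozen_id //; lra.
- by rewrite E0; ring.
have := is_right_Cderive_minus Dut (@qp_time_right _ omega T _ _ _ _ _ _ _ T0 z0 Cder_integrated Cder_integrated' B0 B1 B2 x).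
rewrite (_ : integrated' 0 = c'); last first.
  by apply: functional_extensionality => m; rewrite /integrated' duh'_0.
rewrite (qp_eq Hut) (_ : (ut - ut)%C = RtoC 0) //; ring.
Qed.
End Solution.

(** * The integral equation in exponential form *)

Lemma prim_const0 (t : R) : prim (fun _ => RtoC 0) t = RtoC 0.
Proof. by rewrite /prim /= !RInt_const /scal /= /mult /= Rmult_0_r. Qed.

Lemma duh_zero (l : R) (a b : C) (f : R -> C) t : (forall s, f s = RtoC 0) ->
  duh l a b f t = (RtoC (cos (l * t)) * a + RtoC (sinl l t) * b)%C.
Proof.
move=> f0; rewrite /duh /prim_cos /prim_sin.
rewrite (_ : (fun s => RtoC (sinl l s) * f s)%C = fun _ => RtoC 0); last first.
  by apply: functional_extensionality => s; rewrite f0; ring.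
rewrite (_ : (fun s => RtoC (cos (l * s)) * f s)%C = fun _ => RtoC 0); last first.
  by apply: functional_extensionality => s; rewrite f0; ring.
by rewrite !prim_const0; ring.
Qed.

Lemma expi_opp_minus t : (expi (- t) - expi t)%C = (- (RtoC 2 * Ci * RtoC (sin t)))%C.
Proof. by apply: injective_projections; rewrite /= ?cos_neg ?sin_neg; ring. Qed.

Lemma expi_opp_plus t : (expi t + expi (- t))%C = (RtoC 2 * RtoC (cos t))%C.
Proof. by apply: injective_projections; rewrite /= ?cos_neg ?sin_neg; ring. Qed.

Lemma sin_sinl l t : sin (l * t) = l * sinl l t.
Proof. by rewrite /sinl; case: Req_EM_T => H /=; [rewrite H !Rmult_0_l sin_0 | field]. Qed.

Lemma RtoC_neq0 x : x <> 0 -> RtoC x <> RtoC 0.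
Proof. by move=> H []. Qed.

Lemma sine_kernelE l t : sine_kernel l t = RtoC (sinl l t).
Proof.
rewrite /sine_kernel /sinl; case: Req_EM_T => H //=.
have -> : (expi (t * l) - expi (- (t * l)))%C = (RtoC 2 * Ci * RtoC (sin (l * t)))%C.
  by apply: injective_projections; rewrite /= ?cos_neg ?sin_neg (Rmult_comm t); ring.
have I2 : (Ci * Ci = - RtoC 1)%C by apply: injective_projections; rewrite /=; ring.
rewrite RtoC_div // RtoC_mult.
transitivity (- (Ci * Ci) * (RtoC (sin (l * t)) / RtoC l))%C; last by rewrite I2; ring.
by field; apply: RtoC_neq0.
Qed.

Lemma disp_eq0 {nu} (omega : 'rV[R]_nu) n : disp omega n = 0 -> dot n omega = 0.
Proof.
move=> E; have := disp_sqr omega n; rewrite E pow_i; last lia.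
have := pow2_ge_0 (dot n omega); have := pow2_ge_0 (dot n omega ^ 2) => A A2 H.
have {}H : dot n omega ^ 2 = 0 by move: A; rewrite -pow_mult /= in H *; lra.
by apply: Rsqr_0_uniq; rewrite Rsqr_pow2.
Qed.

Lemma duhamel_formula_of_fixpoint {nu} (omega : 'rV[R]_nu) (c c' : 'rV[int]_nu -> C)
    (sigma K t : R) (z ct : R -> 'rV[int]_nu -> C) (n : 'rV[int]_nu) :
  0 < sigma -> admissible sigma K z ->
  (forall r m, 0 <= r <= t -> ct r m = z r m) -> ct t n = duhamel omega c c' z t n ->
  duhamel_formula omega c c' ct t n.
Proof.
move=> s0 az E Et; set l := disp omega n.
have s2 : sigma / 2 < sigma by lra.
have sw := Rlt_le _ _ s0.
have fc : Ccont (source omega z n) by apply: source_cont az.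
(* The 1/2 comes from the symmetrisation in [conv_dot]; it cancels against the 2 in e^{-i theta} -
   e^{i theta} = - 2 i sin theta. *)
exists (fun r => RtoC (dot n omega ^ 2 / 2) * conv (z r) (z r) n)%C.
(* The integrand is i l times sinl(l, t - s) times the source, so [J] is i l times the Duhamel
   integral and -(i / l) J gives that integral back. For l = 0 one has n.omega = 0, and the source
   vanishes. *)
exists (Ci * RtoC l * (duh l (c n) (c' n) (source omega z n) t - RtoC (cos (l * t)) * c n - RtoC (sinl l t) * c' n))%C.
split; [|split].
- move=> r rt; have Hz m : Cmod (z r m) <= K * expw sigma m by apply: (proj2 az).
  (* The factor m.omega costs half of the rate, and [conv_dot] wants both bounds at one common
     rate. *)
  have [L L0 HL] := dot_pow_bound omega 1 s2 Hz.
  have Hz2 m : Cmod (z r m) <= K * expw (sigma / 2) m.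
    apply: Rle_trans (Hz m) _; apply: Rmult_le_compat_l (bound_ge0 Hz) _.
    by apply: expw_le; lra.
  have HL' m : Cmod (RtoC (dot m omega) * z r m)%C <= L * expw (sigma / 2) m.
    by have := HL m; rewrite Cmod_mult Cmod_R pow_1 Rmult_comm.
  apply: is_usum_ext (conv_dot n _ Hz2 HL'); last lra.
  by move=> m; rewrite !E.
- have := @duh_RInt l (c n) (c' n) _ fc (Ci * RtoC l)%C t.
  apply: is_RInt_ext => r _; rewrite -/l.
  have -> : (r - t) * l = - ((t - r) * l) by ring.
  rewrite expi_opp_minus (Rmult_comm (t - r)) sin_sinl RtoC_mult.
  have -> : RtoC (dot n omega ^ 2 / 2) = (RtoC (dot n omega ^ 2) * RtoC (/ 2))%C by rewrite -RtoC_mult.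
  have half : (RtoC 2 * RtoC (/ 2) = 1)%C by rewrite -RtoC_mult; congr RtoC; lra.
  rewrite /source; match goal with |- @eq _ ?x ?y => change (@eq C x y) end.
  transitivity (Ci * (RtoC l * (RtoC (sinl l (t - r)) *
    - (RtoC (dot n omega ^ 2) * conv (z r) (z r) n))) * (RtoC 2 * RtoC (/ 2)))%C; last by ring.
  by rewrite half; ring.
rewrite Et sine_kernelE expi_opp_plus (Rmult_comm t).
have -> : (RtoC (1 / 2) * c n * (RtoC 2 * RtoC (cos (l * t))) = RtoC (cos (l * t)) * c n)%C.
  by apply: injective_projections; rewrite /=; field.
rewrite /integral_term; case: Req_EM_T => H /=.
  have d0 := disp_eq0 H.
  rewrite /duhamel duh_zero; first by rewrite -/l; ring.
  by move=> r; rewrite /source d0 pow_i; [ring | lia].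
rewrite /duhamel -/l; set D := duh _ _ _ _ _.
have I2 : (Ci * Ci = - RtoC 1)%C by apply: injective_projections; rewrite /=; ring.
have -> : (- (Ci / RtoC l) * (Ci * RtoC l * (D - RtoC (cos (l * t)) * c n - RtoC (sinl l t) * c' n)) =
   - (Ci * Ci) * (D - RtoC (cos (l * t)) * c n - RtoC (sinl l t) * c' n))%C.
  by field; apply: RtoC_neq0.
by rewrite I2; ring.
Qed.

Lemma Rsmall (a b T : R) : 0 <= a -> 0 < b -> 0 <= T <= b / (a + 1) -> T * a <= b.
Proof.
move=> a0 b0 [T0 HT]; have := Rmult_le_compat_r (a + 1) _ _ ltac:(lra) HT.
by rewrite (_ : b / (a + 1) * (a + 1) = b); [nra | field; lra].
Qed.

Lemma bound_weaken {nu} (a : 'rV[int]_nu -> C) (K L s s' : R) :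
  K <= L -> s' <= s -> (forall n, Cmod (a n) <= K * expw s n) ->
  forall n, Cmod (a n) <= L * expw s' n.
Proof.
move=> KL ss Ha n; have K0 := bound_ge0 Ha; apply: Rle_trans (Ha n) _.
by apply: Rmult_le_compat => //; [exact/Rlt_le/expw_gt0 | exact: expw_le].
Qed.

(** * Uniqueness and existence for a short time *)

(** The rates of [z] and [h] are unrelated, so they are compared at rate 0, where the weight still
    controls convolutions. The difference is an oscillator with zero data, and each application of
    [oscillator_le] halves its bound; the induction on [k] avoids a supremum of the difference. *)
Lemma local_uniqueness {nu} (omega : 'rV[R]_nu)
    (homega : forall n : 'rV[int]_nu, n <> 0%ring -> dot n omega <> 0)
    (c c' : 'rV[int]_nu -> C) (v : R -> R -> C) (h z : R -> 'rV[int]_nu -> C)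
    (t0 sigma K s L Kc Kc' : R) :
  0 < t0 -> 0 < sigma -> 0 < s ->
  (forall n, Cmod (c n) <= Kc * expw 0 n) -> (forall n, Cmod (c' n) <= Kc' * expw 0 n) ->
  admissible sigma K z -> (forall t n, 0 <= t < t0 -> z t n = duhamel omega c c' z t n) ->
  (forall t x, 0 <= t < t0 -> is_qp_sum omega (h t) x (v t x)) ->
  good_boussinesq t0 v -> initial_data omega c c' v ->
  (forall n t, 0 <= t < t0 -> Cmod (h t n) <= L * expw s n) ->
  exists t1, 0 < t1 < t0 /\ forall t n, 0 <= t <= t1 -> h t n = z t n.
Proof.
move=> t0p sg0 s0 Hc Hc' az Hz Hv Hbq Hi Hh.
pose T := t0 / 2; have HT : 0 < T < t0 by rewrite /T; lra.
have hI := solution_integrated homega t0p s0 Hc Hc' Hv Hbq Hi Hh HT.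
have D1 := Cder_integrated homega t0p s0 Hv Hbq Hi Hh HT.
have D2 := Cder_integrated' homega t0p s0 Hv Hbq Hi Hh HT.
have L0 : 0 <= L by apply: (bound_ge0 (a := h 0) (s := s)) => n; apply: Hh; lra.
have K0 : 0 <= K := bound_ge0 (proj2 az 0).
pose M := K + L; have M0 : 0 <= M by rewrite /M; lra.
have A0 := conv_cst_gt0 (nu := nu); set A := conv_cst in A0.
have Bz t n : Cmod (z t n) <= M * expw 0 n.
  by apply: (bound_weaken _ _ (proj2 az t)); rewrite /M; lra.
have Bh t n : 0 <= t < t0 -> Cmod (h t n) <= M * expw 0 n.
  by move=> tT; apply: (bound_weaken (s := s) (K := L)); [rewrite /M; lra | lra | move=> m; apply: Hh].
have MA : 0 <= 8 * M * A by apply: Rmult_le_pos; lra.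
(* [T / 2] keeps times strictly below [T], as [solution_integrated] requires; the other bound makes
   4 M A t, the factor gained in one pass, at most 1/2. *)
pose t1 := Rmin (T / 2) (1 / (8 * M * A + 1)).
have t1p : 0 < t1 by apply: Rmin_pos; [lra | apply: Rdiv_lt_0_compat; lra].
have t1T : t1 <= T / 2 by apply: Rmin_l.
have t1M : t1 * (8 * M * A) <= 1.
  by apply: Rsmall => //; [lra | split; [lra | exact: Rmin_r]].
have step k : forall t n, 0 <= t <= t1 -> Cmod (h t n - z t n)%C <= 2 * M * (1 / 2) ^ k * expw 0 n.
  elim: k => [|k IH] t n tT.
    apply: Rle_trans (Cmod_triangle _ _) _; rewrite Cmod_opp /=.
    by have := Bz t n; have := Bh t n ltac:(lra); lra.
  (* Outside [0, t0) the values of [h] are arbitrary. It is replaced by [integrated], and [z] by its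
     Duhamel expression, which are differentiable on the whole line. *)
  have E r m : 0 <= r <= t1 -> (h r m - z r m =
      integrated omega c c' h T r m - duhamel omega c c' z r m)%C.
    by move=> rT; rewrite -hI -?Hz //; lra.
  rewrite E //.
  pose F r := (- (RtoC (dot n omega ^ 2) * (conv (h r) (h r) n - conv (z r) (z r) n)))%C.
  have e0 := expw_gt0 0 n.
  set N := 2 * M * (1 / 2) ^ k in IH.
  have N0 : 0 <= N by apply: Rmult_le_pos; [lra | apply: pow_le; lra].
  apply: Rle_trans (oscillator_le (l := disp omega n) (L := 2 * M * N * A * expw 0 n) (F := F)
    (y := fun r => (integrated omega c c' h T r n - duhamel omega c c' z r n)%C)
    (y1 := fun r => (integrated' omega c c' h T r n - duh' (disp omega n) (c n) (c' n) (source omega z n) r)%C)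
    _ _ _ _ _ _) _.
  - lra.
  - move=> r _; apply: Cder_minus; first exact: D1.
    by apply: Cder_duh; apply: (source_cont omega (Rlt_le _ _ sg0) n az).
  - move=> r rt.
    have := Cder_minus (D2 r n) (Cder_duh' (disp omega n) (c n) (c' n) (source_cont omega (Rlt_le _ _ sg0) n az) r).
    apply: Cder_ext => //; rewrite -/(duhamel omega c c' z r n).
    have -> : forcing omega h T r n = rhs omega (h r) n.
      rewrite /forcing; congr (rhs _ _ _); apply: functional_extensionality => m.
      by rewrite frozen_id //; lra.
    rewrite -hI -?Hz; try lra; rewrite /rhs /F /source; ring.
  - by rewrite /integrated /duhamel !duh_0; ring.
  - by rewrite /integrated' !duh'_0; ring.
  - move=> r rt; apply: Rle_trans (kernel_le _ _ _ _) _.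
    apply: conv_sub_le; try lra; [by move=> m; apply: Bh; lra | exact: Bz | by move=> m; apply: IH; lra].
  rewrite -tech_pow_Rmult.
  have : t * (8 * M * A) <= 1 by apply: Rle_trans t1M; apply: Rmult_le_compat_r; lra.
  have X : 0 <= N * expw 0 n by apply: Rmult_le_pos; lra.
  move=> Y; have := Rmult_le_compat_r _ _ _ X Y; rewrite /N; lra.
exists t1; split; first lra.
move=> t n tT; apply: Cmod_minus_eq0 => e He; apply: Rle_lt_trans He.
apply: (@le0_of_half_pow _ (2 * M * expw 0 n)) => k.
by have := step k t n tT; lra.
Qed.

Lemma local_existence {nu} (omega : 'rV[R]_nu) (c c' : 'rV[int]_nu -> C) (B W kappa : R) :
  0 < B -> 0 <= W -> 0 < kappa ->
  (forall n, Cmod (c n) <= B * exp (- (kappa * l1normZ n / 2))) ->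
  (forall n, Cmod (c' n) <= B * W * exp (- (kappa * l1normZ n / 2))) ->
  exists t0 K z, [/\ 0 < t0, admissible (kappa / 4) K z,
    forall t n, 0 <= t <= t0 -> z t n = duhamel omega c c' z t n &
    forall t n, 0 <= t <= t0 ->
      Cmod (duhamel omega c c' z t n) <= 2 * B * exp (- (kappa * l1normZ n / 4))].
Proof.
move=> B0 W0 k0 Hc Hc'.
have [D Dp HD] := exp_le_expw (nu := nu) (s := kappa / 2) (s' := kappa / 4) ltac:(lra).
have HD' (n : 'rV[int]_nu) : exp (- (kappa * l1normZ n / 2)) <= D * expw (kappa / 4) n.
  by apply: Rle_trans (HD n); apply: Req_le; congr exp; lra.
have A0 := conv_cst_gt0 (nu := nu); set A := conv_cst in A0.
(* In the weight, the data contribute at most 3/2 B D and the nonlinear term at most B D. *)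
pose K := 4 * B * D; have Kp : 0 < K by rewrite /K; repeat apply: Rmult_lt_0_compat; lra.
have BD : 0 < B * D by apply: Rmult_lt_0_compat.
have KA : 0 < K * A by apply: Rmult_lt_0_compat.
have KKA : 0 < K * K * A by rewrite Rmult_assoc; apply: Rmult_lt_0_compat.
(* [1 / 2] controls T W and the contraction factor, [B * D] the self-map condition, and [B / 2] is
   what the data bound 3/2 B leaves below 2 B. Since T a <= b, each term collected in [a] is
   controlled by all three. *)
pose b := Rmin (1 / 2) (Rmin (B * D) (B / 2)).
have bp : 0 < b by apply: Rmin_pos; [lra | apply: Rmin_pos; lra].
have b1 : b <= 1 / 2 by apply: Rmin_l.
have b2 : b <= B * D by apply: Rle_trans (Rmin_r _ _) (Rmin_l _ _).
have b3 : b <= B / 2 by apply: Rle_trans (Rmin_r _ _) (Rmin_r _ _).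
pose a := W + 4 * (K * A) + 2 * (K * K * A).
have ap : 0 <= a by rewrite /a; lra.
pose T := b / (a + 1).
have Tp : 0 < T by apply: Rdiv_lt_0_compat; lra.
have Ta : T * a <= b by apply: Rsmall => //; split; [lra | exact: Rle_refl].
have [TW [TKA TKKA]] : 0 <= T * W /\ 0 < T * (K * A) /\ 0 < T * (K * K * A).
  by split; [apply: Rmult_le_pos; lra | split; apply: Rmult_lt_0_compat].
have Ta' : T * W + 4 * (T * (K * A)) + 2 * (T * (K * K * A)) <= b by move: Ta; rewrite /a; lra.
(* The data term stays a plain exponential here. Passing to the weight yields the self-map condition
   [HK1]; passing to rate kappa / 4 without the weight yields the bound 2 B. *)
have HK (n : 'rV[int]_nu) : Cmod (c n) + T * Cmod (c' n) +
    2 * (K * K * conv_cst (nu := nu) * expw (kappa / 4) n) * T <=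
    3 / 2 * B * exp (- (kappa * l1normZ n / 2)) + b * expw (kappa / 4) n.
  rewrite -/A; have e0 := expw_gt0 (kappa / 4) n; have x0 := exp_pos (- (kappa * l1normZ n / 2)).
  have H1 := Hc n; have H2 := Rmult_le_compat_l T _ _ (Rlt_le _ _ Tp) (Hc' n).
  set x := exp _ in x0 H1 H2 *; set e := expw _ _ in e0 *.
  have H3 : T * W * (B * x) <= 1 / 2 * (B * x).
    by apply: Rmult_le_compat_r; [apply: Rmult_le_pos; lra | lra].
  have H4 : 2 * (T * (K * K * A)) * e <= b * e by apply: Rmult_le_compat_r; lra.
  lra.
have HK1 (n : 'rV[int]_nu) : Cmod (c n) + T * Cmod (c' n) +
    2 * (K * K * conv_cst (nu := nu) * expw (kappa / 4) n) * T <= K * expw (kappa / 4) n.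
  apply: Rle_trans (HK n) _; have e0 := expw_gt0 (kappa / 4) n.
  have := Rmult_le_compat_l B _ _ (Rlt_le _ _ B0) (HD' n).
  have := Rmult_le_compat_r _ _ _ (Rlt_le _ _ e0) b2.
  have : 0 < B * D * expw (kappa / 4) n by apply: Rmult_lt_0_compat.
  by rewrite /K; lra.
have HT : 4 * K * conv_cst (nu := nu) * T <= 1 / 2 by rewrite -/A; lra.
have sg : 0 <= kappa / 4 by lra.
have [z az Hz] := picard_fixpoint omega sg (Rlt_le _ _ Kp) (Rlt_le _ _ Tp) HK1 HT.
exists T, K, z; split=> //.
move=> t n [t0 tT].
apply: Rle_trans (duhamel_le omega c c' sg n az t0) _.
apply: (Rle_trans _ (Cmod (c n) + T * Cmod (c' n) + 2 * (K * K * conv_cst (nu := nu) * expw (kappa / 4) n) * T)).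
  have e0 := expw_gt0 (kappa / 4) n.
  have : 0 <= K * K * A * expw (kappa / 4) n by apply: Rmult_le_pos; lra.
  rewrite -/A => X; have := Rmult_le_compat_l _ _ _ X tT.
  by have := Rmult_le_compat_r _ _ _ (Cmod_ge_0 (c' n)) tT; lra.
apply: Rle_trans (HK n) _.
have E1 : exp (- (kappa * l1normZ n / 2)) <= exp (- (kappa * l1normZ n / 4)).
  have : - (kappa * l1normZ n / 2) <= - (kappa * l1normZ n / 4).
    by have := Rmult_le_pos _ _ (Rlt_le _ _ k0) (l1normZ_ge0 n); lra.
  by case=> [/exp_increasing|->]; lra.
have E2 : expw (kappa / 4) n <= exp (- (kappa * l1normZ n / 4)).
  by apply: Rle_trans (expw_le_exp _ _) _; apply: Req_le; congr exp; lra.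
have x0 := exp_pos (- (kappa * l1normZ n / 4)).
have e0 := expw_gt0 (kappa / 4) n.
have := Rmult_le_compat_l _ _ _ (Rlt_le _ _ B0) E1.
have := Rmult_le_compat _ _ _ _ (Rlt_le _ _ bp) (Rlt_le _ _ e0) b3 E2.
lra.
Qed.

Theorem theorem1p1 (nu : nat) (hnu : (1 <= nu)%nat) (omega : 'rV[R]_nu)
    (homega : forall n : 'rV[int]_nu, n <> 0%ring -> dot n omega <> 0)
    (c c' : 'rV[int]_nu -> C) (B kappa : R) (hB : 0 < B) (hkappa : 0 < kappa)
    (hc : forall n : 'rV[int]_nu,
        Cmod (c n) <= B * exp (- (kappa * l1normZ n / 2)))
    (hc' : forall n : 'rV[int]_nu,
        Cmod (c' n) <= B * l1norm omega * exp (- (kappa * l1normZ n / 2))) :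
  exists t0 : R, 0 < t0 /\
  exists (u : R -> R -> C) (ct : R -> 'rV[int]_nu -> C),
    (forall t x : R, 0 <= t < t0 -> is_qp_sum omega (ct t) x (u t x)) /\
    good_boussinesq t0 u /\
    initial_data omega c c' u /\
    (forall (n : 'rV[int]_nu) (t : R), 0 <= t < t0 ->
       duhamel_formula omega c c' ct t n /\
       Cmod (ct t n) <= 2 * B * exp (- (kappa * l1normZ n / 4))) /\
    (forall (v : R -> R -> C) (h : R -> 'rV[int]_nu -> C) (C1 rho : R),
       0 < C1 -> 0 < rho ->
       (forall t x : R, 0 <= t < t0 -> is_qp_sum omega (h t) x (v t x)) ->
       good_boussinesq t0 v ->
       initial_data omega c c' v ->
       (forall (n : 'rV[int]_nu) (t : R), 0 <= t < t0 ->
          Cmod (h t n) <= C1 * exp (- (rho * l1normZ n))) ->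
       exists t1 : R, 0 < t1 < t0 /\
         forall t x : R, 0 <= t <= t1 -> v t x = u t x).
Proof.
have W0 := l1norm_ge0 omega.
have [T [K [z [T0 az Hz HB]]]] := local_existence omega hB W0 hkappa hc hc'.
have sg : 0 < kappa / 4 by lra.
have sw := Rlt_le _ _ sg.
have K0 : 0 <= K := bound_ge0 (proj2 az 0).
have [Dc Dc0 HDc] := exp_le_expw (nu := nu) (s := kappa / 2) (s' := kappa / 4) ltac:(lra).
have HDc' (n : 'rV[int]_nu) : exp (- (kappa * l1normZ n / 2)) <= Dc * expw (kappa / 4) n.
  by apply: Rle_trans (HDc n); apply: Req_le; congr exp; lra.
have Bc n : Cmod (c n) <= B * Dc * expw (kappa / 4) n.
  by apply: Rle_trans (hc n) _; rewrite Rmult_assoc; apply: Rmult_le_compat_l; [lra | exact: HDc'].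
have Bc' n : Cmod (c' n) <= B * l1norm omega * Dc * expw (kappa / 4) n.
  apply: Rle_trans (hc' n) _; rewrite [X in _ <= X]Rmult_assoc.
  by apply: Rmult_le_compat_l; [apply: Rmult_le_pos; lra | exact: HDc'].
(* [z] is merely continuous in time. Its Duhamel transform agrees with it on [0, T] and is twice
   differentiable on the whole line. *)
pose ct := duhamel omega c c' z.
have ctz t : 0 <= t <= T -> ct t = z t.
  by move=> tT; apply: functional_extensionality => n; rewrite /ct -Hz.
have ctK t : 0 <= t <= T -> forall n, Cmod (ct t n) <= K * expw (kappa / 4) n.
  by move=> tT n; rewrite ctz //; apply: (proj2 az).
pose ct1 t n := duh' (disp omega n) (c n) (c' n) (source omega z n) t.
pose ct2 t n := (source omega z n t - RtoC (disp omega n ^ 2) * ct t n)%C.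
have fc n : Ccont (source omega z n) := source_cont omega sw n az.
have D1 t n : Cder (ct^~ n) t (ct1 t n) by apply: Cder_duh.
have D2 t n : Cder (ct1^~ n) t (ct2 t n) by apply: Cder_duh'.
have ct0 : ct 0 = c by apply: functional_extensionality => n; rewrite /ct /duhamel duh_0.
have ct10 : ct1 0 = c' by apply: functional_extensionality => n; rewrite /ct1 duh'_0.
have ct2E t : 0 <= t <= T -> ct2 t = rhs omega (ct t).
  by move=> tT; apply: functional_extensionality => n; rewrite /ct2 /rhs /source ctz.
have [M M0 HM] := rhs_bound omega sg K0.
(* [rhs_bound] halves the rate to absorb the powers of n.omega, so the time derivatives are summed
   at rate kappa / 8. *)
have s8 : 0 <= kappa / 4 / 2 by lra.
have B0 n : Cmod (ct 0 n) <= B * Dc * expw (kappa / 4 / 2) n.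
  by rewrite ct0; apply: (bound_weaken _ _ Bc); lra.
have B1 n : Cmod (ct1 0 n) <= B * l1norm omega * Dc * expw (kappa / 4 / 2) n.
  by rewrite ct10; apply: (bound_weaken _ _ Bc'); lra.
have B2 t n : 0 <= t <= T -> Cmod (ct2 t n) <= M * expw (kappa / 4 / 2) n.
  by move=> tT; rewrite ct2E //; apply: HM; apply: ctK.
exists T; split=> //; exists (fun t x => qp omega (ct t) x), ct.
split; [|split; [|split; [|split]]].
- by move=> t x tT; apply: (qpP omega x sw (K := K)); apply: ctK; lra.
- move=> t x tT.
  have tT' : 0 <= t <= T by lra.
  have [uxxxx [uxx [u2xx [D4 Dxx D2xx E]]]] := qp_equation omega x sg (ctK t tT').
  exists (qp omega (rhs omega (ct t)) x), uxxxx, uxx, u2xx; split=> //.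
  apply: (is_Cderive_n2 (f1 := fun s => qp omega (ct1 s) x)).
    have d0 : 0 < Rmin t (T - t) by apply: Rmin_pos; lra.
    exists (mkposreal _ d0) => y Hy; apply: (qp_time_Cder1 omega T0 s8 D1 D2 B0 B1 B2).
    move: Hy; rewrite /ball /= /AbsRing_ball /abs /minus /plus /opp /= => /Rabs_def2 [].
    by have := Rmin_l t (T - t); have := Rmin_r t (T - t); lra.
  by rewrite -ct2E //; apply: (qp_time_Cder2 omega T0 s8 D2 B1 B2).
- move=> x; split; first by rewrite ct0; apply: qpP sw Bc.
  exists (qp omega c' x); split; first exact: qpP sw Bc'.
  by rewrite -ct10; apply: (@qp_time_right _ omega T _ _ _ _ _ _ _ T0 s8 D1 D2 B0 B1 B2).
- move=> n t tT; split; last by apply: HB; lra.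
  apply: (duhamel_formula_of_fixpoint sg az) => // r m rt.
  by rewrite ctz //; lra.
move=> v h C1 rho C10 rho0 Hv Hbq Hi Hh.
have [Dr Dr0 HDr] := exp_le_expw (nu := nu) (s := rho) (s' := rho / 2) ltac:(lra).
have Hh' n t : 0 <= t < T -> Cmod (h t n) <= C1 * Dr * expw (rho / 2) n.
  move=> tT; apply: Rle_trans (Hh n t tT) _; rewrite Rmult_assoc.
  by apply: Rmult_le_compat_l; [lra | exact: HDr].
have r2 : 0 < rho / 2 by lra.
have Bc0 n : Cmod (c n) <= B * Dc * expw 0 n by apply: (bound_weaken _ _ Bc); lra.
have Bc0' n : Cmod (c' n) <= B * l1norm omega * Dc * expw 0 n by apply: (bound_weaken _ _ Bc'); lra.
have Hz' t n : 0 <= t < T -> z t n = duhamel omega c c' z t n by move=> tT; apply: Hz; lra.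
have [t1 [t1T E]] := local_uniqueness homega T0 sg r2 Bc0 Bc0' az Hz' Hv Hbq Hi Hh'.
exists t1; split=> // t x tt.
rewrite ctz; last lra.
rewrite -(qp_eq (Hv t x ltac:(lra))); congr (qp _ _ _).
by apply: functional_extensionality => n; apply: E.
Qed.
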